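(* Let $\mathcal{H}(T,A,\mu)$ and $\mathcal{H}(\tilde T,\tilde A,\tilde\mu)$ be two Cauchy--de Branges spaces of the convergence class and of finite order, and let $$B_\gamma(z)=A(z)\Big(\gamma+\sum_n\frac{\mu_n}{t_n-z}\Big),\qquad \tilde B_\gamma(z)=\tilde A(z)\Big(\gamma+\sum_n\frac{\tilde\mu_n}{\tilde t_n-z}\Big).$$ If there exist $\alpha,\beta\in\mathbb{C}\setminus\{0\}$, $\alpha\ne\beta$, such that $\mathcal{Z}(B_\alpha)=\mathcal{Z}(\tilde B_\alpha)$ and $\mathcal{Z}(B_\beta)=\mathcal{Z}(\tilde B_\beta)$ (counting multiplicities), then $\tilde T=T$, $\tilde\mu=\mu$ (i.e. $\tilde\mu_n=\mu_n$ at each point $t_n$) and $\tilde A=SA$ for some entire function $S$ without zeros.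
   Context: Let $T=\{t_n\}_{n\ge1}\subset\mathbb{C}$ be a set of distinct points with $|t_n|\to\infty$, and let $\mu_n>0$ satisfy $\sum_n\frac{\mu_n}{|t_n|^2+1}<\infty$; write $\mu=\sum_n\mu_n\delta_{t_n}$. Let $A$ be an entire function with simple zeros exactly at the points of $T$ and no other zeros. The Cauchy--de Branges space is $\mathcal{H}(T,A,\mu)=\{F(z)=A(z)\sum_n\frac{c_n\mu_n^{1/2}}{z-t_n}:(c_n)\in\ell^2\}$ with norm $\|F\|=\|(c_n)\|_{\ell^2}$. It is of the convergence class if $\sum_n\frac{\mu_n}{|t_n|+1}<\infty$, and of finite order if all its elements are entire functions of finite order (equivalently, $A$ has finite order). $\mathcal{Z}(f)$ denotes the zero set of $f$. *)

(* Defs.v *)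
From Stdlib Require Import Reals.
From Coquelicot Require Import Coquelicot.

Open Scope C_scope.

Definition entire (f : C -> C) : Prop :=
  forall z : C, ex_derive (K := C_AbsRing) (V := C_NormedModule) f z.

Definition finite_order (f : C -> C) : Prop :=
  exists (K : R) (N : nat), forall z : C,
    (Cmod (f z) <= K * exp ((1 + Cmod z) ^ N))%R.

Definition zero_order (f : C -> C) (w : C) (m : nat) : Prop :=
  exists g : C -> C, entire g /\ g w <> 0 /\ forall z, f z = (z - w) ^ m * g z.

Definition same_zeros (f g : C -> C) : Prop :=
  forall (w : C) (m : nat), zero_order f w m <-> zero_order g w m.

Definition CdB_data (t : nat -> C) (A : C -> C) (mu : nat -> R) : Prop :=
  (forall n m, t n = t m -> n = m) /\
  is_lim_seq (fun n => Cmod (t n)) p_infty /\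
  (forall n, 0 < mu n)%R /\
  ex_series (fun n => mu n / (Cmod (t n) ^ 2 + 1))%R /\
  entire A /\
  (forall z, A z = 0 <-> exists n, z = t n) /\
  (forall n, zero_order A (t n) 1).

Definition convergence_class (t : nat -> C) (mu : nat -> R) : Prop :=
  ex_series (fun n => mu n / (Cmod (t n) + 1))%R.

(* the space H(T,A,mu) is of finite order iff A is *)
Definition CdB_finite_order (A : C -> C) : Prop := finite_order A.

Definition Ceq_dec (z w : C) : {z = w} + {z <> w}.
Proof.
  destruct z as [a b], w as [c d].
  destruct (Req_EM_T a c) as [->|h]; [|right; congruence].
  destruct (Req_EM_T b d) as [->|h]; [left; reflexivity|right; congruence].
Defined.

Definition CSeries (a : nat -> C) : C :=
  (Series (fun n => Re (a n)), Series (fun n => Im (a n))).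

(* A z / (t_n - z), extended continuously at z = t_n by -A'(t_n) *)
Definition Bterm (A : C -> C) (t : nat -> C) (n : nat) (z : C) : C :=
  if Ceq_dec z (t n) then - C_derive A (t n) else A z / (t n - z).

Definition Bgam (t : nat -> C) (A : C -> C) (mu : nat -> R) (gamma : C) (z : C) : C :=
  gamma * A z + CSeries (fun n => RtoC (mu n) * Bterm A t n z).

(* Main.v *)
(** Equal zeros give zero-free entire functions [Sa], [Sb] with [B~_alpha = Sa B_alpha] and [B~_beta = Sb B_beta].
With [f], [f~] the two Cauchy transforms, [R = Sa / Sb = exp phi] satisfies
[R (alpha + f) (beta + f~) = (alpha + f~) (beta + f)] off the poles.
The convergence class hypothesis provides arbitrarily large circles on which [f] and [f~] are small in mean,
which bounds the mean of [log+] of the factors; that of [log-] is controlled by Jensen's inequality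
for the functions [B] and the finite order of [A] and [A~].
So the mean of [|Re phi|] is [O(r^N)] and [phi] is a polynomial, say of degree [d]. Now [|Re phi| <= C r^d (|f| + |f~|)] pointwise
on these circles, whose mean is [o(r^d)]: the leading coefficient vanishes unless [d = 0], and then [R = 1].
With [Sa = Sb = S], subtracting the two identities gives [A~ = S A], and [T] and [mu] are read off
from the zeros of [A] and the values of [B] there. *)

Require Import Defs.
From Stdlib Require Import Reals Lra Lia Psatz ClassicalEpsilon.
From Coquelicot Require Import Coquelicot.

Open Scope C_scope.

(** * Complex differentiability *)

(** The points may have arbitrarily close moduli, so no circle stays at a controlled distance from
    all poles. What survives is that the mean of 1/|a - z| over |z| = r is at most | |a|^2 - r^2
    |^(-1/2), whose singularity is integrable in r: averaging over rho < r < 2 rho yields one radius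
    that serves both families. All circles are centred at [t O], where every B_gamma is nonzero;
    this makes Jensen's lower bound finite, and the zero-free factor carries it over to the second
    space. The growth step only needs an upper bound for u = Re phi, because |u| = 2 max(u, 0) - u
    and u has constant mean. Logarithms are taken of |.| + eta, so that every integrand is
    continuous and zeros on the circle do no harm. The pointwise bound for |Re phi| has two sources.
    Where f and f~ are small, ln|alpha| and ln|beta| cancel in the logarithm of the identity; this
    uses that alpha and beta are nonzero. Elsewhere |f| + |f~| is bounded below, and the growth r^d
    of phi already suffices. *)

Lemma Cmod_sub_sym (x y : C) : Cmod (x - y) = Cmod (y - x).
Proof. rewrite <- Cmod_opp. f_equal. ring. Qed.

Lemma Cmod_sub_ge (x y : C) : Cmod x - Cmod y <= Cmod (x - y).
Proof.
  pose proof (Cmod_triangle (x - y) y) as H.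
  replace (x - y + y) with x in H by ring. lra.
Qed.

Lemma Cmod_add_ge (x y : C) : Cmod x - Cmod y <= Cmod (x + y).
Proof.
  pose proof (Cmod_sub_ge x (- y)) as H. rewrite Cmod_opp in H.
  replace (x - - y) with (x + y) in H by ring. exact H.
Qed.

Lemma Cmod_pos (z : C) : z <> 0 -> 0 < Cmod z.
Proof. apply Cmod_gt_0. Qed.

Lemma im_le_Cmod (c : C) : Rabs (Im c) <= Cmod c.
Proof. pose proof (Rmax_Cmod c). pose proof (Rmax_r (Rabs (fst c)) (Rabs (snd c))). unfold Im. lra. Qed.

Lemma Cmod_le_Re_Im (c : C) : Cmod c <= Rabs (Re c) + Rabs (Im c).
Proof.
  unfold Cmod. apply Rsqr_incr_0_var.
  - rewrite Rsqr_sqrt by nra. unfold Rsqr, Re, Im.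
    pose proof (Rabs_pos (fst c)). pose proof (Rabs_pos (snd c)).
    rewrite <- (pow2_abs (fst c)), <- (pow2_abs (snd c)). nra.
  - pose proof (Rabs_pos (Re c)). pose proof (Rabs_pos (Im c)). lra.
Qed.

Lemma Ceq_sub0 (x y : C) : x - y = 0 -> x = y.
Proof. intro H. replace x with (x - y + y) by ring. rewrite H. ring. Qed.

Lemma Cmult_eq0_r (z w : C) : z * w = 0 -> z <> 0 -> w = 0.
Proof.
  intros H Hz. replace w with (/ z * (z * w)) by (field; exact Hz). rewrite H. ring.
Qed.

(** Only the target is pinned to C; the domain stays open, so that one set of closure lemmas serves
    functions of a real and of a complex variable. *)
Notation Rcontinuous := (continuous (U := C_UniformSpace)).
Notation Ccontinuous := (continuous (T := C_UniformSpace) (U := C_UniformSpace)).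

Lemma continuous_C_iff {U : UniformSpace} (f : U -> C) (x : U) :
  Rcontinuous f x <->
  (continuous (fun y => Re (f y)) x /\ continuous (fun y => Im (f y)) x).
Proof.
  split.
  - intros H. split.
    + apply (continuous_comp f (fun p : C => fst p) x H). apply continuous_fst.
    + apply (continuous_comp f (fun p : C => snd p) x H). apply continuous_snd.
  - intros [H1 H2].
    intros P [eps HP].
    pose proof (H1 (fun y => ball (Re (f x)) eps y) (locally_ball _ eps)) as L1.
    pose proof (H2 (fun y => ball (Im (f x)) eps y) (locally_ball _ eps)) as L2.
    unfold filtermap in *.
    generalize (filter_and _ _ L1 L2). apply filter_imp.
    intros y [A B]. apply HP. split; assumption.
Qed.

Lemma continuous_Cplus {U : UniformSpace} (f g : U -> C) (x : U) :
  Rcontinuous f x -> Rcontinuous g x ->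
  Rcontinuous (fun y => f y + g y) x.
Proof.
  rewrite !continuous_C_iff. intros [A B] [D E]. split.
  - apply (continuous_plus (V := R_NormedModule) (fun y => Re (f y)) (fun y => Re (g y))); auto.
  - apply (continuous_plus (V := R_NormedModule) (fun y => Im (f y)) (fun y => Im (g y))); auto.
Qed.

Lemma continuous_Copp {U : UniformSpace} (f : U -> C) (x : U) :
  Rcontinuous f x -> Rcontinuous (fun y => - f y) x.
Proof.
  rewrite !continuous_C_iff. intros [A B]. split.
  - apply (continuous_opp (V := R_NormedModule) (fun y => Re (f y))); auto.
  - apply (continuous_opp (V := R_NormedModule) (fun y => Im (f y))); auto.
Qed.

Lemma continuous_Cminus {U : UniformSpace} (f g : U -> C) (x : U) :
  Rcontinuous f x -> Rcontinuous g x ->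
  Rcontinuous (fun y => f y - g y) x.
Proof. intros A B. apply continuous_Cplus; [exact A|]. apply continuous_Copp, B. Qed.

Lemma continuous_Cmult {U : UniformSpace} (f g : U -> C) (x : U) :
  Rcontinuous f x -> Rcontinuous g x ->
  Rcontinuous (fun y => f y * g y) x.
Proof.
  rewrite !continuous_C_iff. intros [A B] [D E]. split.
  - apply (continuous_minus (V := R_NormedModule) (fun y => Re (f y) * Re (g y))%R (fun y => Im (f y) * Im (g y))%R);
      apply (continuous_mult (K := R_AbsRing)); auto.
  - apply (continuous_plus (V := R_NormedModule) (fun y => Re (f y) * Im (g y))%R (fun y => Im (f y) * Re (g y))%R);
      apply (continuous_mult (K := R_AbsRing)); auto.
Qed.

Lemma continuous_Cconst {U : UniformSpace} (c : C) (x : U) :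
  Rcontinuous (fun _ => c) x.
Proof. apply continuous_const. Qed.

Lemma continuous_Cpow {U : UniformSpace} (f : U -> C) (n : nat) (x : U) :
  Rcontinuous f x -> Rcontinuous (fun y => f y ^ n) x.
Proof.
  intro H. induction n as [|n IH].
  - apply continuous_Cconst.
  - apply (continuous_Cmult f (fun y => f y ^ n)); assumption.
Qed.

Lemma continuous_Rmult {U : UniformSpace} (f g : U -> R) (x : U) :
  continuous f x -> continuous g x -> continuous (fun y => f y * g y)%R x.
Proof. intros. apply (continuous_mult (K := R_AbsRing)); assumption. Qed.

Lemma continuous_Rplus {U : UniformSpace} (f g : U -> R) (x : U) :
  continuous f x -> continuous g x -> continuous (fun y => f y + g y)%R x.
Proof. intros. apply (continuous_plus (V := R_NormedModule)); assumption. Qed.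

Lemma continuous_Cmod {U : UniformSpace} (f : U -> C) (x : U) :
  Rcontinuous f x -> continuous (fun y => Cmod (f y)) x.
Proof.
  rewrite continuous_C_iff. intros [A B]. unfold Cmod.
  apply (continuous_comp (fun y => fst (f y) ^ 2 + snd (f y) ^ 2)%R sqrt).
  - apply continuous_Rplus.
    + apply (continuous_ext (fun y => Re (f y) * Re (f y))%R); [intro; unfold Re; simpl; ring|].
      apply continuous_Rmult; assumption.
    + apply (continuous_ext (fun y => Im (f y) * Im (f y))%R); [intro; unfold Im; simpl; ring|].
      apply continuous_Rmult; assumption.
  - apply continuous_sqrt.
Qed.

Lemma continuous_Cinv {U : UniformSpace} (f : U -> C) (x : U) :
  Rcontinuous f x -> f x <> 0 ->
  Rcontinuous (fun y => / f y) x.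
Proof.
  intros H Hx. pose proof H as H'. rewrite continuous_C_iff in H'. destruct H' as [A B].
  assert (D : continuous (fun y => / (Re (f y) ^ 2 + Im (f y) ^ 2))%R x).
  { apply (continuous_comp (fun y => Re (f y) ^ 2 + Im (f y) ^ 2)%R Rinv).
    - apply continuous_Rplus.
      + apply (continuous_ext (fun y => Re (f y) * Re (f y))%R); [intro; simpl; ring|].
        apply continuous_Rmult; assumption.
      + apply (continuous_ext (fun y => Im (f y) * Im (f y))%R); [intro; simpl; ring|].
        apply continuous_Rmult; assumption.
    - apply continuous_Rinv. intro E. apply Hx.
      apply Cmod_eq_0. unfold Cmod. unfold Re, Im in E. rewrite E. apply sqrt_0. }
  apply continuous_C_iff. split.
  - apply (continuous_ext (fun y => Re (f y) * / (Re (f y) ^ 2 + Im (f y) ^ 2))%R); [reflexivity|].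
    apply continuous_Rmult; assumption.
  - apply (continuous_ext (fun y => (- Im (f y)) * / (Re (f y) ^ 2 + Im (f y) ^ 2))%R); [reflexivity|].
    apply continuous_Rmult; [|assumption].
    apply (continuous_opp (V := R_NormedModule) (fun y => Im (f y))); assumption.
Qed.

Lemma continuous_Cdiv {U : UniformSpace} (f g : U -> C) (x : U) :
  Rcontinuous f x -> Rcontinuous g x -> g x <> 0 ->
  Rcontinuous (fun y => f y / g y) x.
Proof. intros. apply continuous_Cmult; [assumption|]. apply continuous_Cinv; assumption. Qed.

Lemma continuous_C_eps (f : C -> C) (z : C) :
  Ccontinuous f z <->
  forall eps, 0 < eps -> exists delta, 0 < delta /\
    forall y, Cmod (y - z) < delta -> Cmod (f y - f z) < eps.
Proof.
  split.
  - intros H eps He.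
    assert (He2 : 0 < eps / 2) by lra.
    destruct (H (ball (f z) (mkposreal _ He2)) (locally_ball _ _)) as [d Hd].
    exists d. split; [apply cond_pos|].
    intros y Hy.
    assert (B : ball z d y) by (apply C_NormedModule_mixin_compat1; exact Hy).
    specialize (Hd y B). destruct Hd as [B1 B2].
    change (Rabs (fst (f y) - fst (f z)) < eps / 2) in B1.
    change (Rabs (snd (f y) - snd (f z)) < eps / 2) in B2.
    eapply Rle_lt_trans; [apply Cmod_le_Re_Im|].
    change (Rabs (fst (f y) - fst (f z)) + Rabs (snd (f y) - snd (f z)) < eps). lra.
  - intros H P [eps HP].
    destruct (H eps (cond_pos eps)) as [d [Hd Hd']].
    assert (Hd2 : 0 < d / 2) by lra.
    exists (mkposreal _ Hd2). intros y [B1 B2]. apply HP.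
    change (Rabs (fst y - fst z) < d / 2) in B1.
    change (Rabs (snd y - snd z) < d / 2) in B2.
    assert (Hy : Cmod (y - z) < d).
    { eapply Rle_lt_trans; [apply Cmod_le_Re_Im|].
      change (Rabs (fst y - fst z) + Rabs (snd y - snd z) < d). lra. }
    apply C_NormedModule_mixin_compat1. apply Hd', Hy.
Qed.

(** The unfolded form of [is_derive] over C. The weak inequality without division lets [y = z] pass
    without exception. *)
Definition cdiff (f : C -> C) (z l : C) : Prop :=
  forall eps : R, 0 < eps -> exists delta : R, 0 < delta /\
    forall y, Cmod (y - z) < delta ->
      Cmod (f y - f z - (y - z) * l) <= eps * Cmod (y - z).

Lemma cdiff_is_derive (f : C -> C) (z l : C) :
  cdiff f z l <-> is_derive (K := C_AbsRing) (V := C_NormedModule) f z l.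
Proof.
  split.
  - intro H. split.
    + apply is_linear_scal_l.
    + intros x Hx. apply (is_filter_lim_locally_unique (K := C_AbsRing) (V := AbsRing_NormedModule C_AbsRing)) in Hx; subst x.
      intros eps. destruct (H eps (cond_pos eps)) as [d [Hd Hd']].
      exists (mkposreal d Hd). intros y Hy. apply (Hd' y). exact Hy.
  - intros [_ H] eps He.
    specialize (H z (fun P HP => HP) (mkposreal eps He)).
    destruct H as [d Hd]. exists d. split; [apply cond_pos|].
    intros y Hy. apply (Hd y Hy).
Qed.

Lemma entire_cdiff (f : C -> C) : entire f <-> forall z, exists l, cdiff f z l.
Proof.
  split; intros H z; destruct (H z) as [l Hl]; exists l; apply cdiff_is_derive; exact Hl.
Qed.

(** Carathéodory's form: differentiability becomes continuity of a slope function, which reduces the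
    product and chain rules to algebra. *)
Lemma cdiff_cara (f : C -> C) (z l : C) :
  cdiff f z l <-> exists q : C -> C, (forall y, f y = f z + (y - z) * q y) /\ q z = l /\
     Ccontinuous q z.
Proof.
  split.
  - intro H. exists (fun y => if Ceq_dec y z then l else (f y - f z) / (y - z)).
    split; [|split].
    + intro y. destruct (Ceq_dec y z) as [->|n]; [ring|].
      field. intro E. apply n, Ceq_sub0, E.
    + destruct (Ceq_dec z z); congruence.
    + apply continuous_C_eps. intros eps He.
      assert (He2 : 0 < eps / 2) by lra.
      destruct (H _ He2) as [d [Hd Hd']]. exists d. split; [exact Hd|].
      intros y Hy. destruct (Ceq_dec z z) as [_|n]; [|congruence].
      destruct (Ceq_dec y z) as [->|n].
      * replace (l - l) with (RtoC 0) by ring. rewrite Cmod_0. exact He.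
      * assert (Hn : y - z <> 0) by (intro E; apply n, Ceq_sub0, E).
        replace ((f y - f z) / (y - z) - l) with ((f y - f z - (y - z) * l) / (y - z))
          by (field; exact Hn).
        rewrite Cmod_div by exact Hn.
        pose proof (Cmod_pos _ Hn). specialize (Hd' y Hy).
        apply Rle_lt_trans with (eps / 2)%R; [|lra].
        apply Rle_div_l; lra.
  - intros [q [Hq [Hz Hc]]] eps He.
    rewrite continuous_C_eps in Hc. destruct (Hc eps He) as [d [Hd Hd']].
    exists d. split; [exact Hd|]. intros y Hy. specialize (Hd' y Hy).
    rewrite (Hq y). replace (f z + (y - z) * q y - f z - (y - z) * l) with ((y - z) * (q y - q z))
      by (rewrite Hz; ring).
    rewrite Cmod_mult. pose proof (Cmod_ge_0 (y - z)). nra.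
Qed.

Lemma cdiff_continuous (f : C -> C) (z l : C) :
  cdiff f z l -> Ccontinuous f z.
Proof.
  rewrite cdiff_cara. intros [q [Hq [_ Hc]]].
  apply (continuous_ext (T := C_UniformSpace) (U := C_UniformSpace) (fun y => f z + (y - z) * q y)).
  { intro y. symmetry. apply Hq. }
  apply continuous_Cplus; [apply continuous_Cconst|].
  apply continuous_Cmult; [|exact Hc].
  apply continuous_Cminus; [apply continuous_id|apply continuous_Cconst].
Qed.

(** A second-order error bound is the form in which differentiability arises for the inverse, the
    exponential and series of functions. *)
Lemma cdiff_quad (f : C -> C) (z l : C) (K delta : R) :
  0 < delta ->
  (forall y, Cmod (y - z) < delta ->
     Cmod (f y - f z - (y - z) * l) <= K * Cmod (y - z) ^ 2) ->
  cdiff f z l.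
Proof.
  intros Hd H eps He.
  assert (HK : 0 < Rabs K + 1) by (pose proof (Rabs_pos K); lra).
  exists (Rmin delta (eps / (Rabs K + 1))). split.
  { apply Rmin_glb_lt; [exact Hd|]. apply Rdiv_lt_0_compat; assumption. }
  intros y Hy.
  assert (H1 : Cmod (y - z) < delta) by (eapply Rlt_le_trans; [exact Hy|apply Rmin_l]).
  assert (H2 : Cmod (y - z) < eps / (Rabs K + 1)) by (eapply Rlt_le_trans; [exact Hy|apply Rmin_r]).
  specialize (H y H1).
  assert (H3 : Cmod (y - z) * (Rabs K + 1) < eps).
  { apply Rlt_div_r; lra. }
  pose proof (Cmod_ge_0 (y - z)) as H0. pose proof (Rle_abs K).
  assert (K * Cmod (y - z) ^ 2 <= eps * Cmod (y - z)); [|lra].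
  replace (K * Cmod (y - z) ^ 2)%R with ((K * Cmod (y - z)) * Cmod (y - z))%R by ring.
  apply Rmult_le_compat_r; [exact H0|]. nra.
Qed.

Lemma cdiff_ext_loc (f g : C -> C) (z l : C) (delta : R) :
  0 < delta -> (forall y, Cmod (y - z) < delta -> f y = g y) ->
  cdiff f z l -> cdiff g z l.
Proof.
  intros Hd He H eps Heps. destruct (H eps Heps) as [d [Hd1 Hd2]].
  exists (Rmin delta d). split; [apply Rmin_glb_lt; assumption|].
  intros y Hy. rewrite <- (He y), <- (He z).
  - apply Hd2. eapply Rlt_le_trans; [exact Hy|apply Rmin_r].
  - replace (z - z) with (RtoC 0) by ring. rewrite Cmod_0. exact Hd.
  - eapply Rlt_le_trans; [exact Hy|apply Rmin_l].
Qed.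

Lemma cdiff_ext (f g : C -> C) (z l : C) : (forall y, f y = g y) -> cdiff f z l -> cdiff g z l.
Proof. intros H. apply (cdiff_ext_loc f g z l 1); [lra|]. intros; apply H. Qed.

Lemma cdiff_const (c z : C) : cdiff (fun _ => c) z 0.
Proof.
  apply cdiff_cara. exists (fun _ => RtoC 0). split; [intro; ring|]. split; [reflexivity|].
  apply continuous_Cconst.
Qed.

Lemma cdiff_id (z : C) : cdiff (fun y => y) z 1.
Proof.
  apply cdiff_cara. exists (fun _ => RtoC 1). split; [intro; ring|]. split; [reflexivity|].
  apply continuous_Cconst.
Qed.

Lemma cdiff_plus (f g : C -> C) (z l m : C) :
  cdiff f z l -> cdiff g z m -> cdiff (fun y => f y + g y) z (l + m).
Proof.
  rewrite !cdiff_cara. intros [q [H1 [H2 H3]]] [p [G1 [G2 G3]]].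
  exists (fun y => q y + p y). split; [|split].
  - intro y. rewrite (H1 y), (G1 y). ring.
  - congruence.
  - apply continuous_Cplus; assumption.
Qed.

Lemma cdiff_mult (f g : C -> C) (z l m : C) :
  cdiff f z l -> cdiff g z m -> cdiff (fun y => f y * g y) z (l * g z + f z * m).
Proof.
  intros Hf Hg. pose proof (cdiff_continuous _ _ _ Hg) as Cg.
  revert Hf Hg. rewrite !cdiff_cara. intros [q [H1 [H2 H3]]] [p [G1 [G2 G3]]].
  exists (fun y => q y * g y + f z * p y). split; [|split].
  - intro y. rewrite (H1 y), (G1 y). ring.
  - rewrite H2, G2. ring.
  - apply continuous_Cplus; apply continuous_Cmult; try assumption. apply continuous_Cconst.
Qed.

Lemma cdiff_scal (c : C) (f : C -> C) (z l : C) : cdiff f z l -> cdiff (fun y => c * f y) z (c * l).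
Proof.
  intro H. replace (c * l) with (0 * f z + c * l) by ring.
  apply (cdiff_mult (fun _ => c) f); [apply cdiff_const|exact H].
Qed.

Lemma cdiff_opp (f : C -> C) (z l : C) : cdiff f z l -> cdiff (fun y => - f y) z (- l).
Proof.
  intro H. replace (- l) with ((- (1)) * l) by ring.
  apply cdiff_ext with (fun y => (- (1)) * f y); [intro; ring|]. apply cdiff_scal, H.
Qed.

Lemma cdiff_comp (f g : C -> C) (z l m : C) :
  cdiff g z m -> cdiff f (g z) l -> cdiff (fun y => f (g y)) z (l * m).
Proof.
  intros Hg Hf. pose proof (cdiff_continuous _ _ _ Hg) as Cg.
  revert Hf Hg. rewrite !cdiff_cara. intros [q [H1 [H2 H3]]] [p [G1 [G2 G3]]].
  exists (fun y => q (g y) * p y). split; [|split].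
  - intro y. rewrite (H1 (g y)). rewrite (G1 y) at 1. ring.
  - congruence.
  - apply continuous_Cmult; [|assumption].
    apply (continuous_comp (U := C_UniformSpace) (V := C_UniformSpace) (W := C_UniformSpace) g q); assumption.
Qed.

Lemma cdiff_Cinv (w : C) : w <> 0 -> cdiff Cinv w (- / (w * w)).
Proof.
  intros Hw. pose proof (Cmod_pos _ Hw) as Pw.
  (* The error is (y - w)^2 / (w^2 y), and |y| > |w| / 2 within distance |w| / 2 of w. *)
  apply (cdiff_quad _ _ _ (2 / Cmod w ^ 3) (Cmod w / 2)); [lra|].
  intros y Hy.
  assert (Py : Cmod w / 2 < Cmod y).
  { pose proof (Cmod_sub_ge w y). rewrite Cmod_sub_sym in Hy. lra. }
  assert (Hy0 : y <> 0) by (apply Cmod_gt_0; lra).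
  replace (/ y - / w - (y - w) * - / (w * w)) with ((y - w) * (y - w) * / (w * w * y))
    by (field; tauto).
  assert (Hwy : w * w * y <> 0) by (repeat apply Cmult_neq_0; assumption).
  rewrite !Cmod_mult, Cmod_inv, !Cmod_mult by assumption.
  pose proof (Cmod_ge_0 (y - w)) as P0.
  set (d := Cmod (y - w)) in *.
  assert (/ (Cmod w * Cmod w * Cmod y) <= 2 / Cmod w ^ 3).
  { replace (2 / Cmod w ^ 3)%R with (/ (Cmod w * Cmod w * (Cmod w / 2)))%R by (field; lra).
    pose proof (Rmult_lt_0_compat _ _ Pw Pw) as Pw2.
    apply Rinv_le_contravar; [apply Rmult_lt_0_compat; lra|].
    apply Rmult_le_compat_l; lra. }
  replace (d ^ 2)%R with (d * d)%R by ring.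
  rewrite Rmult_comm. apply Rmult_le_compat_r; [nra|assumption].
Qed.

Lemma cdiff_inv (f : C -> C) (z l : C) :
  cdiff f z l -> f z <> 0 -> cdiff (fun y => / f y) z (- / (f z * f z) * l).
Proof. intros H Hz. apply (cdiff_comp Cinv f); [exact H|]. apply cdiff_Cinv, Hz. Qed.

Lemma cdiff_pow (f : C -> C) (n : nat) (z l : C) :
  cdiff f z l -> exists m, cdiff (fun y => f y ^ n) z m.
Proof.
  intro H. induction n as [|n [m IH]].
  - exists 0. apply (cdiff_const 1).
  - exists (l * f z ^ n + f z * m). apply (cdiff_mult f (fun y => f y ^ n)); assumption.
Qed.

Lemma entire_continuous (f : C -> C) (z : C) :
  entire f -> Ccontinuous f z.
Proof. rewrite entire_cdiff. intro H. destruct (H z) as [l Hl]. eapply cdiff_continuous, Hl. Qed.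

Lemma entire_const (c : C) : entire (fun _ => c).
Proof. apply entire_cdiff. intro z. exists 0. apply cdiff_const. Qed.

Lemma entire_id : entire (fun z => z).
Proof. apply entire_cdiff. intro z. exists 1. apply cdiff_id. Qed.

Lemma entire_plus (f g : C -> C) : entire f -> entire g -> entire (fun z => f z + g z).
Proof.
  rewrite !entire_cdiff. intros H K z. destruct (H z) as [l Hl], (K z) as [m Hm].
  eexists. apply cdiff_plus; eauto.
Qed.

Lemma entire_mult (f g : C -> C) : entire f -> entire g -> entire (fun z => f z * g z).
Proof.
  rewrite !entire_cdiff. intros H K z. destruct (H z) as [l Hl], (K z) as [m Hm].
  eexists. apply cdiff_mult; eauto.
Qed.

Lemma entire_comp (f g : C -> C) : entire f -> entire g -> entire (fun z => f (g z)).
Proof.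
  rewrite !entire_cdiff. intros H K z. destruct (K z) as [m Hm], (H (g z)) as [l Hl].
  eexists. apply cdiff_comp; eauto.
Qed.

Lemma entire_shift (f : C -> C) (c : C) : entire f -> entire (fun z => f (c + z)).
Proof.
  intro H. apply (entire_comp f (fun z => c + z) H).
  apply entire_plus; [apply entire_const|apply entire_id].
Qed.

Lemma entire_pow (f : C -> C) (n : nat) : entire f -> entire (fun z => f z ^ n).
Proof.
  intro H. induction n as [|n IH]; [apply (entire_const 1)|].
  apply (entire_mult f (fun y => f y ^ n)); assumption.
Qed.

Lemma entire_inv (f : C -> C) : entire f -> (forall z, f z <> 0) -> entire (fun z => / f z).
Proof.
  rewrite !entire_cdiff. intros H K z. destruct (H z) as [l Hl].
  eexists. apply cdiff_inv; eauto.
Qed.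

(** * The exponential and integrals of complex-valued functions *)

Definition Cexp (z : C) : C := (exp (Re z) * cos (Im z), exp (Re z) * sin (Im z))%R.

Lemma Ceq_ReIm (z w : C) : Re z = Re w -> Im z = Im w -> z = w.
Proof. destruct z, w; unfold Re, Im; simpl; congruence. Qed.

Lemma Cexp_plus (z w : C) : Cexp (z + w) = Cexp z * Cexp w.
Proof.
  destruct z as [a b], w as [c d]. unfold Cexp. apply Ceq_ReIm; unfold Re, Im; simpl;
  rewrite exp_plus, ?cos_plus, ?sin_plus; ring.
Qed.

Lemma Cexp_0 : Cexp 0 = 1.
Proof. apply Ceq_ReIm; unfold Cexp, Re, Im; simpl; rewrite exp_0, ?cos_0, ?sin_0; ring. Qed.

Lemma Cexp_neq0 (z : C) : Cexp z <> 0.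
Proof.
  intro H. apply C1_nz. rewrite <- Cexp_0. replace (RtoC 0) with (z + - z) at 1 by ring.
  rewrite Cexp_plus, H. ring.
Qed.

Lemma Cmod_Cexp (z : C) : Cmod (Cexp z) = exp (Re z).
Proof.
  unfold Cmod, Cexp. simpl fst. simpl snd.
  replace ((exp (Re z) * cos (Im z)) ^ 2 + (exp (Re z) * sin (Im z)) ^ 2)%R
    with (exp (Re z) ^ 2)%R.
  - apply sqrt_pow2. apply Rlt_le, exp_pos.
  - pose proof (sin2_cos2 (Im z)) as H. unfold Rsqr in H. nra.
Qed.

Lemma exp_le_compat (x y : R) : x <= y -> exp x <= exp y.
Proof. intros [H| ->]; [apply Rlt_le, exp_increasing, H|lra]. Qed.

Lemma abs_sin_le (x : R) : Rabs (sin x) <= Rabs x.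
Proof.
  destruct (MVT_gen sin 0 x cos) as [c [_ Hc]].
  - intros y _. apply is_derive_Reals, derivable_pt_lim_sin.
  - intros y _. apply continuity_sin.
  - rewrite sin_0, !Rminus_0_r in Hc. rewrite Hc, Rabs_mult.
    pose proof (COS_bound c). pose proof (Rabs_pos x).
    assert (Rabs (cos c) <= 1) by (apply Rabs_le; lra). nra.
Qed.

Lemma one_minus_cos_bound (x : R) : 0 <= 1 - cos x <= x ^ 2 / 2.
Proof.
  pose proof (COS_bound x). split; [lra|].
  replace (cos x) with (cos (2 * (x / 2))) by (f_equal; field).
  rewrite cos_2a_sin.
  pose proof (abs_sin_le (x / 2)) as Hs.
  assert (sin (x / 2) ^ 2 <= (x / 2) ^ 2); [|nra].
  rewrite <- (pow2_abs (sin (x/2))), <- (pow2_abs (x/2)).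
  apply pow_incr. split; [apply Rabs_pos|exact Hs].
Qed.

Lemma abs_sin_sub (x : R) : (Rabs x <= 1 -> Rabs (sin x - x) <= x ^ 2)%R.
Proof.
  intro Hx.
  destruct (MVT_gen (fun y => sin y - y)%R 0 x (fun y => cos y - 1)%R) as [c [Hc1 Hc]].
  - intros y _. auto_derive; [exact I|]. ring.
  - intros y _. apply continuity_minus; [apply continuity_sin|apply derivable_continuous, derivable_id].
  - rewrite sin_0, !Rminus_0_r in Hc. rewrite Hc, Rabs_mult.
    pose proof (one_minus_cos_bound c) as Hb.
    assert (Hcx : Rabs c <= Rabs x).
    { unfold Rmin, Rmax in Hc1. apply Rabs_le. destruct (Rle_dec 0 x);
      unfold Rabs; destruct (Rcase_abs x); lra. }
    assert (Rabs (cos c - 1) <= Rabs x).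
    { rewrite Rabs_minus_sym, Rabs_pos_eq by lra.
      rewrite <- (pow2_abs c) in Hb. pose proof (Rabs_pos c). nra. }
    rewrite <- (pow2_abs x). pose proof (Rabs_pos x). nra.
Qed.

(** The upper bound comes from exp x (1 - x) <= 1, that is exp (-x) >= 1 - x, together with (1 -
    x)(1 + x + 2 x^2) >= 1 for x <= 1/2. *)
Lemma exp_sub_bound (x : R) : (Rabs x <= 1 / 2 -> 0 <= exp x - 1 - x <= 2 * x ^ 2)%R.
Proof.
  intro H. apply Rabs_le_between in H.
  pose proof (exp_ineq1_le x). pose proof (exp_ineq1_le (- x)).
  split; [lra|].
  assert (exp x * exp (- x) = 1)%R by (rewrite <- exp_plus, Rplus_opp_r; apply exp_0).
  pose proof (exp_pos x).
  assert (exp x * (1 - x) <= 1) by nra.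
  assert ((1 - x) * (1 + x + 2 * x ^ 2) >= 1) by nra. nra.
Qed.

Lemma cdiff_Cexp (z : C) : cdiff Cexp z (Cexp z).
Proof.
  (* For |h| <= 1/2 the real part of exp h - 1 - h is at most 3 |h|^2 and the imaginary part at most
     4 |h|^2; 8 leaves room. *)
  apply (cdiff_quad _ _ _ (8 * Cmod (Cexp z)) (1 / 2)); [lra|].
  intros y Hy. set (h := y - z) in *.
  replace y with (z + h) by (unfold h; ring). rewrite Cexp_plus.
  replace (Cexp z * Cexp h - Cexp z - h * Cexp z) with (Cexp z * (Cexp h - 1 - h)) by ring.
  rewrite Cmod_mult. pose proof (Cmod_ge_0 (Cexp z)).
  assert (Hh : Cmod (Cexp h - 1 - h) <= 8 * Cmod h ^ 2); [|nra].
  destruct h as [a b]. clear -Hy.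
  pose proof (re_le_Cmod (a, b)) as Ra. pose proof (im_le_Cmod (a, b)) as Rb.
  unfold Re, Im in Ra, Rb. simpl fst in Ra. simpl snd in Rb.
  eapply Rle_trans; [apply Cmod_le_Re_Im|].
  assert (E1 : Re (Cexp (a, b) - 1 - (a, b)) = (exp a - 1 - a - exp a * (1 - cos b))%R).
  { unfold Cexp, Re, Im; simpl. ring. }
  assert (E2 : Im (Cexp (a, b) - 1 - (a, b)) = (exp a * (sin b - b) + (exp a - 1) * b)%R).
  { unfold Cexp, Re, Im; simpl. ring. }
  rewrite E1, E2. clear E1 E2.
  pose proof (exp_sub_bound a ltac:(lra)) as Ha.
  pose proof (one_minus_cos_bound b) as Hc. pose proof (abs_sin_sub b ltac:(lra)) as Hs.
  set (m := Cmod (a, b)) in *.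
  assert (a ^ 2 <= m ^ 2) by (rewrite <- (pow2_abs a); apply pow_incr; split; [apply Rabs_pos|lra]).
  assert (b ^ 2 <= m ^ 2) by (rewrite <- (pow2_abs b); apply pow_incr; split; [apply Rabs_pos|lra]).
  assert (Hab : Rabs a <= 1 / 2) by lra. apply Rabs_le_between in Hab.
  assert (He : 0 <= exp a <= 2) by (split; [apply Rlt_le, exp_pos|nra]).
  assert (Hm : 0 <= m <= 1 / 2) by (split; [apply Cmod_ge_0|lra]).
  apply Rabs_le_between in Ra. apply Rabs_le_between in Rb. apply Rabs_le_between in Hs.
  assert (P1 : 0 <= exp a * (1 - cos b) <= 2 * (b ^ 2 / 2)).
  { split; [apply Rmult_le_pos; lra|]. apply Rmult_le_compat; lra. }
  assert (P2 : Rabs (exp a * (sin b - b)) <= 2 * b ^ 2).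
  { rewrite Rabs_mult. rewrite (Rabs_pos_eq (exp a)) by lra.
    apply Rmult_le_compat; try lra. apply Rabs_pos. apply Rabs_le; lra. }
  assert (P3 : Rabs ((exp a - 1) * b) <= 2 * m ^ 2).
  { rewrite Rabs_mult. replace (2 * m ^ 2)%R with (2 * m * m)%R by ring.
    apply Rmult_le_compat; try apply Rabs_pos; apply Rabs_le; [|lra].
    split; nra. }
  pose proof (Rabs_triang (exp a * (sin b - b)) ((exp a - 1) * b)).
  assert (Rabs (exp a - 1 - a - exp a * (1 - cos b)) <= 3 * m ^ 2) by (apply Rabs_le; lra).
  lra.
Qed.

(** * Integrals of continuous complex-valued functions over real intervals *)

Definition CInt (f : R -> C) (a b : R) : C := RInt (V := C_R_CompleteNormedModule) f a b.

Definition Ccont (f : R -> C) : Prop := forall x, Rcontinuous f x.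

Definition Ccont_on (f : R -> C) (a b : R) : Prop :=
  forall x, a <= x <= b -> Rcontinuous f x.

Lemma Ccont_Ccont_on (f : R -> C) (a b : R) : Ccont f -> Ccont_on f a b.
Proof. intros H x _. apply H. Qed.

Lemma is_CInt (f : R -> C) (a b : R) : a <= b -> Ccont_on f a b ->
  is_RInt (V := C_R_NormedModule) f a b (CInt f a b).
Proof.
  intros Hab H. apply (RInt_correct (V := C_R_CompleteNormedModule)).
  apply (ex_RInt_continuous (V := C_R_CompleteNormedModule)).
  intros z Hz. apply H. rewrite Rmin_left, Rmax_right in Hz by lra. exact Hz.
Qed.

Lemma CInt_unique (f : R -> C) (a b : R) (l : C) :
  is_RInt (V := C_R_NormedModule) f a b l -> CInt f a b = l.
Proof. apply (is_RInt_unique (V := C_R_CompleteNormedModule)). Qed.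

Lemma CInt_ext (f g : R -> C) (a b : R) :
  (forall x, f x = g x) -> CInt f a b = CInt g a b.
Proof. intro H. apply (RInt_ext (V := C_R_CompleteNormedModule)). intros; apply H. Qed.

Lemma CInt_plus (f g : R -> C) (a b : R) : a <= b -> Ccont_on f a b -> Ccont_on g a b ->
  CInt (fun x => f x + g x) a b = CInt f a b + CInt g a b.
Proof.
  intros Hab Hf Hg. apply CInt_unique.
  apply (is_RInt_plus (V := C_R_NormedModule)); apply is_CInt; assumption.
Qed.

Lemma CInt_minus (f g : R -> C) (a b : R) : a <= b -> Ccont_on f a b -> Ccont_on g a b ->
  CInt (fun x => f x - g x) a b = CInt f a b - CInt g a b.
Proof.
  intros Hab Hf Hg. apply CInt_unique.
  apply (is_RInt_minus (V := C_R_NormedModule)); apply is_CInt; assumption.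
Qed.

Lemma Ccont_on_Re (f : R -> C) (a b : R) : Ccont_on f a b ->
  forall x, a <= x <= b -> continuous (fun y => Re (f y)) x.
Proof. intros H x Hx. apply (continuous_C_iff f x), H, Hx. Qed.

Lemma Ccont_on_Im (f : R -> C) (a b : R) : Ccont_on f a b ->
  forall x, a <= x <= b -> continuous (fun y => Im (f y)) x.
Proof. intros H x Hx. apply (continuous_C_iff f x), H, Hx. Qed.

Lemma CInt_ReIm (f : R -> C) (a b : R) : a <= b -> Ccont_on f a b ->
  CInt f a b = (RInt (fun x => Re (f x)) a b, RInt (fun x => Im (f x)) a b).
Proof.
  intros Hab H. pose proof (is_CInt f a b Hab H) as I.
  apply Ceq_ReIm; symmetry; apply is_RInt_unique.
  - apply (is_RInt_fct_extend_fst (U := R_NormedModule) (V := R_NormedModule) f a b (CInt f a b) I).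
  - apply (is_RInt_fct_extend_snd (U := R_NormedModule) (V := R_NormedModule) f a b (CInt f a b) I).
Qed.

Lemma ex_RInt_cont (g : R -> R) (a b : R) : a <= b ->
  (forall x, a <= x <= b -> continuous g x) -> ex_RInt g a b.
Proof.
  intros Hab H. apply (ex_RInt_continuous (V := R_CompleteNormedModule)).
  intros z Hz. apply H. rewrite Rmin_left, Rmax_right in Hz by lra. exact Hz.
Qed.

Lemma CInt_scal (c : C) (f : R -> C) (a b : R) : a <= b -> Ccont_on f a b ->
  CInt (fun x => c * f x) a b = c * CInt f a b.
Proof.
  intros Hab H.
  rewrite (CInt_ReIm f) by assumption. rewrite CInt_ReIm; [|assumption|].
  2:{ intros x Hx. apply continuous_Cmult; [apply continuous_Cconst|apply H, Hx]. }
  pose proof (ex_RInt_cont _ a b Hab (Ccont_on_Re f a b H)) as E1.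
  pose proof (ex_RInt_cont _ a b Hab (Ccont_on_Im f a b H)) as E2.
  apply Ceq_ReIm.
  - change (RInt (fun x => Re c * Re (f x) - Im c * Im (f x))%R a b =
      (Re c * RInt (fun x => Re (f x)) a b - Im c * RInt (fun x => Im (f x)) a b)%R).
    rewrite (RInt_minus (V := R_CompleteNormedModule) (fun x => Re c * Re (f x))%R (fun x => Im c * Im (f x))%R);
      try (apply (ex_RInt_scal (V := R_CompleteNormedModule)); assumption).
    rewrite <- !(RInt_scal (V := R_CompleteNormedModule)) by assumption. reflexivity.
  - change (RInt (fun x => Re c * Im (f x) + Im c * Re (f x))%R a b =
      (Re c * RInt (fun x => Im (f x)) a b + Im c * RInt (fun x => Re (f x)) a b)%R).
    rewrite (RInt_plus (V := R_CompleteNormedModule) (fun x => Re c * Im (f x))%R (fun x => Im c * Re (f x))%R);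
      try (apply (ex_RInt_scal (V := R_CompleteNormedModule)); assumption).
    rewrite <- !(RInt_scal (V := R_CompleteNormedModule)) by assumption. reflexivity.
Qed.

Lemma CInt_const (c : C) (a b : R) : CInt (fun _ => c) a b = RtoC (b - a) * c.
Proof. apply CInt_unique. rewrite <- scal_R_Cmult. apply (is_RInt_const (V := C_R_NormedModule)). Qed.

Lemma CInt_Chasles (f : R -> C) (a b c : R) : a <= b -> b <= c -> Ccont_on f a c ->
  CInt f a c = CInt f a b + CInt f b c.
Proof.
  intros H1 H2 H. apply CInt_unique.
  apply (is_RInt_Chasles (V := C_R_NormedModule)) with b;
    apply is_CInt; try assumption; intros x Hx; apply H; lra.
Qed.

Lemma Cmod_CInt_le (f : R -> C) (M a b : R) : a <= b -> Ccont_on f a b ->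
  (forall x, a <= x <= b -> Cmod (f x) <= M) -> Cmod (CInt f a b) <= (b - a) * M.
Proof.
  intros Hab H HM. rewrite Cmod_norm.
  apply (norm_RInt_le_const (V := C_R_NormedModule) f a b (CInt f a b) M Hab).
  - intros x Hx. rewrite <- Cmod_norm. apply HM, Hx.
  - apply is_CInt; assumption.
Qed.

Lemma Cmod_CInt_RInt (f : R -> C) (g : R -> R) (a b : R) : a <= b -> Ccont_on f a b ->
  (forall x, a <= x <= b -> continuous g x) ->
  (forall x, a <= x <= b -> Cmod (f x) <= g x) -> Cmod (CInt f a b) <= RInt g a b.
Proof.
  intros Hab H Hg HM. rewrite Cmod_norm.
  apply (norm_RInt_le (V := C_R_NormedModule) f g a b (CInt f a b)); try assumption.
  - intros x Hx. rewrite <- Cmod_norm. apply HM, Hx.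
  - apply is_CInt; assumption.
  - apply (RInt_correct (V := R_CompleteNormedModule)), ex_RInt_cont; assumption.
Qed.

Lemma is_derive_line (H : C -> C) (p v : C) (x : R) (l : C) :
  cdiff H (p + RtoC x * v) l ->
  is_derive (K := R_AbsRing) (V := C_R_NormedModule) (fun s : R => H (p + RtoC s * v)) x (l * v).
Proof.
  intros D. split.
  - apply (is_linear_scal_l (K := R_AbsRing) (V := C_R_NormedModule)).
  - intros x0 Hx0. apply (is_filter_lim_locally_unique (K := R_AbsRing) (V := AbsRing_NormedModule R_AbsRing)) in Hx0; subst x0.
    intros eps.
    (* The direction [v] may be 0, hence the [+ 1] in the rescaled tolerances. *)
    assert (He : 0 < eps / (Cmod v + 1)).
    { apply Rdiv_lt_0_compat; [apply cond_pos|]. pose proof (Cmod_ge_0 v); lra. }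
    destruct (D _ He) as [d [Hd Hd']].
    assert (Hd2 : 0 < d / (Cmod v + 1)).
    { apply Rdiv_lt_0_compat; [exact Hd|]. pose proof (Cmod_ge_0 v); lra. }
    exists (mkposreal _ Hd2). intros y Hy.
    change (Rabs (y - x) < d / (Cmod v + 1)) in Hy.
    rewrite <- Cmod_norm.
    change (norm (minus y x)) with (Rabs (y - x)).
    change (minus y x) with (y - x)%R. rewrite scal_R_Cmult.
    change (Cmod (H (p + RtoC y * v)%C - H (p + RtoC x * v)%C - RtoC (y - x) * (l * v))
      <= eps * Rabs (y - x)).
    assert (E : p + RtoC y * v - (p + RtoC x * v) = RtoC (y - x) * v).
    { rewrite RtoC_minus. ring. }
    specialize (Hd' (p + RtoC y * v)). rewrite E in Hd'.
    rewrite Cmod_mult, Cmod_R in Hd'.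
    replace (RtoC (y - x) * (l * v)) with (RtoC (y - x) * v * l) by ring.
    pose proof (Cmod_ge_0 v) as Hv. pose proof (Rabs_pos (y - x)) as Ha.
    assert (Q : Rabs (y - x) * (Cmod v + 1) < d).
    { apply Rlt_div_r; lra. }
    eapply Rle_trans; [apply Hd'; nra|].
    replace (eps * Rabs (y - x))%R with (eps / (Cmod v + 1) * (Rabs (y - x) * (Cmod v + 1)))%R by (field; lra).
    apply Rmult_le_compat_l; [lra|]. nra.
Qed.

Lemma CInt_line_FTC (H k : C -> C) (p v : C) (a b : R) : a <= b ->
  (forall z, cdiff H z (k z)) -> (forall z, Ccontinuous k z) ->
  CInt (fun s => k (p + RtoC s * v) * v) a b = H (p + RtoC b * v) - H (p + RtoC a * v).
Proof.
  intros Hab D Ck. apply CInt_unique.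
  apply (is_RInt_derive (V := C_R_CompleteNormedModule) (fun s : R => H (p + RtoC s * v))).
  - intros x _. apply is_derive_line, D.
  - intros x _. apply (continuous_Cmult (fun s : R => k (p + RtoC s * v)) (fun _ => v)); [|apply continuous_Cconst].
    apply (continuous_comp (U := R_UniformSpace) (V := C_UniformSpace) (W := C_UniformSpace)
             (fun s : R => p + RtoC s * v) k); [|apply Ck].
    apply continuous_Cplus; [apply continuous_Cconst|].
    apply continuous_Cmult; [|apply continuous_Cconst].
    apply continuous_C_iff. split; simpl; [apply continuous_id|apply continuous_const].
Qed.

(** * Goursat's theorem on rectangles *)

(** The contour integral over the boundary of the rectangle [a, b] x [c, d], counterclockwise; the
    factor [Ci] is dz = i dy on the vertical sides. *)
Definition bdry (h : C -> C) (a b c d : R) : C :=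
  CInt (fun x => h (x, c)) a b - CInt (fun x => h (x, d)) a b
  + Ci * (CInt (fun y => h (b, y)) c d - CInt (fun y => h (a, y)) c d).

Definition cont_rect (h : C -> C) (a b c d : R) : Prop :=
  forall x y, a <= x <= b -> c <= y <= d ->
    Ccontinuous h (x, y).

Lemma cont_rect_horiz (h : C -> C) (a b c d y : R) :
  cont_rect h a b c d -> c <= y <= d -> Ccont_on (fun x => h (x, y)) a b.
Proof.
  intros H Hy x Hx.
  apply (continuous_comp (U := R_UniformSpace) (V := C_UniformSpace) (W := C_UniformSpace)
             (fun s : R => (s, y)) h); [|apply H; assumption].
  apply continuous_C_iff. split; [apply continuous_id|apply continuous_const].
Qed.

Lemma cont_rect_vert (h : C -> C) (a b c d x : R) :
  cont_rect h a b c d -> a <= x <= b -> Ccont_on (fun y => h (x, y)) c d.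
Proof.
  intros H Hx y Hy.
  apply (continuous_comp (U := R_UniformSpace) (V := C_UniformSpace) (W := C_UniformSpace)
             (fun s : R => (x, s)) h); [|apply H; assumption].
  apply continuous_C_iff. split; [apply continuous_const|apply continuous_id].
Qed.

Lemma cont_rect_sub (h : C -> C) (a b c d a' b' c' d' : R) :
  cont_rect h a b c d -> a <= a' -> b' <= b -> c <= c' -> d' <= d ->
  cont_rect h a' b' c' d'.
Proof. intros H ? ? ? ? x y Hx Hy. apply H; lra. Qed.

Lemma bdry_primitive (H k : C -> C) (a b c d : R) : a <= b -> c <= d ->
  (forall z, cdiff H z (k z)) ->
  (forall z, Ccontinuous k z) ->
  bdry k a b c d = 0.
Proof.
  intros Hab Hcd D Ck.
  assert (Hor : forall y, CInt (fun x => k (x, y)) a b = H (b, y) - H (a, y)).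
  { intro y. pose proof (CInt_line_FTC H k (0, y) 1 a b Hab D Ck) as E.
    replace ((0, y) + RtoC b * 1) with ((b, y) : C) in E by (apply Ceq_ReIm; unfold Re, Im; simpl; ring).
    replace ((0, y) + RtoC a * 1) with ((a, y) : C) in E by (apply Ceq_ReIm; unfold Re, Im; simpl; ring).
    rewrite <- E. apply CInt_ext. intro x.
    rewrite Cmult_1_r. f_equal. apply Ceq_ReIm; unfold Re, Im; simpl; ring. }
  assert (Ver : forall x, Ci * CInt (fun y => k (x, y)) c d = H (x, d) - H (x, c)).
  { intro x. pose proof (CInt_line_FTC H k (x, 0) Ci c d Hcd D Ck) as E.
    replace ((x, 0) + RtoC d * Ci) with ((x, d) : C) in E by (apply Ceq_ReIm; unfold Re, Im; simpl; ring).
    replace ((x, 0) + RtoC c * Ci) with ((x, c) : C) in E by (apply Ceq_ReIm; unfold Re, Im; simpl; ring).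
    rewrite <- E. rewrite <- CInt_scal; [|exact Hcd|].
    - apply CInt_ext. intro y. rewrite Cmult_comm. f_equal. f_equal.
      apply Ceq_ReIm; unfold Re, Im; simpl; ring.
    - apply (cont_rect_vert k x x c d); [|lra]. intros u v _ _. apply Ck. }
  unfold bdry. rewrite !Hor.
  replace (Ci * (CInt (fun y => k (b, y)) c d - CInt (fun y => k (a, y)) c d))
    with (Ci * CInt (fun y => k (b, y)) c d - Ci * CInt (fun y => k (a, y)) c d) by ring.
  rewrite !Ver. ring.
Qed.

Lemma bdry_minus (h k : C -> C) (a b c d : R) : a <= b -> c <= d ->
  cont_rect h a b c d -> cont_rect k a b c d ->
  bdry (fun z => h z - k z) a b c d = bdry h a b c d - bdry k a b c d.
Proof.
  intros Hab Hcd Ch Ck. unfold bdry.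
  rewrite !(CInt_minus (fun x => h (x, _)) (fun x => k (x, _))), !(CInt_minus (fun y => h (_, y)) (fun y => k (_, y)));
  try assumption; try (eapply cont_rect_horiz; [eassumption|lra]); try (eapply cont_rect_vert; [eassumption|lra]).
  ring.
Qed.

Lemma bdry_bound (h : C -> C) (a b c d M : R) : a <= b -> c <= d ->
  cont_rect h a b c d ->
  (forall x y, a <= x <= b -> c <= y <= d -> Cmod (h (x, y)) <= M) ->
  Cmod (bdry h a b c d) <= 2 * ((b - a) + (d - c)) * M.
Proof.
  intros Hab Hcd Ch HM. unfold bdry.
  assert (B1 : forall y, c <= y <= d -> Cmod (CInt (fun x => h (x, y)) a b) <= (b - a) * M).
  { intros y Hy. apply Cmod_CInt_le; [lra| |].
    - eapply cont_rect_horiz; eassumption.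
    - intros; apply HM; assumption. }
  assert (B2 : forall x, a <= x <= b -> Cmod (CInt (fun y => h (x, y)) c d) <= (d - c) * M).
  { intros x Hx. apply Cmod_CInt_le; [lra| |].
    - eapply cont_rect_vert; eassumption.
    - intros; apply HM; assumption. }
  eapply Rle_trans; [apply Cmod_triangle|].
  rewrite Cmod_mult, Cmod_Ci.
  pose proof (Cmod_triangle (CInt (fun x => h (x, c)) a b) (- CInt (fun x => h (x, d)) a b)) as T1.
  pose proof (Cmod_triangle (CInt (fun y => h (b, y)) c d) (- CInt (fun y => h (a, y)) c d)) as T2.
  rewrite Cmod_opp in T1, T2.
  pose proof (B1 c ltac:(lra)). pose proof (B1 d ltac:(lra)).
  pose proof (B2 a ltac:(lra)). pose proof (B2 b ltac:(lra)).
  unfold Cminus. lra.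
Qed.

Lemma bdry_split (h : C -> C) (a m b c n d : R) :
  a <= m <= b -> c <= n <= d -> cont_rect h a b c d ->
  bdry h a b c d = bdry h a m c n + bdry h m b c n + bdry h a m n d + bdry h m b n d.
Proof.
  intros Hm Hn Ch. unfold bdry.
  rewrite (CInt_Chasles (fun x => h (x, c)) a m b), (CInt_Chasles (fun x => h (x, d)) a m b),
    (CInt_Chasles (fun y => h (a, y)) c n d), (CInt_Chasles (fun y => h (b, y)) c n d);
  try lra; try (eapply cont_rect_horiz; [eassumption|lra]); try (eapply cont_rect_vert; [eassumption|lra]).
  ring.
Qed.

(** The affine part of [h] at [p] has an explicit quadratic primitive and integrates to 0, so only
    the error term contributes. The sum of the side lengths serves both as half the perimeter and as
    a bound for the distance to [p]. *)
Lemma bdry_local (h : C -> C) (a b c d : R) (p l : C) (eps : R) :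
  a <= fst p <= b -> c <= snd p <= d -> 0 <= eps -> cont_rect h a b c d ->
  (forall x y, a <= x <= b -> c <= y <= d ->
    Cmod (h (x, y) - h p - ((x, y) - p) * l) <= eps * Cmod ((x, y) - p)%C) ->
  Cmod (bdry h a b c d) <= 2 * eps * ((b - a) + (d - c)) ^ 2.
Proof.
  intros Ha Hc He Ch HB.
  set (k := fun z : C => h p + (z - p) * l).
  assert (Dk : forall z, cdiff (fun z => z * h p + (z - p) * (z - p) * (l / 2)) z (k z)).
  { intro z. unfold k.
    assert (D1 : cdiff (fun z => z - p) z (1 + 0)).
    { apply (cdiff_plus (fun z => z) (fun _ => - p)); [apply cdiff_id|apply cdiff_const]. }
    pose proof (cdiff_mult _ _ _ _ _ (cdiff_mult _ _ _ _ _ D1 D1) (cdiff_const (l / 2) z)) as D2.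
    pose proof (cdiff_mult _ _ _ _ _ (cdiff_id z) (cdiff_const (h p) z)) as D3.
    pose proof (cdiff_plus _ _ _ _ _ D3 D2) as D4. cbv beta in D4.
    match type of D4 with cdiff _ _ ?L => replace (h p + (z - p) * l) with L end; [exact D4|].
    field. }
  assert (Ck : forall z, Ccontinuous k z).
  { intro z. apply continuous_Cplus; [apply continuous_Cconst|].
    apply continuous_Cmult; [|apply continuous_Cconst].
    apply continuous_Cminus; [apply continuous_id|apply continuous_Cconst]. }
  assert (Ckr : cont_rect k a b c d) by (intros x y _ _; apply Ck).
  assert (E : bdry h a b c d = bdry (fun z => h z - k z) a b c d).
  { rewrite bdry_minus; try assumption; try lra.
    rewrite (bdry_primitive _ k a b c d ltac:(lra) ltac:(lra) Dk Ck). ring. }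
  rewrite E. set (D := ((b - a) + (d - c))%R).
  replace (2 * eps * D ^ 2)%R with (2 * D * (eps * D))%R by ring.
  apply bdry_bound; try lra.
  - intros x y Hx Hy. apply continuous_Cminus; [apply Ch; assumption|apply Ck].
  - intros x y Hx Hy. unfold k.
    replace (h (x, y) - (h p + ((x, y) - p) * l)) with (h (x, y) - h p - ((x, y) - p) * l) by ring.
    eapply Rle_trans; [apply HB; assumption|].
    apply Rmult_le_compat_l; [exact He|].
    eapply Rle_trans; [apply Cmod_le_Re_Im|]. unfold D, Re, Im. simpl.
    apply Rplus_le_compat; apply Rabs_le; lra.
Qed.

(** * Bisection of rectangles *)

Record rect : Set := mkrect { ra : R; rb : R; rc : R; rd : R }.

Definition rdiam (q : rect) : R := (rb q - ra q) + (rd q - rc q).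
Definition rbdry (h : C -> C) (q : rect) : C := bdry h (ra q) (rb q) (rc q) (rd q).

Definition rsub (q : rect) (i j : bool) : rect :=
  let m := ((ra q + rb q) / 2)%R in let n := ((rc q + rd q) / 2)%R in
  mkrect (if i then m else ra q) (if i then rb q else m) (if j then n else rc q) (if j then rd q else n).

(** Selecting a quarter by comparison of reals makes the nested rectangles an explicit iteration.
    The fourth quarter is the default: when the other three fail the strict test, the triangle
    inequality makes it large enough. *)
Definition rnext (h : C -> C) (q : rect) : rect :=
  let big q' := Rlt_dec (Cmod (rbdry h q) / 4) (Cmod (rbdry h q')) in
  if big (rsub q false false) then rsub q false false else
  if big (rsub q true false) then rsub q true false else
  if big (rsub q false true) then rsub q false true else rsub q true true.

Definition rwf (q : rect) : Prop := (ra q <= rb q) /\ rc q <= rd q.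

Lemma rnext_sub (h : C -> C) (q : rect) : exists i j, rnext h q = rsub q i j.
Proof. unfold rnext. repeat destruct Rlt_dec; eauto. Qed.

Lemma rnext_spec (h : C -> C) (q : rect) : rwf q ->
  rwf (rnext h q) /\ rdiam (rnext h q) = (rdiam q / 2)%R /\
  ra q <= ra (rnext h q) /\ rb (rnext h q) <= rb q /\
  rc q <= rc (rnext h q) /\ rd (rnext h q) <= rd q.
Proof.
  intros [H1 H2]. destruct (rnext_sub h q) as [i [j ->]].
  unfold rwf, rdiam, rsub; destruct i, j; simpl; repeat split; lra.
Qed.

Lemma rnext_big (h : C -> C) (q : rect) : rwf q -> cont_rect h (ra q) (rb q) (rc q) (rd q) ->
  Cmod (rbdry h q) / 4 <= Cmod (rbdry h (rnext h q)).
Proof.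
  intros [H1 H2] Ch. unfold rnext.
  destruct Rlt_dec as [|n1]; [lra|]. destruct Rlt_dec as [|n2]; [lra|].
  destruct Rlt_dec as [|n3]; [lra|].
  assert (E : rbdry h q = rbdry h (rsub q false false) + rbdry h (rsub q true false)
     + rbdry h (rsub q false true) + rbdry h (rsub q true true)).
  { unfold rbdry, rsub; simpl. apply bdry_split; try assumption; lra. }
  pose proof (f_equal Cmod E) as E'.
  pose proof (Cmod_triangle (rbdry h (rsub q false false) + rbdry h (rsub q true false)
     + rbdry h (rsub q false true)) (rbdry h (rsub q true true))).
  pose proof (Cmod_triangle (rbdry h (rsub q false false) + rbdry h (rsub q true false)) (rbdry h (rsub q false true))).
  pose proof (Cmod_triangle (rbdry h (rsub q false false)) (rbdry h (rsub q true false))).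
  lra.
Qed.

Lemma nested_intervals (u v : nat -> R) :
  (forall n, u n <= u (S n)) -> (forall n, v (S n) <= v n) -> (forall n, u n <= v n) ->
  exists x, forall n, u n <= x <= v n.
Proof.
  intros Hu Hv Huv.
  assert (Mu : forall n k, u n <= u (n + k)%nat).
  { intros n k. induction k; [rewrite Nat.add_0_r; lra|]. rewrite Nat.add_succ_r. specialize (Hu (n + k)%nat). lra. }
  assert (Mv : forall n k, v (n + k)%nat <= v n).
  { intros n k. induction k; [rewrite Nat.add_0_r; lra|]. rewrite Nat.add_succ_r. specialize (Hv (n + k)%nat). lra. }
  assert (Muv : forall n k, u n <= v k).
  { intros n k. pose proof (Mu n k). pose proof (Mv k n). rewrite (Nat.add_comm k n) in H0.
    specialize (Huv (n + k)%nat). lra. }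
  destruct (completeness (fun x => exists n, x = u n)) as [x [Hx1 Hx2]].
  - exists (v O). intros y [n ->]. apply Muv.
  - exists (u O), O. reflexivity.
  - exists x. intro n. split.
    + apply Hx1. exists n. reflexivity.
    + apply Hx2. intros y [k ->]. apply Muv.
Qed.

(* Goursat's bisection: continuity of the derivative is not assumed. *)
Lemma bdry_Goursat (h : C -> C) (a b c d : R) : a <= b -> c <= d ->
  (forall x y, a <= x <= b -> c <= y <= d -> exists l, cdiff h (x, y) l) ->
  bdry h a b c d = 0.
Proof.
  intros Hab Hcd Hd.
  assert (Ch : cont_rect h a b c d).
  { intros x y Hx Hy. destruct (Hd x y Hx Hy) as [l Hl]. eapply cdiff_continuous, Hl. }
  set (Q := fun n => Nat.iter n (rnext h) (mkrect a b c d)).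
  assert (QS : forall n, Q (S n) = rnext h (Q n)) by reflexivity.
  assert (W : forall n, rwf (Q n)).
  { induction n; [split; simpl; assumption|]. rewrite QS. apply rnext_spec, IHn. }
  assert (DI : forall n, rdiam (Q n) = (rdiam (Q O) / 2 ^ n)%R).
  { induction n; [simpl; field|]. rewrite QS.
    destruct (rnext_spec h (Q n) (W n)) as [_ [-> _]]. rewrite IHn. simpl. field. apply pow_nonzero; lra. }
  assert (IN : forall n, a <= ra (Q n) /\ rb (Q n) <= b /\ c <= rc (Q n) /\ rd (Q n) <= d).
  { induction n; [simpl; lra|]. rewrite QS.
    destruct (rnext_spec h (Q n) (W n)) as [_ [_ ?]]. lra. }
  assert (BG : forall n, Cmod (rbdry h (Q O)) / 4 ^ n <= Cmod (rbdry h (Q n))).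
  { induction n; [simpl; lra|]. rewrite QS.
    eapply Rle_trans; [|apply rnext_big; [apply W|]].
    - replace (Cmod (rbdry h (Q O)) / 4 ^ S n)%R with (Cmod (rbdry h (Q O)) / 4 ^ n / 4)%R; [lra|].
      simpl. field. apply pow_nonzero; lra.
    - eapply cont_rect_sub; [exact Ch|apply IN..]. }
  destruct (nested_intervals (fun n => ra (Q n)) (fun n => rb (Q n))) as [x Hx].
  { intro n. rewrite QS. apply rnext_spec, W. }
  { intro n. rewrite QS. apply rnext_spec, W. }
  { intro n. apply W. }
  destruct (nested_intervals (fun n => rc (Q n)) (fun n => rd (Q n))) as [y Hy].
  { intro n. rewrite QS. apply rnext_spec, W. }
  { intro n. rewrite QS. apply rnext_spec, W. }
  { intro n. apply W. }
  destruct (Hd x y) as [l Hl]; [apply (Hx O)|apply (Hy O)|].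
  apply Cmod_eq_0. apply Rle_antisym; [|apply Cmod_ge_0].
  apply le_epsilon. intros eps Heps. rewrite Rplus_0_l.
  set (D := rdiam (Q O)).
  assert (HD : 0 <= D) by (unfold D, rdiam; simpl; lra).
  (* Chosen so that 2 e D^2 <= eps; the rectangle may be degenerate, so D = 0 has to be allowed. *)
  set (e := (eps / (2 * (D ^ 2 + 1)))%R).
  assert (He : 0 < e) by (apply Rdiv_lt_0_compat; nra).
  destruct (Hl e He) as [dl [Hdl Hdl']].
  destruct (pow_lt_1_zero (/ 2) ltac:(rewrite Rabs_pos_eq; lra) (dl / (D + 1))) as [n Hn].
  { apply Rdiv_lt_0_compat; lra. }
  specialize (Hn n (le_n n)). rewrite Rabs_pos_eq in Hn by (apply pow_le; lra).
  rewrite pow_inv in Hn.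
  assert (P2 : 0 < 2 ^ n) by (apply pow_lt; lra).
  assert (Hn' : rdiam (Q n) < dl).
  { rewrite DI. fold D. apply Rle_lt_trans with ((D + 1) * / 2 ^ n)%R.
    - unfold Rdiv. apply Rmult_le_compat_r; [apply Rlt_le, Rinv_0_lt_compat, P2|lra].
    - rewrite Rmult_comm. apply Rlt_div_r; lra. }
  assert (B : Cmod (rbdry h (Q n)) <= 2 * e * rdiam (Q n) ^ 2).
  { apply (bdry_local h _ _ _ _ (x, y) l); simpl; try lra.
    - apply Hx. - apply Hy.
    - eapply cont_rect_sub; [exact Ch|apply IN..].
    - intros x' y' Hx' Hy'. apply Hdl'.
      eapply Rle_lt_trans; [apply Cmod_le_Re_Im|]. eapply Rle_lt_trans; [|exact Hn'].
      unfold rdiam, Re, Im. simpl. pose proof (Hx n). pose proof (Hy n).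
      apply Rplus_le_compat; apply Rabs_le; lra. }
  specialize (BG n). rewrite DI in B. fold D in B.
  change (rbdry h (Q O)) with (bdry h a b c d) in BG.
  (* The factor 4^n lost by passing to quarters is exactly regained from the square of the diameter
     D / 2^n. *)
  assert (P4 : (4 ^ n = 2 ^ n * 2 ^ n)%R) by (rewrite <- Rpow_mult_distr; f_equal; lra).
  assert (F : Cmod (bdry h a b c d) <= 2 * e * D ^ 2).
  { apply Rmult_le_reg_r with (/ 4 ^ n)%R; [apply Rinv_0_lt_compat, pow_lt; lra|].
    unfold Rdiv in BG. eapply Rle_trans; [exact BG|]. eapply Rle_trans; [exact B|].
    rewrite P4. right. field. lra. }
  eapply Rle_trans; [exact F|]. unfold e.
  replace (2 * (eps / (2 * (D ^ 2 + 1))) * D ^ 2)%R with (eps * D ^ 2 / (D ^ 2 + 1))%R by (field; nra).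
  apply Rle_div_l; nra.
Qed.

(** * Integrals over circles *)

Definition circ (r theta : R) : C := (r * cos theta, r * sin theta)%R.

Lemma Cmod_circ (r theta : R) : 0 <= r -> Cmod (circ r theta) = r.
Proof.
  intro Hr. unfold Cmod, circ. simpl fst; simpl snd.
  replace ((r * cos theta) ^ 2 + (r * sin theta) ^ 2)%R with (r ^ 2)%R.
  - apply sqrt_pow2, Hr.
  - pose proof (sin2_cos2 theta) as H. unfold Rsqr in H. nra.
Qed.

Lemma circ_neq0 (r theta : R) : 0 < r -> circ r theta <> 0.
Proof. intros Hr. apply Cmod_gt_0. rewrite Cmod_circ; lra. Qed.

Lemma Ccont_circ (r : R) : Ccont (circ r).
Proof.
  intro x. apply continuous_C_iff. unfold circ, Re, Im. simpl. split.
  - apply continuous_Rmult; [apply continuous_const|]. apply continuous_cos.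
  - apply continuous_Rmult; [apply continuous_const|]. apply continuous_sin.
Qed.

Lemma circ_mult (r s x y : R) : circ r x * circ s y = circ (r * s) (x + y).
Proof. unfold circ. apply Ceq_ReIm; unfold Re, Im; simpl; rewrite ?cos_plus, ?sin_plus; ring. Qed.

Lemma circ_pow (r x : R) (n : nat) : circ r x ^ n = circ (r ^ n) (INR n * x).
Proof.
  induction n as [|n IH].
  - unfold circ. apply Ceq_ReIm; unfold Re, Im; simpl; rewrite Rmult_0_l, ?cos_0, ?sin_0; ring.
  - rewrite Cpow_S, IH, circ_mult, S_INR. unfold circ. simpl. f_equal; f_equal; f_equal; ring.
Qed.

Lemma circ_2PI (r x : R) : circ r (x + 2 * PI) = circ r x.
Proof.
  unfold circ. rewrite cos_plus, sin_plus, cos_2PI, sin_2PI. apply Ceq_ReIm; unfold Re, Im; simpl; ring.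
Qed.

Lemma circ_polar (w : C) : exists psi, - PI <= psi <= PI /\ w = circ (Cmod w) psi.
Proof.
  destruct (Req_dec (Cmod w) 0) as [E|N].
  - exists 0%R. pose proof PI_RGT_0. split; [lra|]. rewrite E. apply Cmod_eq_0 in E. subst w.
    apply Ceq_ReIm; unfold circ, Re, Im; simpl; ring.
  - assert (P : 0 < Cmod w) by (pose proof (Cmod_ge_0 w); lra).
    assert (S : (Re w ^ 2 + Im w ^ 2 = Cmod w ^ 2)%R) by (symmetry; apply Cmod2_alt).
    set (m := Cmod w) in *.
    assert (S1 : ((Re w / m) ^ 2 + (Im w / m) ^ 2 = 1)%R).
    { replace ((Re w / m) ^ 2 + (Im w / m) ^ 2)%R with ((Re w ^ 2 + Im w ^ 2) / m ^ 2)%R by (field; lra).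
      rewrite S. field. lra. }
    assert (Bd : -1 <= Re w / m <= 1) by (split; nra).
    assert (Hc : cos (acos (Re w / m)) = (Re w / m)%R) by (apply cos_acos, Bd).
    assert (Hs : sin (acos (Re w / m)) = sqrt ((Im w / m) ^ 2)%R).
    { rewrite sin_acos by exact Bd. f_equal. unfold Rsqr. nra. }
    pose proof (acos_bound (Re w / m)) as Ab.
    destruct (Rle_dec 0 (Im w)) as [Hi|Hi].
    + exists (acos (Re w / m)). split; [lra|]. unfold circ. rewrite Hc, Hs.
      rewrite sqrt_pow2.
      2:{ apply Rmult_le_pos; [exact Hi|]. apply Rlt_le, Rinv_0_lt_compat, P. }
      apply Ceq_ReIm; unfold Re, Im; simpl; field; lra.
    + exists (- acos (Re w / m))%R. split; [lra|]. unfold circ. rewrite cos_neg, sin_neg, Hc, Hs.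
      replace ((Im w / m) ^ 2)%R with ((- Im w / m) ^ 2)%R by (field; lra).
      rewrite sqrt_pow2.
      2:{ apply Rmult_le_pos; [lra|]. apply Rlt_le, Rinv_0_lt_compat, P. }
      apply Ceq_ReIm; unfold Re, Im; simpl; field; lra.
Qed.

Lemma two_PI_pos : 0 < 2 * PI.
Proof. pose proof PI_RGT_0. lra. Qed.

Lemma RtoC_2PI_neq0 : RtoC (2 * PI) <> 0.
Proof. intro H. apply RtoC_inj in H. pose proof two_PI_pos. lra. Qed.

Lemma RInt_circle_plus (f g : R -> R) : (forall x, continuous f x) -> (forall x, continuous g x) ->
  RInt (fun x => f x + g x)%R 0 (2 * PI) = (RInt f 0 (2 * PI) + RInt g 0 (2 * PI))%R.
Proof.
  intros Hf Hg. pose proof two_PI_pos.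
  apply (RInt_plus (V := R_CompleteNormedModule)); apply ex_RInt_cont; auto; lra.
Qed.

Lemma RInt_circle_scal (k : R) (f : R -> R) : (forall x, continuous f x) ->
  RInt (fun x => k * f x)%R 0 (2 * PI) = (k * RInt f 0 (2 * PI))%R.
Proof.
  intros Hf. pose proof two_PI_pos.
  apply (RInt_scal (V := R_CompleteNormedModule)); apply ex_RInt_cont; auto; lra.
Qed.

Lemma RInt_circle_const (k : R) : RInt (fun _ => k) 0 (2 * PI) = (2 * PI * k)%R.
Proof. rewrite RInt_const, Rminus_0_r. reflexivity. Qed.

Lemma RInt_circle_le (f g : R -> R) : (forall x, continuous f x) -> (forall x, continuous g x) ->
  (forall x, f x <= g x)%R -> RInt f 0 (2 * PI) <= RInt g 0 (2 * PI).
Proof.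
  intros Hf Hg H. pose proof two_PI_pos.
  apply RInt_le; try (apply ex_RInt_cont; auto; lra); auto; lra.
Qed.

Definition circint (G : C -> C) (r : R) : C := CInt (fun x => G (circ r x)) 0 (2 * PI).

Lemma Ccont_comp_circ (G : C -> C) (r : R) : 0 <= r ->
  (forall z, Cmod z = r -> Ccontinuous G z) ->
  Ccont (fun x => G (circ r x)).
Proof.
  intros Hr H x.
  apply (continuous_comp (U := R_UniformSpace) (V := C_UniformSpace) (W := C_UniformSpace) (circ r) G).
  - apply Ccont_circ.
  - apply H, Cmod_circ, Hr.
Qed.

Lemma Ccont_entire_circ (F : C -> C) (r : R) : entire F -> Ccont (fun x => F (circ r x)).
Proof.
  intros H x.
  apply (continuous_comp (U := R_UniformSpace) (V := C_UniformSpace) (W := C_UniformSpace) (circ r) F).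
  - apply Ccont_circ.
  - apply entire_continuous, H.
Qed.

Lemma continuous_Rabs_comp {U : UniformSpace} (f : U -> R) (x : U) :
  continuous f x -> continuous (fun y => Rabs (f y)) x.
Proof. intro H. apply (continuous_comp f Rabs); [exact H|apply continuity_pt_filterlim, Rcontinuity_abs]. Qed.

Lemma continuous_Re_circ (F : C -> C) (r x : R) : entire F -> continuous (fun y => Re (F (circ r y))) x.
Proof. intro H. apply (continuous_C_iff (fun y => F (circ r y))). apply Ccont_entire_circ, H. Qed.

Ltac ccont_hyp := match goal with
  | H : Ccont ?g |- continuous ?g _ => exact (H _)
  | H : Ccont ?g |- continuous (fun x => ?g x) _ => exact (H _)
  | H : forall x, continuous ?g x |- continuous ?g _ => exact (H _)
  | H : forall x, continuous ?g x |- continuous (fun x => ?g x) _ => exact (H _)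
  end.

(** Structural recursion on the integrand. Hypotheses are tried first, so that named pieces are not
    taken apart, and the nonvanishing of denominators that are powers of [circ] is settled on the
    way. *)
Ltac ccont := intros; first [ccont_hyp | lazymatch goal with
  | |- Ccont _ => intro; ccont
  | |- Ccont_on _ _ _ => intros ? ?; ccont
  | |- continuous (fun _ => ?c) _ => apply continuous_const
  | |- continuous (fun x => Cplus (@?f x) (@?g x)) _ => apply (continuous_Cplus f g); ccont
  | |- continuous (fun x => Cminus (@?f x) (@?g x)) _ => apply (continuous_Cminus f g); ccont
  | |- continuous (fun x => Cmult (@?f x) (@?g x)) _ => apply (continuous_Cmult f g); ccont
  | |- continuous (fun x => Cdiv (@?f x) (@?g x)) _ => apply (continuous_Cdiv f g); ccont
  | |- continuous (fun x => Cpow (@?f x) ?n) _ => apply (continuous_Cpow f n); ccont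
  | |- continuous (fun x => RtoC (@?f x)) _ => apply continuous_C_iff; split; simpl; ccont
  | |- continuous (fun x => Rplus (@?f x) (@?g x)) _ => apply (continuous_Rplus f g); ccont
  | |- continuous (fun x => Rmult (@?f x) (@?g x)) _ => apply (continuous_Rmult f g); ccont
  | |- continuous (fun x => Rabs (@?f x)) _ => apply (continuous_Rabs_comp f); ccont
  | |- continuous (fun x => Cmod (@?f x)) _ => apply (continuous_Cmod f); ccont
  | |- continuous (fun x => circ ?r x) _ => apply Ccont_circ
  | |- continuous (circ ?r) _ => apply Ccont_circ
  | |- continuous (fun x => circ ?r (@?f x)) _ =>
      apply (continuous_comp (U := R_UniformSpace) (V := R_UniformSpace) (W := C_UniformSpace) f (circ r)); [ccont|apply Ccont_circ]
  | |- continuous (fun x => Re (?F (circ ?r x))) _ => apply (continuous_Re_circ F); assumption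
  | |- continuous (fun x => ?F (circ ?r x)) _ => apply (Ccont_entire_circ F); assumption
  | |- continuous (fun x => x) _ => apply continuous_id
  | |- (_ ^ _)%C <> _ => apply Cpow_nz; ccont
  | |- circ _ _ <> _ => apply circ_neq0; lra
  end].


(** Composition with exp turns the annulus into the rectangle [ln r0, ln r1] x [0, 2 pi]. Its
    horizontal sides cancel by periodicity, and its vertical sides are the two circle integrals. *)
Lemma circint_annulus (G : C -> C) (r0 r1 : R) : 0 < r0 <= r1 ->
  (forall z, r0 <= Cmod z <= r1 -> exists l, cdiff G z l) ->
  circint G r0 = circint G r1.
Proof.
  intros Hr HG. unfold circint.
  assert (L : ln r0 <= ln r1).
  { apply ln_le; lra. }
  assert (B : bdry (fun w => G (Cexp w)) (ln r0) (ln r1) 0 (2 * PI) = 0).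
  { apply bdry_Goursat; [exact L|pose proof two_PI_pos; lra|].
    intros x y Hx Hy.
    destruct (HG (Cexp (x, y))) as [l Hl].
    { rewrite Cmod_Cexp. unfold Re; simpl. split.
      - rewrite <- (exp_ln r0) by lra. apply exp_le_compat. lra.
      - rewrite <- (exp_ln r1) by lra. apply exp_le_compat. lra. }
    eexists. apply (cdiff_comp G Cexp); [apply cdiff_Cexp|exact Hl]. }
  unfold bdry in B.
  assert (E1 : forall r x, 0 < r -> Cexp (ln r, x) = circ r x).
  { intros r x Hr'. unfold Cexp, circ, Re, Im; simpl. rewrite exp_ln by exact Hr'. reflexivity. }
  rewrite (CInt_ext (fun x => G (Cexp (x, 2 * PI)%R)) (fun x => G (Cexp (x, 0)%R))) in B.
  2:{ intro x. unfold Cexp, Re, Im; simpl. rewrite cos_2PI, sin_2PI, cos_0, sin_0. reflexivity. }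
  rewrite (CInt_ext (fun y => G (Cexp (ln r0, y)))  (fun y => G (circ r0 y))) in B
    by (intro; rewrite E1 by lra; reflexivity).
  rewrite (CInt_ext (fun y => G (Cexp (ln r1, y)))  (fun y => G (circ r1 y))) in B
    by (intro; rewrite E1 by lra; reflexivity).
  symmetry. apply Ceq_sub0. apply (Cmult_eq0_r Ci); [|apply Ci_nz].
  rewrite <- B. ring.
Qed.

(** The integral is unchanged when the circle shrinks, and continuity at 0 evaluates it on small
    circles. *)
Lemma circint_MVP (G : C -> C) (r : R) : 0 < r ->
  (forall z, Cmod z <= r -> exists l, cdiff G z l) ->
  circint G r = RtoC (2 * PI) * G 0.
Proof.
  intros Hr HG. apply Ceq_sub0, Cmod_eq_0. apply Rle_antisym; [|apply Cmod_ge_0].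
  apply le_epsilon. intros eps He. rewrite Rplus_0_l.
  pose proof two_PI_pos as Hpi.
  destruct (HG 0) as [l Hl]; [rewrite Cmod_0; lra|].
  pose proof (cdiff_continuous _ _ _ Hl) as Hc. rewrite continuous_C_eps in Hc.
  destruct (Hc (eps / (2 * PI))%R) as [d [Hd Hd']]; [apply Rdiv_lt_0_compat; lra|].
  set (s := Rmin r (d / 2)).
  assert (Hs : 0 < s) by (apply Rmin_glb_lt; lra).
  assert (Hs1 : s <= r) by apply Rmin_l.
  assert (Hs2 : s <= d / 2) by apply Rmin_r.
  rewrite <- (circint_annulus G s r); [|lra|intros z Hz; apply HG; lra].
  assert (Cs : Ccont (fun x => G (circ s x))).
  { apply Ccont_comp_circ; [lra|]. intros z Hz. destruct (HG z) as [l' Hl']; [lra|].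
    eapply cdiff_continuous, Hl'. }
  replace (RtoC (2 * PI) * G 0) with (CInt (fun _ => G 0) 0 (2 * PI)) by (rewrite CInt_const, Rminus_0_r; reflexivity).
  unfold circint.
  rewrite <- CInt_minus; [|lra|ccont|ccont].
  replace eps with ((2 * PI - 0) * (eps / (2 * PI)))%R by (field; lra).
  apply Cmod_CInt_le; [lra| |].
  - ccont.
  - intros x _. apply Rlt_le, Hd'. replace (circ s x - 0) with (circ s x) by ring.
    rewrite Cmod_circ; lra.
Qed.

Lemma RInt_Re_MVP (G : C -> C) (r : R) : 0 < r ->
  (forall z, Cmod z <= r -> exists l, cdiff G z l) ->
  RInt (fun x => Re (G (circ r x))) 0 (2 * PI) = (2 * PI * Re (G 0))%R.
Proof.
  intros Hr HG. pose proof (circint_MVP G r Hr HG) as E. unfold circint in E.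
  pose proof two_PI_pos.
  rewrite CInt_ReIm in E; [|lra|].
  - apply (f_equal Re) in E. rewrite re_scal_l in E. exact E.
  - apply Ccont_Ccont_on, Ccont_comp_circ; [lra|]. intros z Hz.
    destruct (HG z) as [l Hl]; [lra|]. eapply cdiff_continuous, Hl.
Qed.

Lemma entire_RInt_Re (phi : C -> C) (r : R) : entire phi -> 0 < r ->
  RInt (fun x => Re (phi (circ r x))) 0 (2 * PI) = (2 * PI * Re (phi 0))%R.
Proof. rewrite entire_cdiff. intros H Hr. apply RInt_Re_MVP; auto. Qed.

Lemma entire_circint_MVP (F : C -> C) (r : R) : entire F -> 0 < r ->
  circint F r = RtoC (2 * PI) * F 0.
Proof. rewrite entire_cdiff. intros H Hr. apply circint_MVP; auto. Qed.

(** The Taylor coefficient at 0 by Cauchy's formula. [circint] integrates in the angle, not in dz,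
    so the power is [n] instead of n + 1. *)
Definition coef (F : C -> C) (n : nat) : C := circint (fun z => F z / z ^ n) 1 / RtoC (2 * PI).

Lemma circint_coef (F : C -> C) (n : nat) (r : R) : entire F -> 0 < r ->
  circint (fun z => F z / z ^ n) r = RtoC (2 * PI) * coef F n.
Proof.
  intros HF Hr. unfold coef.
  replace (RtoC (2 * PI) * (circint (fun z => F z / z ^ n) 1 / RtoC (2 * PI)))
    with (circint (fun z => F z / z ^ n) 1) by (field; apply RtoC_2PI_neq0).
  assert (D : forall z : C, z <> 0 -> exists l, cdiff (fun z => F z / z ^ n) z l).
  { intros z Hz. rewrite entire_cdiff in HF. destruct (HF z) as [l Hl].
    destruct (cdiff_pow (fun y => y) n z 1 (cdiff_id z)) as [m Hm].
    eexists. apply (cdiff_mult F (fun y => / y ^ n)); [exact Hl|].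
    apply cdiff_inv; [exact Hm|]. apply Cpow_nz, Hz. }
  destruct (Rle_dec r 1).
  - apply circint_annulus; [lra|]. intros z Hz. apply D, Cmod_gt_0. lra.
  - symmetry. apply circint_annulus; [lra|]. intros z Hz. apply D, Cmod_gt_0. lra.
Qed.

(** The Fourier coefficients of negative index of an entire function vanish: the mean value
    property, applied to a product that is 0 at the centre. *)
Lemma circint_pos_pow (F : C -> C) (n : nat) (r : R) : entire F -> 0 < r ->
  circint (fun z => F z * z ^ (S n)) r = 0.
Proof.
  intros HF Hr. rewrite entire_circint_MVP; [|apply entire_mult; [exact HF|apply entire_pow, entire_id]|exact Hr].
  rewrite Cpow_S. ring.
Qed.

Lemma coef_0 (F : C -> C) : entire F -> coef F 0 = F 0.
Proof.
  intro HF. pose proof (circint_coef F 0 1 HF ltac:(lra)) as H.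
  pose proof (entire_circint_MVP F 1 HF ltac:(lra)) as H2.
  assert (E : circint (fun z => F z / z ^ 0) 1 = circint F 1).
  { apply CInt_ext. intro x. simpl. field. }
  rewrite E, H2 in H. symmetry. apply Ceq_sub0. apply (Cmult_eq0_r (RtoC (2 * PI))); [|apply RtoC_2PI_neq0].
  replace (RtoC (2 * PI) * (F 0 - coef F 0)) with (RtoC (2 * PI) * F 0 - RtoC (2 * PI) * coef F 0) by ring.
  rewrite H. ring.
Qed.

Lemma coef_bound (F : C -> C) (n : nat) (r M : R) : entire F -> 0 < r ->
  (forall x, Cmod (F (circ r x)) <= M) -> Cmod (coef F n) * r ^ n <= M.
Proof.
  intros HF Hr HM. pose proof (circint_coef F n r HF Hr) as E.
  pose proof two_PI_pos.
  assert (Hrn : 0 < r ^ n) by (apply pow_lt, Hr).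
  assert (B : Cmod (circint (fun z => F z / z ^ n)%C r) <= (2 * PI - 0) * (M / r ^ n)).
  { apply Cmod_CInt_le; [lra| |].
    - ccont.
    - intros x _. rewrite Cmod_div by apply Cpow_nz, circ_neq0, Hr.
      rewrite Cmod_pow, Cmod_circ by lra.
      apply Rmult_le_compat_r; [apply Rlt_le, Rinv_0_lt_compat, Hrn|apply HM]. }
  rewrite E, Cmod_mult, Cmod_R, Rabs_pos_eq in B by lra.
  apply Rmult_le_reg_l with (2 * PI)%R; [lra|].
  replace ((2 * PI - 0) * (M / r ^ n))%R with (2 * PI * M / r ^ n)%R in B by (field; lra).
  apply Rle_div_r in B; lra.
Qed.

Lemma entire_bounded_circle (F : C -> C) (r : R) : entire F ->
  exists M, forall z, Cmod z = r -> Cmod (F z) <= M.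
Proof.
  intros HF. pose proof PI_RGT_0.
  destruct (continuity_ab_maj (fun x => Cmod (F (circ r x))) (- PI) PI) as [x [Hx _]]; [lra| |].
  - intros c _. apply continuity_pt_filterlim.
    change (continuous (fun x => Cmod (F (circ r x))) c). ccont.
  - exists (Cmod (F (circ r x))). intros z Hz.
    destruct (circ_polar z) as [psi [Hpsi ->]]. rewrite Hz. apply Hx, Hpsi.
Qed.

(** * Convergence of the Taylor expansion *)

Lemma RInt_shift_period {V : CompleteNormedModule R_AbsRing} (g : R -> V) (a : R) : 0 <= a ->
  (forall x, continuous g x) -> (forall x, g (x + 2 * PI)%R = g x) ->
  RInt (fun x => g (x + a)%R) 0 (2 * PI) = RInt g 0 (2 * PI).
Proof.
  intros Ha Hc Hp.
  assert (Ex : forall u v, ex_RInt g u v) by (intros; apply ex_RInt_continuous; intros; apply Hc).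
  assert (Sh : forall v u w, RInt (fun x => g (x + v)%R) u w = RInt g (u + v) (w + v)).
  { intros v u w. pose proof (RInt_comp_lin g 1 v u w (Ex _ _)) as E.
    rewrite !Rmult_1_l in E. rewrite <- E. apply RInt_ext. intros x _.
    rewrite Rmult_1_l. symmetry. apply (scal_one (K := R_AbsRing)). }
  rewrite Sh, Rplus_0_l.
  pose proof (RInt_Chasles g 0 a (2 * PI + a) (Ex _ _) (Ex _ _)) as E1.
  pose proof (RInt_Chasles g 0 (2 * PI) (2 * PI + a) (Ex _ _) (Ex _ _)) as E2.
  assert (E3 : RInt g (2 * PI) (2 * PI + a) = RInt g 0 a).
  { pose proof (Sh (2 * PI)%R 0 a) as E. rewrite Rplus_0_l, (Rplus_comm a) in E. rewrite <- E.
    apply RInt_ext. intros x _. apply Hp. }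
  rewrite E3, <- E1, plus_comm in E2. symmetry. exact (plus_reg_l _ _ _ E2).
Qed.

Lemma uniform_cont_C (g : R -> C) (a b eps : R) : Ccont g -> 0 < eps ->
  exists d, 0 < d /\ forall x y, a <= x <= b -> a <= y <= b -> Rabs (y - x) < d ->
    Cmod (g y - g x) < eps.
Proof.
  intros Hg He.
  destruct (unifcont_normed_1d (K := R_AbsRing) (V := C_R_NormedModule) g a b (fun x _ => Hg x) (mkposreal eps He))
    as [d Hd].
  exists d. split; [apply cond_pos|]. intros x y Hx Hy Hxy.
  specialize (Hd x y Hx Hy Hxy). unfold ball_norm in Hd. rewrite <- Cmod_norm in Hd. exact Hd.
Qed.

(** A shift by pi / n changes the sign of the oscillating factor, so twice the integral is an
    integral of g(x) - g(x + pi / n) against it, which uniform continuity makes small. The sign [sg]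
    covers positive and negative frequencies. *)
Lemma Riemann_Lebesgue (g : R -> C) (sg eps : R) : Ccont g -> (forall x, g (x + 2 * PI)%R = g x) ->
  (sg = 1 \/ sg = -1)%R -> 0 < eps ->
  exists N : nat, forall n, (N <= n)%nat ->
    Cmod (CInt (fun x => (g x * circ 1 (INR n * (sg * x)))%C) 0 (2 * PI)) <= eps.
Proof.
  intros Hg Hp Hsg He. pose proof two_PI_pos as Hpi.
  (* The extra length pi leaves room for the shift, which is at most pi. *)
  destruct (uniform_cont_C g 0 (2 * PI + PI) (eps / (2 * PI)) Hg) as [d [Hd Hd']].
  { apply Rdiv_lt_0_compat; lra. }
  destruct (archimed_cor1 (d / PI)) as [N [HN HN0]]; [apply Rdiv_lt_0_compat; lra|].
  exists N. intros n Hn.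
  assert (HNp : 0 < INR N) by (apply lt_0_INR; exact HN0).
  assert (Hnp : INR N <= INR n) by (apply le_INR; exact Hn).
  assert (Hn1 : 1 <= INR n) by (change 1%R with (INR 1); apply le_INR; lia).
  set (e := fun x => circ 1 (INR n * (sg * x))).
  set (dl := (PI / INR n)%R).
  assert (Hdl : 0 < dl <= PI).
  { split; [apply Rdiv_lt_0_compat; lra|]. unfold dl.
    apply Rmult_le_reg_r with (INR n); [lra|]. unfold Rdiv. rewrite Rmult_assoc, Rinv_l by lra. nra. }
  assert (Hdld : dl < d).
  { unfold dl. apply Rle_lt_trans with (PI * / INR N)%R.
    - apply Rmult_le_compat_l; [lra|]. apply Rinv_le_contravar; lra.
    - rewrite Rmult_comm. apply Rlt_div_r; lra. }
  assert (Ce : Ccont e) by (unfold e; ccont).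
  assert (Ep : forall x, e (x + dl)%R = - e x).
  { intro x. unfold e, circ, dl.
    replace (INR n * (sg * (x + PI / INR n)))%R with (INR n * (sg * x) + sg * PI)%R by (field; lra).
    rewrite cos_plus, sin_plus.
    assert (cos (sg * PI) = -1)%R.
    { destruct Hsg as [-> | ->]; [rewrite Rmult_1_l; apply cos_PI|].
      replace (-1 * PI)%R with (- PI)%R by ring. rewrite cos_neg. apply cos_PI. }
    assert (sin (sg * PI) = 0)%R.
    { destruct Hsg as [-> | ->]; [rewrite Rmult_1_l; apply sin_PI|].
      replace (-1 * PI)%R with (- PI)%R by ring. rewrite sin_neg, sin_PI. ring. }
    rewrite H, H0. apply Ceq_ReIm; unfold Re, Im; simpl; ring. }
  assert (E2pi : forall x, e (x + 2 * PI)%R = e x).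
  { intro x. unfold e. transitivity (circ 1 (sg * (x + 2 * PI)) ^ n).
    { rewrite circ_pow, pow1. reflexivity. }
    transitivity (circ 1 (sg * x) ^ n); [|rewrite circ_pow, pow1; reflexivity].
    f_equal. destruct Hsg as [-> | ->].
    - rewrite !Rmult_1_l. apply circ_2PI.
    - rewrite <- (circ_2PI 1 (-1 * (x + 2 * PI))). f_equal. ring. }
  assert (Cgs : Ccont (fun x => g (x + dl)%R)).
  { intro x. apply (continuous_comp (fun x => x + dl)%R g); [|apply Hg].
    apply continuous_Rplus; [apply continuous_id|apply continuous_const]. }
  set (I := CInt (fun x => g x * e x) 0 (2 * PI)).
  assert (EI : I = CInt (fun x => (- (1)) * (g (x + dl)%R * e x)) 0 (2 * PI)).
  { unfold I, CInt. rewrite <- (RInt_shift_period (V := C_R_CompleteNormedModule) (fun x => g x * e x) dl).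
    - apply (RInt_ext (V := C_R_CompleteNormedModule)). intros x _. rewrite Ep.
      change (g (x + dl)%R * - e x = - (1) * (g (x + dl)%R * e x)). ring.
    - lra.
    - ccont.
    - intro x. rewrite Hp, E2pi. reflexivity. }
  rewrite CInt_scal in EI; [|lra|ccont].
  assert (E2 : RtoC 2 * I = CInt (fun x => (g x - g (x + dl)%R) * e x) 0 (2 * PI)).
  { rewrite (CInt_ext _ (fun x => g x * e x - g (x + dl)%R * e x)) by (intro; ring).
    rewrite CInt_minus; [|lra|ccont..]. fold I.
    replace (RtoC 2 * I) with (I + I) by ring.
    rewrite EI at 2. ring. }
  assert (B : Cmod (RtoC 2 * I) <= (2 * PI - 0) * (eps / (2 * PI))).
  { rewrite E2. apply Cmod_CInt_le; [lra| |].
    - ccont.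
    - intros x Hx. rewrite Cmod_mult. unfold e at 1. rewrite Cmod_circ by lra.
      rewrite Rmult_1_r, Cmod_sub_sym. apply Rlt_le, Hd'; try lra.
      replace (x + dl - x)%R with dl by ring. rewrite Rabs_pos_eq; lra. }
  rewrite Cmod_mult, Cmod_R, Rabs_pos_eq in B by lra.
  replace ((2 * PI - 0) * (eps / (2 * PI)))%R with eps in B by (field; lra).
  change (Cmod I <= eps). pose proof (Cmod_ge_0 I). lra.
Qed.

(** Continuity of [Q], which at [w] itself comes from Carathéodory's form, is what the
    Riemann-Lebesgue lemma asks for on the circle through [w]. *)
Lemma entire_difference_quotient (F : C -> C) (w : C) : entire F ->
  exists Q : C -> C, (forall z, F z = F w + (z - w) * Q z) /\
    forall z, Ccontinuous Q z.
Proof.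
  intro HF. pose proof HF as HF'. rewrite entire_cdiff in HF'. destruct (HF' w) as [l Hl].
  apply cdiff_cara in Hl. destruct Hl as [q [H1 [H2 H3]]]. exists q. split; [exact H1|].
  intro z. destruct (Ceq_dec z w) as [->|n]; [exact H3|].
  assert (Hn : z - w <> 0) by (intro E; apply n, Ceq_sub0, E).
  assert (Cq : Ccontinuous (fun y => (F y - F w) / (y - w)) z).
  { apply continuous_Cdiv; [| |exact Hn].
    - apply continuous_Cminus; [apply entire_continuous, HF|apply continuous_Cconst].
    - apply continuous_Cminus; [apply continuous_id|apply continuous_Cconst]. }
  assert (Eq : forall y, y - w <> 0 -> q y = (F y - F w) / (y - w)).
  { intros y Hy. rewrite (H1 y). field. exact Hy. }
  rewrite continuous_C_eps in Cq. apply continuous_C_eps. intros eps He.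
  destruct (Cq eps He) as [d [Hd Hd']].
  exists (Rmin d (Cmod (z - w))). split; [apply Rmin_glb_lt; [exact Hd|apply Cmod_pos, Hn]|].
  intros y Hy.
  assert (Hyw : y - w <> 0).
  { intro E. apply Ceq_sub0 in E. subst y. rewrite Cmod_sub_sym in Hy.
    pose proof (Rmin_r d (Cmod (z - w))). lra. }
  rewrite (Eq y Hyw), (Eq z Hn). apply Hd'. eapply Rlt_le_trans; [exact Hy|apply Rmin_l].
Qed.

(** Cauchy's estimate has the fixed bound |c| on every circle; the radius is taken so large that a
    nonzero coefficient would exceed it. *)
Lemma coef_const (c : C) (n : nat) : coef (fun _ => c) (S n) = 0.
Proof.
  apply Cmod_eq_0. apply Rle_antisym; [|apply Cmod_ge_0].
  apply Rnot_lt_le. intro H. set (m := Cmod (coef (fun _ => c) (S n))) in *.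
  pose proof (Cmod_ge_0 c) as Hc.
  set (r := ((Cmod c + 1) / m + 1)%R).
  assert (Hr0 : 0 < (Cmod c + 1) / m) by (apply Rdiv_lt_0_compat; lra).
  assert (Hr : 1 <= r) by (unfold r; lra).
  pose proof (coef_bound (fun _ => c) (S n) r (Cmod c) (entire_const c) ltac:(lra) (fun _ => Rle_refl _)) as B.
  fold m in B. simpl in B. pose proof (pow_R1_Rle r n Hr).
  assert (m * r = Cmod c + 1 + m)%R by (unfold r; field; lra).
  assert (r <= r * r ^ n) by nra. nra.
Qed.

(** Works on the circle through [w], so only circles centred at 0 occur. Writing F(z) = F(w) + (z -
    w) Q(z), the coefficients of F become differences b n - w b (n + 1) of Fourier coefficients of
    Q. The partial sums telescope, with remainder w^(N+1) b N, and Riemann-Lebesgue sends it to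
    0. *)
Lemma entire_expansion_remainder (F : C -> C) (w : C) : entire F -> w <> 0 ->
  forall eps, 0 < eps -> exists N0, forall N, (N0 <= N)%nat ->
    Cmod (sum_n (G := C_AbelianMonoid) (fun n => coef F n * w ^ n)%C N - F w) <= eps.
Proof.
  intros HF Hw. set (r := Cmod w). assert (Hr : 0 < r) by apply Cmod_pos, Hw.
  pose proof two_PI_pos as Hpi.
  destruct (entire_difference_quotient F w HF) as [Q [HQ CQ]].
  set (b := fun n => circint (fun z => Q z / z ^ n) r).
  set (d := fun n => circint (fun z => Q z * z ^ n) r).
  assert (CQr : Ccont (fun x => Q (circ r x))) by (apply Ccont_comp_circ; [lra|intros; apply CQ]).
  assert (Rb : forall n, RtoC (2 * PI) * coef F (S n) = b n - w * b (S n)).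
  { intro n. rewrite <- (circint_coef F (S n) r HF Hr).
    assert (Z : circint (fun z => F w / z ^ S n) r = 0).
    { pose proof (circint_coef (fun _ => F w) (S n) r (entire_const _) Hr) as E. cbv beta in E.
      rewrite E, coef_const. ring. }
    transitivity (circint (fun z => F w / z ^ S n) r + (b n - w * b (S n))); [|rewrite Z; ring].
    unfold b, circint. rewrite <- CInt_scal, <- CInt_minus, <- CInt_plus; try lra; try ccont.
    apply CInt_ext. intro x. rewrite (HQ (circ r x)), Cpow_S. field.
    split; [apply Cpow_nz|]; apply circ_neq0, Hr. }
  assert (Rd : forall n, circint (fun z => F z * z ^ n) r =
     circint (fun z => F w * z ^ n) r + (d (S n) - w * d n)).
  { intro n. unfold d, circint. rewrite <- CInt_scal, <- CInt_minus, <- CInt_plus; try lra; try ccont.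
    apply CInt_ext. intro x. rewrite (HQ (circ r x)), Cpow_S. ring. }
  assert (Hper : forall x, Q (circ r (x + 2 * PI)) = Q (circ r x)) by (intro; rewrite circ_2PI; reflexivity).
  assert (Db : forall n, RtoC (r ^ n) * b n = CInt (fun x => Q (circ r x) * circ 1 (INR n * (-1 * x))) 0 (2 * PI)).
  { intro n. unfold b, circint. rewrite <- CInt_scal; [|lra|ccont].
    apply CInt_ext. intro x.
    assert (Ep : circ r x ^ n * circ 1 (INR n * (-1 * x)) = RtoC (r ^ n)).
    { rewrite circ_pow, circ_mult. replace (INR n * x + INR n * (-1 * x))%R with 0%R by ring.
      unfold circ. rewrite cos_0, sin_0. apply Ceq_ReIm; unfold Re, Im; simpl; ring. }
    rewrite <- Ep. field. apply Cpow_nz, circ_neq0, Hr. }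
  assert (Dd : forall n, d n = RtoC (r ^ n) * CInt (fun x => Q (circ r x) * circ 1 (INR n * (1 * x))) 0 (2 * PI)).
  { intro n. unfold d, circint. rewrite <- CInt_scal; [|lra|ccont].
    apply CInt_ext. intro x. rewrite circ_pow.
    replace (circ (r ^ n) (INR n * x)) with (RtoC (r ^ n) * circ 1 (INR n * (1 * x))); [ring|].
    unfold circ. apply Ceq_ReIm; unfold Re, Im; simpl; rewrite ?Rmult_1_l; ring. }
  (* [Rd] gives d (n + 2) = w d (n + 1), so |d (n + 1)| = r^n |d 1|. Riemann-Lebesgue, for positive
     frequencies, makes d (n + 1) / r^(n+1) tend to 0, which forces d 1 = 0. *)
  assert (d1 : d 1%nat = 0).
  { assert (Dn : forall n, d (S n) = w ^ n * d 1%nat).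
    { induction n as [|n IH]; [simpl; ring|].
      pose proof (Rd (S n)) as E. rewrite (circint_pos_pow F n r HF Hr) in E.
      pose proof (circint_pos_pow (fun _ => F w) n r (entire_const _) Hr) as E2. cbv beta in E2.
      rewrite E2 in E. rewrite Cpow_S.
      replace (d (S (S n))) with (w * d (S n)); [rewrite IH; ring|].
      symmetry. apply Ceq_sub0. rewrite E. ring. }
    apply Cmod_eq_0. apply Rle_antisym; [|apply Cmod_ge_0].
    apply le_epsilon. intros eps He. rewrite Rplus_0_l.
    destruct (Riemann_Lebesgue _ 1 (eps / r) CQr Hper ltac:(lra)) as [N HN].
    { apply Rdiv_lt_0_compat; lra. }
    specialize (HN (S N) ltac:(lia)).
    pose proof (f_equal Cmod (Dd (S N))) as E. rewrite Dn in E.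
    assert (Hrn : 0 < r ^ N) by (apply pow_lt, Hr).
    rewrite !Cmod_mult, Cmod_pow, Cmod_R, Rabs_pos_eq in E by (apply pow_le; lra).
    fold r in E. simpl pow in E.
    apply Rmult_le_reg_l with (r ^ N)%R; [exact Hrn|]. rewrite E.
    replace (r ^ N * eps)%R with (r * r ^ N * (eps / r))%R by (field; lra).
    apply Rmult_le_compat_l; [nra|exact HN]. }
  (* The start N = 0 of the telescoping is [Rd] at n = 0, where d 1 = 0 and d 0 = b 0. *)
  assert (Main : forall N, RtoC (2 * PI) * F w =
      RtoC (2 * PI) * sum_n (G := C_AbelianMonoid) (fun n => coef F n * w ^ n) N + w ^ S N * b N).
  { induction N as [|N IH].
    - rewrite sum_O. pose proof (Rd O) as E.
      rewrite d1 in E.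
      assert (E0 : circint (fun z => F z * z ^ 0) r = RtoC (2 * PI) * F 0).
      { rewrite <- (entire_circint_MVP F r HF Hr). apply CInt_ext. intro. simpl. ring. }
      assert (E1 : circint (fun z => F w * z ^ 0) r = RtoC (2 * PI) * F w).
      { pose proof (entire_circint_MVP (fun _ => F w) r (entire_const _) Hr) as H. rewrite <- H.
        apply CInt_ext. intro. simpl. ring. }
      assert (E3 : d O = b O).
      { unfold d, b, circint. apply CInt_ext. intro. simpl. field. }
      rewrite E0, E1, E3 in E. rewrite coef_0 by exact HF. simpl.
      replace (RtoC (2 * PI) * (F 0 * 1)) with (RtoC (2 * PI) * F 0) by ring. rewrite E. ring.
    - rewrite IH, sum_Sn. change plus with Cplus.
      replace (w ^ S N * b N) with (w ^ S N * (b N - w * b (S N)) + w ^ S (S N) * b (S N)) by (rewrite (Cpow_S w (S N)); ring).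
      rewrite <- Rb. ring. }
  intros eps He.
  destruct (Riemann_Lebesgue _ (-1) (eps * (2 * PI) / r) CQr Hper ltac:(lra)) as [N HN].
  { apply Rdiv_lt_0_compat; nra. }
  exists N. intros n Hn. specialize (HN n Hn). rewrite <- Db in HN. specialize (Main n).
  set (s := sum_n _ n) in *.
  assert (E : RtoC (2 * PI) * (s - F w) = - (w ^ S n * b n)).
  { replace (RtoC (2 * PI) * (s - F w)) with (RtoC (2 * PI) * s - RtoC (2 * PI) * F w) by ring.
    rewrite Main. ring. }
  apply (f_equal Cmod) in E. rewrite Cmod_opp, !Cmod_mult, Cmod_pow, Cmod_R, Rabs_pos_eq in E by lra.
  rewrite Cmod_mult, Cmod_R, Rabs_pos_eq in HN by (apply pow_le; lra).
  fold r in E. simpl pow in E.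
  apply Rmult_le_reg_l with (2 * PI)%R; [lra|]. rewrite E.
  replace (2 * PI * eps)%R with (r * (eps * (2 * PI) / r))%R by (field; lra).
  rewrite Rmult_assoc. apply Rmult_le_compat_l; [lra|exact HN].
Qed.

(** * Series and power series *)

(** [CSeries] is total and does not express convergence; this predicate adds it, coordinatewise to
    match. *)
Definition is_CSeries (a : nat -> C) (l : C) : Prop :=
  is_series (fun n => Re (a n)) (Re l) /\ is_series (fun n => Im (a n)) (Im l).

Lemma is_CSeries_unique (a : nat -> C) (l : C) : is_CSeries a l -> CSeries a = l.
Proof.
  intros [H1 H2]. unfold CSeries. rewrite (is_series_unique _ _ H1), (is_series_unique _ _ H2).
  apply Ceq_ReIm; reflexivity.
Qed.

Lemma is_CSeries_dom (a : nat -> C) (b : nat -> R) :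
  (forall n, Cmod (a n) <= b n) -> ex_series b -> is_CSeries a (CSeries a).
Proof.
  intros H Hb. split; simpl; apply Series_correct;
  apply (ex_series_le (K := R_AbsRing) (V := R_CompleteNormedModule) _ b); try exact Hb; intro n.
  - eapply Rle_trans; [apply re_le_Cmod|apply H].
  - eapply Rle_trans; [apply im_le_Cmod|apply H].
Qed.

Lemma CSeries_ext (a b : nat -> C) : (forall n, a n = b n) -> CSeries a = CSeries b.
Proof. intro H. unfold CSeries. f_equal; apply Series_ext; intro n; rewrite H; reflexivity. Qed.

Lemma is_CSeries_ext (a b : nat -> C) (l : C) : (forall n, a n = b n) -> is_CSeries a l -> is_CSeries b l.
Proof.
  intros H [A B]. split.
  - eapply is_series_ext; [|exact A]. intro n; simpl; rewrite H; reflexivity.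
  - eapply is_series_ext; [|exact B]. intro n; simpl; rewrite H; reflexivity.
Qed.

Lemma is_CSeries_plus (a b : nat -> C) (l m : C) : is_CSeries a l -> is_CSeries b m ->
  is_CSeries (fun n => a n + b n) (l + m).
Proof.
  intros [A1 A2] [B1 B2]. split.
  - apply (is_series_plus (fun n => Re (a n)) (fun n => Re (b n))); assumption.
  - apply (is_series_plus (fun n => Im (a n)) (fun n => Im (b n))); assumption.
Qed.

Lemma is_CSeries_scal (c : C) (a : nat -> C) (l : C) : is_CSeries a l ->
  is_CSeries (fun n => c * a n) (c * l).
Proof.
  intros [A1 A2]. split.
  - apply (is_series_minus (fun n => Re c * Re (a n))%R (fun n => Im c * Im (a n))%R);
      apply (is_series_scal (K := R_AbsRing) (V := R_NormedModule)); assumption.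
  - apply (is_series_plus (fun n => Re c * Im (a n))%R (fun n => Im c * Re (a n))%R);
      apply (is_series_scal (K := R_AbsRing) (V := R_NormedModule)); assumption.
Qed.

Lemma is_CSeries_minus (a b : nat -> C) (l m : C) : is_CSeries a l -> is_CSeries b m ->
  is_CSeries (fun n => a n - b n) (l - m).
Proof.
  intros A B. replace (l - m) with (l + (- (1)) * m) by ring.
  apply is_CSeries_ext with (fun n => a n + (- (1)) * b n); [intro; ring|].
  apply is_CSeries_plus; [exact A|apply is_CSeries_scal, B].
Qed.

Lemma is_CSeries_decr_1 (a : nat -> C) (l : C) : is_CSeries (fun n => a (S n)) l ->
  is_CSeries a (a O + l).
Proof.
  intros [A1 A2].
  split.
  - apply (is_series_decr_1 (fun n => Re (a n))).
    replace (plus _ _) with (Re l); [exact A1|].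
    unfold plus, opp, Re; simpl. ring.
  - apply (is_series_decr_1 (fun n => Im (a n))).
    replace (plus _ _) with (Im l); [exact A2|].
    unfold plus, opp, Im; simpl. ring.
Qed.

Lemma Rabs_Series_le (c b : nat -> R) : (forall n, Rabs (c n) <= b n) -> ex_series b ->
  Rabs (Series c) <= Series b.
Proof.
  intros H Hb. eapply Rle_trans; [apply Series_Rabs|].
  - apply (ex_series_le (K := R_AbsRing) (V := R_CompleteNormedModule) _ b); [|exact Hb]. intro n.
    change (Rabs (Rabs (c n)) <= b n). rewrite Rabs_Rabsolu. apply H.
  - apply Series_le; [|exact Hb]. intro n. split; [apply Rabs_pos|apply H].
Qed.

Lemma CSeries_bound (a : nat -> C) (b : nat -> R) :
  (forall n, Cmod (a n) <= b n) -> ex_series b -> Cmod (CSeries a) <= 2 * Series b.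
Proof.
  intros H Hb. eapply Rle_trans; [apply Cmod_le_Re_Im|].
  assert (B1 : Rabs (Series (fun n => Re (a n))) <= Series b).
  { apply Rabs_Series_le; [|exact Hb]. intro n. eapply Rle_trans; [apply re_le_Cmod|apply H]. }
  assert (B2 : Rabs (Series (fun n => Im (a n))) <= Series b).
  { apply Rabs_Series_le; [|exact Hb]. intro n. eapply Rle_trans; [apply im_le_Cmod|apply H]. }
  change (Rabs (Series (fun n => Re (a n))) + Rabs (Series (fun n => Im (a n))) <= 2 * Series b). lra.
Qed.

Lemma ex_series_Rscal (k : R) (b : nat -> R) : ex_series b -> ex_series (fun n => k * b n)%R.
Proof. apply (ex_series_scal (K := R_AbsRing) (V := R_NormedModule)). Qed.

Lemma is_CSeries_of_sums (a : nat -> C) (l : C) :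
  (forall eps, 0 < eps -> exists N0, forall N, (N0 <= N)%nat ->
    Cmod (sum_n (G := C_AbelianMonoid) a N - l) <= eps) -> is_CSeries a l.
Proof.
  intros H.
  assert (Part : forall g : C -> R, (forall x y, g (x + y)%C = (g x + g y)%R) -> (forall x, Rabs (g x) <= Cmod x) ->
    is_series (fun n => g (a n)) (g l)).
  { intros g Add Le. apply (is_lim_seq_spec (sum_n (fun n => g (a n))) (g l)). intros eps.
    destruct (H (eps / 2)%R) as [N0 HN]; [pose proof (cond_pos eps); lra|]. exists N0. intros n Hn.
    assert (E : sum_n (fun n => g (a n)) n = g (sum_n (G := C_AbelianMonoid) a n)).
    { clear Hn. induction n as [|n IH]; [rewrite !sum_O; reflexivity|]. rewrite !sum_Sn, IH. symmetry. apply Add. }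
    assert (D : forall s, g s = (g (s - l)%C + g l)%R) by (intro s; rewrite <- Add; f_equal; ring).
    rewrite E, D. specialize (HN n Hn). pose proof (Le (sum_n (G := C_AbelianMonoid) a n - l)). pose proof (cond_pos eps).
    match goal with |- Rabs (?x + ?y - ?y) < _ => replace (x + y - y)%R with x by ring end. lra. }
  split; apply Part; auto using re_plus, im_plus, re_le_Cmod, im_le_Cmod.
Qed.

(** Summable second-order remainder bounds add up to a single one, so term-by-term differentiation
    reduces to [cdiff_quad]. *)
Lemma cdiff_CSeries (F : nat -> C -> C) (F' : nat -> C) (z l : C) (M : nat -> R) (delta : R) :
  0 < delta -> ex_series M ->
  (forall n y, Cmod (y - z) < delta ->
     Cmod (F n y - F n z - (y - z) * F' n) <= M n * Cmod (y - z) ^ 2) ->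
  (forall y, Cmod (y - z) < delta -> exists s, is_CSeries (fun n => F n y) s) ->
  is_CSeries F' l ->
  cdiff (fun y => CSeries (fun n => F n y)) z l.
Proof.
  intros Hd HM HR HS Hl.
  apply (cdiff_quad _ _ _ (2 * Series M) delta Hd). intros y Hy.
  destruct (HS y Hy) as [sy Hsy].
  destruct (HS z) as [sz Hsz].
  { replace (z - z) with (RtoC 0) by ring. rewrite Cmod_0. exact Hd. }
  rewrite (is_CSeries_unique _ _ Hsy), (is_CSeries_unique _ _ Hsz).
  pose proof (is_CSeries_minus _ _ _ _ (is_CSeries_minus _ _ _ _ Hsy Hsz) (is_CSeries_scal (y - z) _ _ Hl)) as E.
  cbv beta in E. rewrite <- (is_CSeries_unique _ _ E).
  replace (2 * Series M * Cmod (y - z) ^ 2)%R with (2 * Series (fun n => Cmod (y - z) ^ 2 * M n)%R)%R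
    by (rewrite Series_scal_l; ring).
  apply CSeries_bound.
  - intro n. rewrite (Rmult_comm _ (M n)). apply HR, Hy.
  - apply ex_series_Rscal, HM.
Qed.

(** Infinite radius of convergence. Boundedness for every [rho] is what Cauchy's estimate delivers;
    passing from [rho] to 2 [rho] turns it into a geometric bound. *)
Definition superexp_decay (a : nat -> C) : Prop :=
  forall rho, 0 < rho -> exists M, forall n, Cmod (a n) * rho ^ n <= M.

Definition PS (a : nat -> C) (z : C) : C := CSeries (fun n => a n * z ^ n).

Definition dcoef (a : nat -> C) (n : nat) : C := RtoC (INR (S n)) * a (S n).

Lemma ex_series_half (M : R) : ex_series (fun n => M * (/ 2) ^ n)%R.
Proof.
  apply ex_series_Rscal.
  apply ex_series_geom. rewrite Rabs_pos_eq; lra.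
Qed.

Lemma superexp_decay_half (a : nat -> C) (s : R) : superexp_decay a -> 0 < s ->
  exists M, forall n, Cmod (a n) * s ^ n <= M * (/ 2) ^ n.
Proof.
  intros H Hs. destruct (H (2 * s)%R) as [M HM]; [lra|]. exists M. intro n.
  specialize (HM n). rewrite Rpow_mult_distr in HM.
  rewrite pow_inv. assert (P : 0 < 2 ^ n) by (apply pow_lt; lra).
  apply (Rle_div_r _ M (2 ^ n)); lra.
Qed.

Lemma PS_ex (a : nat -> C) (z : C) : superexp_decay a -> is_CSeries (fun n => a n * z ^ n) (PS a z).
Proof.
  intro H. pose proof (Cmod_ge_0 z).
  destruct (superexp_decay_half a (Cmod z + 1) H) as [M HM]; [lra|].
  apply (is_CSeries_dom _ (fun n => M * (/ 2) ^ n)%R); [|apply ex_series_half].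
  intro n. eapply Rle_trans; [|apply HM]. rewrite Cmod_mult, Cmod_pow.
  apply Rmult_le_compat_l; [apply Cmod_ge_0|]. apply pow_incr. lra.
Qed.

Lemma INR_S_le_pow2 (n : nat) : INR (S n) <= 2 ^ n.
Proof.
  induction n as [|n IH]; [simpl; lra|]. rewrite S_INR. simpl (2 ^ S n)%R.
  assert (1 <= 2 ^ n) by (apply pow_R1_Rle; lra). lra.
Qed.

(** The remainders satisfy E (n+1) = (z + h) E n + h^2 n z^(n-1). With n <= 2^n the last term is at
    most |h|^2 b^n for b = 2 (|z| + 1), and |z| + 2 <= b closes the induction. *)
Lemma pow_remainder (z h : C) (n : nat) : Cmod h <= 1 ->
  Cmod ((z + h) ^ n - z ^ n - h * (RtoC (INR n) * z ^ pred n)) <= Cmod h ^ 2 * (2 * (Cmod z + 1)) ^ n.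
Proof.
  intro Hh. pose proof (Cmod_ge_0 z) as Hz. pose proof (Cmod_ge_0 h) as Hh0. set (b := (2 * (Cmod z + 1))%R).
  induction n as [|n IH].
  - replace ((z + h) ^ 0 - z ^ 0 - h * (RtoC (INR 0) * z ^ pred 0)) with (RtoC 0) by (simpl; ring).
    rewrite Cmod_0. simpl. nra.
  - set (E := (z + h) ^ n - z ^ n - h * (RtoC (INR n) * z ^ pred n)) in *.
    assert (Eq : (z + h) ^ S n - z ^ S n - h * (RtoC (INR (S n)) * z ^ pred (S n))
       = (z + h) * E + h * h * (RtoC (INR n) * z ^ pred n)).
    { unfold E. rewrite S_INR, RtoC_plus, !Cpow_S. destruct n as [|n]; simpl pred; [simpl|rewrite !Cpow_S]; ring. }
    rewrite Eq. eapply Rle_trans; [apply Cmod_triangle|]. rewrite !Cmod_mult, Cmod_pow, Cmod_R, Rabs_pos_eq by apply pos_INR.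
    pose proof (Cmod_triangle z h) as T.
    assert (Hb : INR n * Cmod z ^ pred n <= b ^ n).
    { unfold b. rewrite Rpow_mult_distr. apply Rmult_le_compat; [apply pos_INR|apply pow_le, Hz| |].
      - pose proof (INR_S_le_pow2 n) as P. rewrite S_INR in P. lra.
      - apply Rle_trans with ((Cmod z + 1) ^ pred n)%R; [apply pow_incr; lra|apply Rle_pow; [lra|lia]]. }
    assert (A1 : Cmod (z + h) * Cmod E <= (Cmod z + 1) * (Cmod h ^ 2 * b ^ n)).
    { apply Rmult_le_compat; try apply Cmod_ge_0; [lra|exact IH]. }
    assert (A2 : Cmod h * Cmod h * (INR n * Cmod z ^ pred n) <= Cmod h ^ 2 * b ^ n).
    { replace (Cmod h ^ 2)%R with (Cmod h * Cmod h)%R by ring. apply Rmult_le_compat_l; [nra|exact Hb]. }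
    assert (0 <= Cmod z * (Cmod h ^ 2 * b ^ n)).
    { apply Rmult_le_pos; [exact Hz|]. apply Rmult_le_pos; [nra|]. apply pow_le. unfold b. lra. }
    replace (Cmod h ^ 2 * b ^ S n)%R with (b * (Cmod h ^ 2 * b ^ n))%R by (simpl; ring).
    set (X := (Cmod h ^ 2 * b ^ n)%R) in *. unfold b. lra.
Qed.

Lemma superexp_decay_dcoef (a : nat -> C) : superexp_decay a -> superexp_decay (dcoef a).
Proof.
  intros H rho Hr. destruct (H (2 * rho)%R) as [M HM]; [lra|].
  exists (M / (2 * rho))%R. intro n. specialize (HM (S n)).
  unfold dcoef. rewrite Cmod_mult, Cmod_R, Rabs_pos_eq by apply pos_INR.
  apply Rmult_le_reg_r with (2 * rho)%R; [lra|].
  replace (M / (2 * rho) * (2 * rho))%R with M by (field; lra).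
  eapply Rle_trans; [|exact HM]. simpl ((2 * rho) ^ S n)%R. rewrite Rpow_mult_distr.
  replace (INR (S n) * Cmod (a (S n)) * rho ^ n * (2 * rho))%R
    with (INR (S n) * (Cmod (a (S n)) * rho ^ n * (2 * rho)))%R by ring.
  replace (Cmod (a (S n)) * (2 * rho * (2 ^ n * rho ^ n)))%R
    with (2 ^ n * (Cmod (a (S n)) * rho ^ n * (2 * rho)))%R by ring.
  apply Rmult_le_compat_r; [|apply INR_S_le_pow2].
  apply Rmult_le_pos; [|lra]. apply Rmult_le_pos; [apply Cmod_ge_0|apply pow_le; lra].
Qed.

Lemma cdiff_PS (a : nat -> C) (z : C) : superexp_decay a -> cdiff (PS a) z (PS (dcoef a) z).
Proof.
  intro H. pose proof (Cmod_ge_0 z).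
  destruct (superexp_decay_half a (2 * (Cmod z + 1)) H) as [M HM]; [lra|].
  apply (cdiff_CSeries (fun n y => a n * y ^ n) (fun n => a n * (RtoC (INR n) * z ^ pred n)) z _
    (fun n => M * (/ 2) ^ n)%R 1); [lra|apply ex_series_half| | |].
  - intros n y Hy. set (h := y - z) in *.
    replace y with (z + h) by (unfold h; ring).
    replace (a n * (z + h) ^ n - a n * z ^ n - h * (a n * (RtoC (INR n) * z ^ pred n)))
      with (a n * ((z + h) ^ n - z ^ n - h * (RtoC (INR n) * z ^ pred n))) by ring.
    rewrite Cmod_mult.
    eapply Rle_trans; [apply Rmult_le_compat_l; [apply Cmod_ge_0|apply pow_remainder; lra]|].
    specialize (HM n).
    replace (Cmod (a n) * (Cmod h ^ 2 * (2 * (Cmod z + 1)) ^ n))%R with ((Cmod (a n) * (2 * (Cmod z + 1)) ^ n) * Cmod h ^ 2)%R by ring.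
    apply Rmult_le_compat_r; [apply pow2_ge_0|exact HM].
  - intros y _. exists (PS a y). apply PS_ex, H.
  (* The differentiated series has one more term, at index 0, than the series of [dcoef]; its factor
     [INR 0] kills it, whatever [pred 0] stands for. *)
  - replace (PS (dcoef a) z) with (a O * (RtoC (INR 0) * z ^ pred 0) + PS (dcoef a) z)
      by (change (INR 0) with 0%R; ring).
    apply (is_CSeries_decr_1 (fun n => a n * (RtoC (INR n) * z ^ pred n))).
    apply is_CSeries_ext with (fun n => dcoef a n * z ^ n).
    + intro n. unfold dcoef. simpl pred. ring.
    + apply PS_ex, superexp_decay_dcoef, H.
Qed.

Lemma entire_PS (a : nat -> C) : superexp_decay a -> entire (PS a).
Proof. intro H. apply entire_cdiff. intro z. eexists. apply cdiff_PS, H. Qed.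

Lemma superexp_decay_coef (F : C -> C) : entire F -> superexp_decay (coef F).
Proof.
  intros HF rho Hr. destruct (entire_bounded_circle F rho HF) as [M HM].
  exists M. intro n. apply coef_bound; [exact HF|exact Hr|].
  intro x. apply HM, Cmod_circ. lra.
Qed.

Lemma entire_eq_PS (F : C -> C) (w : C) : entire F -> F w = PS (coef F) w.
Proof.
  intro HF. symmetry. apply is_CSeries_unique.
  destruct (Ceq_dec w 0) as [->|n].
  - apply is_CSeries_of_sums. intros eps He. exists O. intros N _.
    assert (E : sum_n (G := C_AbelianMonoid) (fun n => coef F n * 0 ^ n) N = F 0).
    { induction N as [|N IH].
      - rewrite sum_O, coef_0 by exact HF. apply Cmult_1_r.
      - rewrite sum_Sn, IH. change (F 0 + coef F (S N) * (0 * 0 ^ N) = F 0). ring. }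
    rewrite E. replace (F 0 - F 0) with (RtoC 0) by ring. rewrite Cmod_0. lra.
  - apply is_CSeries_of_sums. apply entire_expansion_remainder; assumption.
Qed.

Lemma entire_derivative (F : C -> C) : entire F ->
  exists F' : C -> C, entire F' /\ forall z, cdiff F z (F' z).
Proof.
  intro HF. pose proof (superexp_decay_coef F HF) as HD.
  exists (PS (dcoef (coef F))). split.
  - apply entire_PS, superexp_decay_dcoef, HD.
  - intro z. apply cdiff_ext with (PS (coef F)); [intro; symmetry; apply entire_eq_PS, HF|].
    apply cdiff_PS, HD.
Qed.

Lemma entire_primitive (F : C -> C) : entire F ->
  exists G : C -> C, entire G /\ forall z, cdiff G z (F z).
Proof.
  intro HF. pose proof (superexp_decay_coef F HF) as HD.
  set (b := fun n => match n with O => RtoC 0 | S m => coef F m / RtoC (INR (S m)) end).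
  assert (Hb : superexp_decay b).
  { intros rho Hr. destruct (HD rho Hr) as [M HM]. exists (Rmax 0 (M * rho)). intros [|n]; simpl b.
    - rewrite Cmod_0. simpl. rewrite Rmult_0_l. apply Rmax_l.
    - eapply Rle_trans; [|apply Rmax_r].
      assert (Hn : 1 <= INR (S n)) by (change 1%R with (INR 1); apply le_INR; lia).
      assert (Hn0 : RtoC (INR (S n)) <> 0) by (intro E; apply RtoC_inj in E; lra).
      change (match n with O => 1%R | S _ => (INR n + 1)%R end) with (INR (S n)).
      rewrite Cmod_div by exact Hn0. rewrite Cmod_R, Rabs_pos_eq by lra.
      specialize (HM n). simpl (rho ^ S n)%R.
      pose proof (Cmod_ge_0 (coef F n)). assert (0 < rho ^ n) by (apply pow_lt, Hr).
      assert (Cmod (coef F n) / INR (S n) <= Cmod (coef F n)).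
      { unfold Rdiv. rewrite <- (Rmult_1_r (Cmod (coef F n))) at 2.
        apply Rmult_le_compat_l; [assumption|]. rewrite <- Rinv_1. apply Rinv_le_contravar; lra. }
      replace (Cmod (coef F n) / INR (S n) * (rho * rho ^ n))%R with ((Cmod (coef F n) / INR (S n)) * rho ^ n * rho)%R by ring.
      apply Rmult_le_compat_r; [lra|]. eapply Rle_trans; [|exact HM].
      apply Rmult_le_compat_r; lra. }
  exists (PS b). split; [apply entire_PS, Hb|].
  intro z. rewrite (entire_eq_PS F z HF).
  replace (PS (coef F) z) with (PS (dcoef b) z); [apply cdiff_PS, Hb|].
  apply CSeries_ext. intro n. f_equal. unfold dcoef, b.
  assert (Hn : 1 <= INR (S n)) by (change 1%R with (INR 1); apply le_INR; lia).
  field. intro E. apply RtoC_inj in E. lra.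
Qed.

Lemma PS_shift (a : nat -> C) (z : C) : superexp_decay a ->
  superexp_decay (fun n => a (S n)) /\ PS a z = a O + z * PS (fun n => a (S n)) z.
Proof.
  intro H.
  assert (HS : superexp_decay (fun n => a (S n))).
  { intros rho Hr. destruct (H rho Hr) as [M HM]. exists (M / rho)%R. intro n.
    specialize (HM (S n)). simpl in HM.
    apply (Rle_div_r _ M rho); lra. }
  split; [exact HS|]. apply is_CSeries_unique.
  replace (a O + z * PS (fun n => a (S n)) z) with (a O * z ^ 0 + z * PS (fun n => a (S n)) z) by (simpl; ring).
  apply (is_CSeries_decr_1 (fun n => a n * z ^ n)).
  apply is_CSeries_ext with (fun n => z * (a (S n) * z ^ n)); [intro; rewrite Cpow_S; ring|].
  apply is_CSeries_scal, PS_ex, HS.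
Qed.

Lemma PS_shift_iter (m : nat) : forall a : nat -> C, superexp_decay a -> (forall k, (k < m)%nat -> a k = 0) ->
  superexp_decay (fun n => a (m + n)%nat) /\ forall z, PS a z = z ^ m * PS (fun n => a (m + n)%nat) z.
Proof.
  induction m as [|m IH]; intros a H H0.
  - split; [exact H|]. intro z. simpl. symmetry. apply Cmult_1_l.
  - destruct (PS_shift a 0 H) as [HS _].
    destruct (IH (fun n => a (S n)) HS) as [A B]; [intros; apply H0; lia|].
    split; [exact A|]. intro z. destruct (PS_shift a z H) as [_ ->].
    rewrite B, (H0 O) by lia. rewrite Cpow_S.
    replace (PS (fun n => a (S m + n)%nat) z) with (PS (fun n => a (S (m + n))) z) by reflexivity. ring.
Qed.

Lemma PS_at_0 (a : nat -> C) : superexp_decay a -> PS a 0 = a O.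
Proof. intro H. destruct (PS_shift a 0 H) as [_ ->]. ring. Qed.

(** The order is the index of the first nonzero Taylor coefficient at [w]; if there were none, F
    would vanish at [z0] too. *)
Lemma zero_order_exists (F : C -> C) (w z0 : C) : entire F -> F z0 <> 0 -> exists m, zero_order F w m.
Proof.
  intros HF Hz.
  set (G := fun z => F (w + z)). assert (HG : entire G) by apply entire_shift, HF.
  pose proof (superexp_decay_coef G HG) as HD.
  assert (Ex : exists m, coef G m <> 0).
  { apply Classical_Prop.NNPP. intro Hn. apply Hz.
    replace (F z0) with (G (z0 - w)) by (unfold G; f_equal; ring).
    rewrite (entire_eq_PS G _ HG). apply is_CSeries_unique.
    apply is_CSeries_ext with (fun n => 0 * (coef G n * (z0 - w) ^ n)).
    { intro n. assert (E : coef G n = 0) by (apply Classical_Prop.NNPP; intro E; apply Hn; exists n; exact E).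
      rewrite E. ring. }
    pose proof (is_CSeries_scal 0 _ _ (PS_ex (coef G) (z0 - w) HD)) as E.
    rewrite (Cmult_0_l (PS _ _)) in E. exact E. }
  assert (Min : exists m, coef G m <> 0 /\ forall k, (k < m)%nat -> coef G k = 0).
  { destruct Ex as [m0 Hm0]. revert Hm0. induction m0 as [m0 IHm] using (well_founded_induction Wf_nat.lt_wf). intro Hm0.
    destruct (Classical_Prop.classic (exists k, (k < m0)%nat /\ coef G k <> 0)) as [[k [Hk1 Hk2]]|Hno].
    - apply (IHm k Hk1 Hk2).
    - exists m0. split; [exact Hm0|]. intros k Hk. apply Classical_Prop.NNPP. intro E. apply Hno. eauto. }
  destruct Min as [m [Hm1 Hm2]].
  destruct (PS_shift_iter m (coef G) HD Hm2) as [A B].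
  exists m, (fun z => PS (fun n => coef G (m + n)%nat) (z - w)). split; [|split].
  - apply (entire_comp (PS (fun n => coef G (m + n)%nat)) (fun z => z - w)); [apply entire_PS, A|].
    apply (entire_plus (fun z => z) (fun _ => - w)); [apply entire_id|apply entire_const].
  - replace (w - w) with (RtoC 0) by ring. rewrite PS_at_0 by exact A. rewrite Nat.add_0_r. exact Hm1.
  - intro z. rewrite <- B. rewrite <- (entire_eq_PS G _ HG). unfold G. f_equal. ring.
Qed.

(** * Zero-free quotients, logarithms and the submean inequality *)

Lemma entire_nonzero_near (g : C -> C) (w : C) : entire g -> g w <> 0 ->
  exists d, 0 < d /\ forall z, Cmod (z - w) < d -> g z <> 0.
Proof.
  intros Hg Hw. pose proof (entire_continuous g w Hg) as Hc. rewrite continuous_C_eps in Hc.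
  destruct (Hc (Cmod (g w)) (Cmod_pos _ Hw)) as [d [Hd Hd']].
  exists d. split; [exact Hd|]. intros z Hz E. specialize (Hd' z Hz).
  rewrite E in Hd'. replace (0 - g w) with (- g w) in Hd' by ring. rewrite Cmod_opp in Hd'. lra.
Qed.

(** At each [w] both functions split off the same power of z - w, leaving cofactors g and h that are
    nonzero at [w]. The quotient h/g is differentiable near [w] and agrees with G/F off the
    zeros. *)
Lemma zero_free_quotient (F G : C -> C) (z0 : C) : entire F -> entire G -> F z0 <> 0 ->
  same_zeros F G ->
  exists S : C -> C, entire S /\ (forall z, S z <> 0) /\ forall z, G z = S z * F z.
Proof.
  intros HF HG Hz0 HS.
  assert (Loc : forall w, exists p : nat * (C -> C) * (C -> C),
    let '(m, g, h) := p in
    entire g /\ g w <> 0 /\ entire h /\ h w <> 0 /\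
    (forall z, F z = (z - w) ^ m * g z) /\ (forall z, G z = (z - w) ^ m * h z)).
  { intro w. destruct (zero_order_exists F w z0 HF Hz0) as [m Hm].
    pose proof (proj1 (HS w m) Hm) as Hm'.
    destruct Hm as [g [G1 [G2 G3]]], Hm' as [h [H1 [H2 H3]]].
    exists (m, g, h). tauto. }
  set (p := fun w => proj1_sig (constructive_indefinite_description _ (Loc w))).
  assert (Hp : forall w, let '(m, g, h) := p w in
    entire g /\ g w <> 0 /\ entire h /\ h w <> 0 /\
    (forall z, F z = (z - w) ^ m * g z) /\ (forall z, G z = (z - w) ^ m * h z)).
  { intro w. exact (proj2_sig (constructive_indefinite_description _ (Loc w))). }
  clearbody p.
  (* Evaluation on the diagonal: the value at [w] uses the factorisation chosen at [w], so the
     choices need not be compatible. *)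
  exists (fun w => snd (p w) w / snd (fst (p w)) w).
  assert (Quot : forall z, F z <> 0 -> snd (p z) z / snd (fst (p z)) z = G z / F z).
  { intros z Hz. specialize (Hp z). destruct (p z) as [[m g] h]. simpl.
    destruct Hp as [G1 [G2 [H1 [H2 [E1 E2]]]]].
    destruct m as [|m].
    - rewrite E1, E2. simpl. field. exact G2.
    - exfalso. apply Hz. rewrite E1, Cpow_S. ring. }
  split; [|split].
  - apply entire_cdiff. intro w. pose proof (Hp w) as Hw.
    destruct (p w) as [[m g] h] eqn:Epw.
    destruct Hw as [G1 [G2 [H1 [H2 [E1 E2]]]]].
    destruct (entire_nonzero_near g w G1 G2) as [d [Hd Hd']].
    pose proof H1 as H1'. pose proof G1 as G1'. rewrite entire_cdiff in H1', G1'.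
    destruct (H1' w) as [lh Hlh], (G1' w) as [lg Hlg].
    eexists.
    apply (cdiff_ext_loc (fun z => h z * / g z) _ w _ d Hd).
    2:{ apply cdiff_mult; [exact Hlh|]. apply cdiff_inv; [exact Hlg|exact G2]. }
    intros z Hz. destruct (Ceq_dec z w) as [->|n]; [rewrite Epw; reflexivity|].
    assert (Hn : z - w <> 0) by (intro E; apply n, Ceq_sub0, E).
    assert (Fz : F z <> 0).
    { rewrite E1. apply Cmult_neq_0; [apply Cpow_nz, Hn|apply Hd', Hz]. }
    rewrite (Quot z Fz), E1, E2. field. split; [apply Hd', Hz|apply Cpow_nz, Hn].
  - intro z. specialize (Hp z). destruct (p z) as [[m g] h]. simpl.
    destruct Hp as [G1 [G2 [H1 [H2 _]]]]. intro E. apply H2.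
    replace (h z) with (h z / g z * g z) by (field; exact G2). rewrite E. ring.
  - intro z. specialize (Hp z). destruct (p z) as [[m g] h]. simpl.
    destruct Hp as [G1 [G2 [H1 [H2 [E1 E2]]]]]. rewrite E1, E2. field. exact G2.
Qed.

Lemma cdiff_zero_const (H : C -> C) : (forall z, cdiff H z 0) -> forall z, H z = H 0.
Proof.
  intros D z.
  pose proof (CInt_line_FTC H (fun _ => RtoC 0) 0 z 0 1 ltac:(lra) D (fun _ => continuous_Cconst _ _)) as E.
  rewrite (CInt_ext _ (fun _ => 0)) in E by (intro; ring).
  rewrite CInt_const in E.
  replace (0 + RtoC 1 * z) with z in E by ring. replace (0 + RtoC 0 * z) with (RtoC 0) in E by ring.
  apply Ceq_sub0. rewrite <- E. ring.
Qed.

Lemma Cexp_surj (c : C) : c <> 0 -> exists k, c = Cexp k.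
Proof.
  intro Hc. destruct (circ_polar c) as [psi [_ E]].
  exists (ln (Cmod c), psi). rewrite E at 1. unfold Cexp, circ, Re, Im. simpl.
  rewrite exp_ln by (apply Cmod_pos, Hc). reflexivity.
Qed.

(** A primitive of F'/F exists by integrating its Taylor series; F exp(-Phi) then has derivative 0,
    and its constant value goes into the exponent. *)
Lemma entire_log (F : C -> C) : entire F -> (forall z, F z <> 0) ->
  exists phi, entire phi /\ forall z, F z = Cexp (phi z).
Proof.
  intros HF Hnz.
  destruct (entire_derivative F HF) as [F' [HF' D]].
  assert (HL : entire (fun z => F' z * / F z)) by (apply entire_mult; [exact HF'|apply entire_inv; assumption]).
  destruct (entire_primitive _ HL) as [Phi [HPhi DPhi]].
  set (H := fun z => F z * Cexp (- Phi z)).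
  assert (DH : forall z, cdiff H z 0).
  { intro z. pose proof (cdiff_comp Cexp (fun z => - Phi z) z _ _ (cdiff_opp _ _ _ (DPhi z)) (cdiff_Cexp _)) as D1.
    pose proof (cdiff_mult _ _ _ _ _ (D z) D1) as D2. cbv beta in D2.
    match type of D2 with cdiff _ _ ?L => replace (RtoC 0) with L end; [exact D2|].
    field. apply Hnz. }
  assert (HH : forall z, H z = H 0) by (apply cdiff_zero_const, DH).
  destruct (Cexp_surj (H 0)) as [k Hk].
  { unfold H. apply Cmult_neq_0; [apply Hnz|apply Cexp_neq0]. }
  exists (fun z => Phi z + k). split.
  - apply entire_plus; [exact HPhi|apply entire_const].
  - intro z. rewrite Cexp_plus, <- Hk, <- (HH z). unfold H.
    replace (Cexp (Phi z) * (F z * Cexp (- Phi z))) with (F z * Cexp (Phi z + - Phi z)) by (rewrite Cexp_plus; ring).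
    replace (Phi z + - Phi z) with (RtoC 0) by ring. rewrite Cexp_0. ring.
Qed.

(** * The submean inequality for ln |F|, and Taylor coefficients bounded by the real part *)

Fixpoint psum (f : nat -> R) (n : nat) : R :=
  match n with O => 0%R | S k => (psum f k + f k)%R end.

Fixpoint cprod (f : nat -> C -> C) (n : nat) (z : C) : C :=
  match n with O => 1 | S k => cprod f k z * f k z end.

(** Left-endpoint sums against the integral; on each step only the one-sided comparison of [V] with
    its value at the left end is used. *)
Lemma Riemann_sum_le (V : R -> R) (eps dl : R) (n : nat) :
  (forall x, continuous V x) -> 0 <= dl ->
  (forall s t, 0 <= s -> s <= t <= s + dl -> t <= INR n * dl -> V s <= V t + eps) ->
  forall k, (k <= n)%nat ->
    (dl * psum (fun j => V (INR j * dl)) k <= RInt V 0 (INR k * dl) + INR k * dl * eps)%R.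
Proof.
  intros HV Hdl HU.
  assert (Ex : forall u v, ex_RInt V u v) by (intros; apply (ex_RInt_continuous (V := R_CompleteNormedModule)); intros; apply HV).
  induction k as [|k IH]; intro Hk.
  - simpl. rewrite Rmult_0_l. change (RInt V 0 0) with (RInt (V := R_CompleteNormedModule) V 0 0).
    rewrite RInt_point. change (zero (G := R_CompleteNormedModule)) with 0%R. lra.
  - specialize (IH ltac:(lia)). simpl psum. rewrite S_INR.
    set (u := (INR k * dl)%R) in *.
    assert (Hu : 0 <= u) by (apply Rmult_le_pos; [apply pos_INR|exact Hdl]).
    replace ((INR k + 1) * dl)%R with (u + dl)%R by (unfold u; ring).
    assert (HuN : u + dl <= INR n * dl).
    { unfold u. replace (INR k * dl + dl)%R with (INR (S k) * dl)%R by (rewrite S_INR; ring).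
      apply Rmult_le_compat_r; [exact Hdl|]. apply le_INR, Hk. }
    pose proof (RInt_Chasles (V := R_CompleteNormedModule) V 0 u (u + dl) (Ex _ _) (Ex _ _)) as Ch.
    change plus with Rplus in Ch. rewrite <- Ch.
    assert (L : (RInt (fun _ => V u - eps) u (u + dl) <= RInt V u (u + dl))%R).
    { apply RInt_le; [lra| |apply Ex|].
      - apply ex_RInt_const.
      - intros x Hx. specialize (HU u x Hu ltac:(lra) ltac:(lra)). lra. }
    rewrite RInt_const in L. change (scal (u + dl - u)%R (V u - eps)%R) with ((u + dl - u) * (V u - eps))%R in L.
    nra.
Qed.

(* Averaging [prod_k F (z w^k)] over the n-th roots of unity [w^k] turns the mean value property
   into the submean inequality for [ln |F|], up to the error of a Riemann sum. *)
Lemma ln_submean (F : C -> C) (W : R -> R) (r : R) : entire F -> F 0 <> 0 -> 0 < r ->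
  (forall x, continuous W x) -> (forall x, W (x + 2 * PI)%R = W x) ->
  (forall x, Cmod (F (circ r x)) <= exp (W x)) ->
  2 * PI * ln (Cmod (F 0)) <= RInt W 0 (2 * PI).
Proof.
  intros HF H0 Hr HW Hp HB. pose proof two_PI_pos as Hpi.
  apply le_epsilon. intros eps He.
  set (e := (eps / (2 * PI))%R). assert (He' : 0 < e) by (apply Rdiv_lt_0_compat; lra).
  (* The arguments are t + x with t and x both in [0, 2 pi]. *)
  destruct (unifcont_normed_1d (K := R_AbsRing) (V := R_NormedModule) W 0 (2 * (2 * PI)) (fun x _ => HW x) (mkposreal e He'))
    as [d Hd].
  destruct (archimed_cor1 (d / (2 * PI))) as [n [Hn Hn0]].
  { apply Rdiv_lt_0_compat; [apply cond_pos|lra]. }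
  assert (Hnp : 0 < INR n) by (apply lt_0_INR; exact Hn0).
  set (dl := (2 * PI / INR n)%R).
  assert (Hdl : 0 < dl) by (apply Rdiv_lt_0_compat; lra).
  assert (Hdld : dl < d).
  { unfold dl, Rdiv. rewrite Rmult_comm. apply Rlt_div_r; lra. }
  assert (Hndl : (INR n * dl = 2 * PI)%R) by (unfold dl; field; lra).
  set (G := cprod (fun k z => F (z * circ 1 (INR k * dl))) n).
  assert (EG : entire G).
  { unfold G. clearbody dl. clear - HF. induction n as [|k IH]; [apply (entire_const 1)|].
    apply (entire_mult (cprod (fun k z => F (z * circ 1 (INR k * dl))) k) (fun z => F (z * circ 1 (INR k * dl)))); [exact IH|].
    apply (entire_comp F (fun z => z * circ 1 (INR k * dl))); [exact HF|].
    apply entire_mult; [apply entire_id|apply entire_const]. }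
  assert (G0 : G 0 = F 0 ^ n).
  { unfold G. clearbody dl. clear. induction n as [|k IH]; [reflexivity|]. simpl cprod. rewrite IH.
    rewrite Cmult_0_l. simpl. ring. }
  (* The bound does not depend on x: the exponents sum to a Riemann sum of a translate of [W], and
     periodicity gives all translates the same integral. *)
  assert (Bd : forall x, 0 <= x <= 2 * PI -> Cmod (G (circ r x)) <= exp ((RInt W 0 (2 * PI) + eps) / dl)).
  { intros x Hx.
    apply Rle_trans with (exp (psum (fun j => W (INR j * dl + x)%R) n)).
    - unfold G. clearbody dl. clear - HB. induction n as [|k IH].
      + simpl. rewrite Cmod_1, exp_0. lra.
      + simpl cprod. simpl psum. rewrite Cmod_mult, exp_plus.
        apply Rmult_le_compat; try apply Cmod_ge_0; [exact IH|].
        rewrite circ_mult, Rmult_1_r, (Rplus_comm x). apply HB.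
    - assert (L : (dl * psum (fun j => W (INR j * dl + x)%R) n <=
        RInt (fun t => W (t + x)%R) 0 (INR n * dl) + INR n * dl * e)).
      { apply (Riemann_sum_le (fun t => W (t + x)%R) e dl n); [|lra| |lia].
        - intro y. apply (continuous_comp (fun t => t + x)%R W); [ccont|apply HW].
        - intros s t Hs Ht Htn. rewrite Hndl in Htn.
          assert (Hb : ball (t + x)%R d (s + x)%R).
          { change (Rabs (s + x - (t + x)) < d). replace (s + x - (t + x))%R with (- (t - s))%R by ring.
            rewrite Rabs_Ropp, Rabs_pos_eq by lra. lra. }
          assert (Q : (Rabs (W (s + x) - W (t + x)) < e)%R).
          { apply (Hd (t + x)%R (s + x)%R); [lra|lra|exact Hb]. }
          apply Rabs_def2 in Q. lra. }
      rewrite Hndl in L.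
      rewrite (RInt_shift_period (V := R_CompleteNormedModule) W x) in L; [|lra|exact HW|exact Hp].
      replace (2 * PI * e)%R with eps in L by (unfold e; field; lra).
      assert (Q : (psum (fun j => W (INR j * dl + x)) n <= (RInt W 0 (2 * PI) + eps) / dl)%R).
      { apply Rle_div_r; lra. }
      apply exp_le_compat, Q. }
  assert (B2 : Cmod (circint G r) <= (2 * PI - 0) * exp ((RInt W 0 (2 * PI) + eps) / dl)).
  { apply Cmod_CInt_le; [lra|ccont|exact Bd]. }
  rewrite (entire_circint_MVP G r EG Hr), G0, Cmod_mult, Cmod_R, Rabs_pos_eq, Cmod_pow in B2 by lra.
  rewrite Rminus_0_r in B2. apply Rmult_le_reg_l in B2; [|lra].
  assert (P0 : 0 < Cmod (F 0)) by apply Cmod_pos, H0.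
  (* Multiplying by [dl] turns the exponent n coming from [G0] into n dl = 2 pi. *)
  assert (L : INR n * ln (Cmod (F 0)) <= (RInt W 0 (2 * PI) + eps) / dl).
  { rewrite <- ln_pow by exact P0. rewrite <- (ln_exp ((RInt W 0 (2 * PI) + eps) / dl)).
    apply ln_le; [apply pow_lt, P0|exact B2]. }
  apply (Rle_div_r _ _ dl) in L; [|lra]. rewrite <- Hndl in L |- *. lra.
Qed.

Lemma CInt_conj (f : R -> C) (a b : R) : a <= b -> Ccont_on f a b ->
  CInt (fun x => Cconj (f x)) a b = Cconj (CInt f a b).
Proof.
  intros Hab H.
  assert (H' : Ccont_on (fun x => Cconj (f x)) a b).
  { intros x Hx. apply continuous_C_iff. split.
    - apply (Ccont_on_Re f a b H x Hx).
    - apply (continuous_opp (V := R_NormedModule) (fun y => Im (f y))). apply (Ccont_on_Im f a b H x Hx). }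
  rewrite (CInt_ReIm f), CInt_ReIm by assumption.
  apply Ceq_ReIm; [reflexivity|].
  change (RInt (fun x => (- Im (f x))%R) a b = (- RInt (fun x => Im (f x)) a b)%R).
  apply (RInt_opp (V := R_CompleteNormedModule) (fun x => Im (f x))).
  apply ex_RInt_cont; [exact Hab|]. apply (Ccont_on_Im f a b H).
Qed.

(** Adding the conjugate of a vanishing Fourier coefficient of negative index replaces phi by 2 Re
    phi in Cauchy's formula. This gives the bound with a factor 1/pi, which is relaxed to 1. *)
Lemma coef_le_mean_Re (phi : C -> C) (n : nat) (r : R) : entire phi -> 0 < r ->
  Cmod (coef phi (S n)) * r ^ S n <= RInt (fun x => Rabs (Re (phi (circ r x)))) 0 (2 * PI).
Proof.
  intros HF Hr. pose proof two_PI_pos as Hpi. set (m := S n).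
  assert (Cp : Ccont (fun x => phi (circ r x) * circ r x ^ m)) by ccont.
  assert (Z : CInt (fun x => Cconj (phi (circ r x) * circ r x ^ m)) 0 (2 * PI) = 0).
  { rewrite CInt_conj; [|lra|ccont].
    change (CInt (fun x => phi (circ r x) * circ r x ^ m) 0 (2 * PI)) with (circint (fun z => phi z * z ^ S n) r).
    rewrite (circint_pos_pow phi n r HF Hr). apply Ceq_ReIm; unfold Re, Im; simpl; ring. }
  assert (Pr : 0 < r ^ m) by (apply pow_lt, Hr).
  assert (Nr : RtoC (r ^ m) <> 0) by (intro E; apply RtoC_inj in E; lra).
  assert (Inv : forall x, Cconj (circ r x ^ m) = RtoC (r ^ m) * RtoC (r ^ m) / circ r x ^ m).
  { intro x. assert (E : circ r x ^ m * Cconj (circ r x ^ m) = RtoC (r ^ m) * RtoC (r ^ m)).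
    { rewrite <- Cmod2_conj, Cmod_pow, Cmod_circ by lra. rewrite <- RtoC_mult. f_equal. ring. }
    rewrite <- E. field. apply Cpow_nz, circ_neq0, Hr. }
  set (k := RtoC (r ^ m) * RtoC (r ^ m)) in *.
  assert (E : k * (RtoC (2 * PI) * coef phi m) =
     CInt (fun x => RtoC (2 * Re (phi (circ r x))) * (k / circ r x ^ m)) 0 (2 * PI)).
  { rewrite <- (circint_coef phi m r HF Hr). unfold circint.
    rewrite <- CInt_scal; [|lra|ccont].
    transitivity (CInt (fun x => k * (phi (circ r x) / circ r x ^ m)) 0 (2 * PI)
       + CInt (fun x => Cconj (phi (circ r x) * circ r x ^ m)) 0 (2 * PI)); [rewrite Z; ring|].
    rewrite <- CInt_plus; [|lra| |].
    - apply CInt_ext. intro x. rewrite Cmult_conj, Inv.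
      assert (E2 : RtoC (2 * Re (phi (circ r x))) = phi (circ r x) + Cconj (phi (circ r x))).
      { apply Ceq_ReIm; unfold Re, Im; simpl; ring. }
      rewrite E2. field. apply Cpow_nz, circ_neq0, Hr.
    - ccont.
    - apply Ccont_Ccont_on. intro x. apply continuous_C_iff. pose proof (Cp x) as Cx.
      apply continuous_C_iff in Cx. destruct Cx as [C1 C2]. split; [exact C1|].
      apply (continuous_opp (V := R_NormedModule) _ x C2). }
  assert (Cu : forall x, continuous (fun x => Rabs (Re (phi (circ r x)))) x) by ccont.
  assert (B : (Cmod (k * (RtoC (2 * PI) * coef phi m)) <=
     RInt (fun x => (2 * r ^ m * Rabs (Re (phi (circ r x))))%R) 0 (2 * PI))).
  { rewrite E. apply Cmod_CInt_RInt; [lra| | |].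
    - ccont.
    - ccont.
    - intros x _. rewrite Cmod_mult, Cmod_R, Cmod_div by apply Cpow_nz, circ_neq0, Hr.
      unfold k. rewrite Cmod_mult, Cmod_R, Cmod_pow, Cmod_circ by lra.
      rewrite (Rabs_pos_eq (r ^ m)) by lra. rewrite Rabs_mult, (Rabs_pos_eq 2) by lra.
      right. field. lra. }
  rewrite RInt_circle_scal in B by exact Cu.
  unfold k in B. rewrite !Cmod_mult, !Cmod_R, !Rabs_pos_eq in B by lra.
  pose proof PI2_1 as HP1. pose proof (Cmod_ge_0 (coef phi m)) as Hc.
  apply Rmult_le_reg_l with (2 * r ^ m)%R; [lra|].
  assert (Q : 0 <= r ^ m * (r ^ m * Cmod (coef phi m))) by (apply Rmult_le_pos; [lra|apply Rmult_le_pos; lra]).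
  nra.
Qed.

(** * The functions B_gamma *)

Fixpoint csum (a : nat -> C) (n : nat) : C :=
  match n with O => 0 | S k => csum a k + a k end.

Lemma Cmod_csum_le (a : nat -> C) (b : nat -> R) (n : nat) :
  (forall k, (k < n)%nat -> Cmod (a k) <= b k) -> Cmod (csum a n) <= psum b n.
Proof.
  induction n as [|n IH]; intro H; simpl; [rewrite Cmod_0; lra|].
  eapply Rle_trans; [apply Cmod_triangle|]. apply Rplus_le_compat; [apply IH; auto|apply H; lia].
Qed.

Definition tail {T : Type} (M : nat) (u : nat -> T) (k : nat) : T := u (M + k)%nat.

Lemma is_CSeries_split (M : nat) : forall (a : nat -> C) (l : C),
  is_CSeries (tail M a) l -> is_CSeries a (csum a M + l).
Proof.
  induction M as [|M IH]; intros a l H; simpl.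
  - rewrite Cplus_0_l. exact H.
  - rewrite <- Cplus_assoc. apply IH.
    replace (a M) with (tail M a O) by (unfold tail; f_equal; lia).
    apply is_CSeries_decr_1. apply is_CSeries_ext with (tail (S M) a); [|exact H].
    intro k. unfold tail. f_equal. lia.
Qed.

(** The sign t n - z is chosen so that B_gamma = A (gamma + [ctransform]) off the zeros of A. At a
    point [t n] one term is a division by zero; the value there carries no meaning. *)
Definition ctransform (t : nat -> C) (mu : nat -> R) (z : C) : C :=
  CSeries (fun n => RtoC (mu n) / (t n - z)).

(** * The Cauchy transform on a disc that stays far from all points *)

Section Far_points.

Variables (t : nat -> C) (mu : nat -> R) (rho : R).
Hypothesis mu_pos : forall n, 0 < mu n.
Hypothesis Hconv : convergence_class t mu.
Hypothesis Hrho : 1 <= rho.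
Hypothesis Hfar : forall n, 2 * rho < Cmod (t n).

(** |z| < rho < |t n| / 2 gives |t n - z| > |t n| / 2, and this is at least (|t n| + 1) / 3 because
    |t n| > 2. The resulting majorant is the series of the convergence class. *)
Lemma far_term (n : nat) (z : C) : Cmod z < rho ->
  1 <= Cmod (t n - z) /\ / Cmod (t n - z) <= 3 * / (Cmod (t n) + 1) /\ t n - z <> 0.
Proof.
  intros Hz. specialize (Hfar n). pose proof (Cmod_sub_ge (t n) z). split; [lra|]. split; [|apply Cmod_gt_0; lra].
  replace (3 * / (Cmod (t n) + 1))%R with (/ ((Cmod (t n) + 1) / 3))%R by (field; lra).
  apply Rinv_le_contravar; lra.
Qed.

Lemma far_weights : ex_series (fun n => mu n * (3 * / (Cmod (t n) + 1)))%R.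
Proof.
  apply (ex_series_ext (fun n => 3 * (mu n / (Cmod (t n) + 1)))%R); [|apply ex_series_Rscal, Hconv].
  intro k. refine (_ : _ = _ :> R). unfold Rdiv. ring.
Qed.

Lemma far_summable (z : C) : Cmod z < rho -> is_CSeries (fun n => RtoC (mu n) / (t n - z)) (ctransform t mu z).
Proof.
  intros Hz. eapply is_CSeries_dom; [|apply far_weights].
  intro n. cbv beta. destruct (far_term n z Hz) as [F1 [F2 F3]]. specialize (mu_pos n).
  rewrite Cmod_div, Cmod_R, Rabs_pos_eq by (assumption || lra).
  apply Rmult_le_compat_l; [lra|exact F2].
Qed.

(** The n-th remainder is (y - z)^2 mu n / ((t n - z)^2 (t n - y)); since |t n - z| >= 1, one factor
    of the denominator suffices for summability. *)
Lemma far_cdiff (z : C) : Cmod z < rho -> exists l, cdiff (ctransform t mu) z l.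
Proof.
  intros Hz. exists (CSeries (fun n => RtoC (mu n) / ((t n - z) * (t n - z)))).
  apply (cdiff_CSeries (fun n y => RtoC (mu n) / (t n - y)) (fun n => RtoC (mu n) / ((t n - z) * (t n - z))) z _
     (fun n => mu n * (3 * / (Cmod (t n) + 1)))%R (rho - Cmod z)); [lra|apply far_weights| | |].
  - intros n y Hy. assert (Hyr : Cmod y < rho) by (pose proof (Cmod_sub_ge y z); lra).
    destruct (far_term n z Hz) as [F1 [_ F3]], (far_term n y Hyr) as [G1 [G2 G3]]. specialize (mu_pos n).
    replace (RtoC (mu n) / (t n - y) - RtoC (mu n) / (t n - z) - (y - z) * (RtoC (mu n) / ((t n - z) * (t n - z))))
      with ((y - z) * (y - z) * (RtoC (mu n) / ((t n - z) * (t n - z) * (t n - y)))) by (field; tauto).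
    rewrite !Cmod_mult, Cmod_div by (repeat apply Cmult_neq_0; assumption).
    rewrite !Cmod_mult, Cmod_R, Rabs_pos_eq by lra.
    replace (Cmod (y - z) ^ 2)%R with (Cmod (y - z) * Cmod (y - z))%R by ring. rewrite Rmult_comm.
    apply Rmult_le_compat_r; [apply Rmult_le_pos; apply Cmod_ge_0|].
    apply Rmult_le_compat_l; [lra|]. eapply Rle_trans; [|exact G2].
    apply Rinv_le_contravar; [lra|].
    rewrite <- (Rmult_1_l (Cmod (t n - y))) at 1. apply Rmult_le_compat_r; [lra|nra].
  - intros y Hy. eexists. apply far_summable. pose proof (Cmod_sub_ge y z). lra.
  - eapply is_CSeries_dom; [|apply far_weights].
    intro n. cbv beta. destruct (far_term n z Hz) as [F1 [F2 F3]]. specialize (mu_pos n).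
    rewrite Cmod_div, Cmod_mult, Cmod_R, Rabs_pos_eq by (lra || (apply Cmult_neq_0; assumption)).
    apply Rmult_le_compat_l; [lra|]. eapply Rle_trans; [|exact F2].
    apply Rinv_le_contravar; [lra|nra].
Qed.

End Far_points.

(** * The functions B_gamma of one space: entirety, and values on and off the points *)

Section Cauchy_transform.

Variables (t : nat -> C) (A : C -> C) (mu : nat -> R).
Hypothesis HT : CdB_data t A mu.
Hypothesis Hconv : convergence_class t mu.

Lemma points_escape (rho : R) : exists M, forall n, (M <= n)%nat -> rho < Cmod (t n).
Proof.
  destruct HT as [_ [H _]]. apply is_lim_seq_spec in H. destruct (H rho) as [M HM].
  exists M. exact HM.
Qed.

Lemma far_tail (rho : R) : 1 <= rho -> exists M,
  (forall z, Cmod z < rho -> is_CSeries (tail M (fun n => RtoC (mu n) / (t n - z))) (ctransform (tail M t) (tail M mu) z)) /\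
  (forall z, Cmod z < rho -> exists l, cdiff (ctransform (tail M t) (tail M mu)) z l) /\
  (forall z k, Cmod z < rho -> z <> tail M t k).
Proof.
  intro Hr. destruct (points_escape (2 * rho)) as [M HM]. exists M.
  assert (P : forall k, 0 < tail M mu k) by (intro; apply HT).
  assert (F : forall k, 2 * rho < Cmod (tail M t k)) by (intro; apply HM; lia).
  assert (S : convergence_class (tail M t) (tail M mu)).
  { apply (ex_series_incr_n (fun n => mu n / (Cmod (t n) + 1))%R M), Hconv. }
  split; [|split].
  - intros z Hz. apply (far_summable _ _ rho P S Hr F z Hz).
  - intros z Hz. apply (far_cdiff _ _ rho P S Hr F z Hz).
  - intros z k Hz ->. specialize (F k). lra.
Qed.

Lemma A_entire : entire A.
Proof. apply HT. Qed.

Lemma A_zero (z : C) : A z = 0 <-> exists n, z = t n.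
Proof. apply HT. Qed.

(** The zero of A at [t n] is simple, so the extended quotient A(z) / (t n - z) is minus the
    cofactor [g], also at [t n], where g equals A'. *)
Lemma Bterm_spec (n : nat) : exists g : C -> C, entire g /\ g (t n) <> 0 /\
  (forall z, A z = (z - t n) * g z) /\ (forall z, Bterm A t n z = - g z).
Proof.
  destruct HT as [_ [_ [_ [_ [_ [_ H]]]]]]. destruct (H n) as [g [G1 [G2 G3]]].
  assert (G3' : forall z, A z = (z - t n) * g z) by (intro z; rewrite G3, Cpow_1_r; reflexivity).
  exists g. split; [exact G1|]. split; [exact G2|]. split; [exact G3'|].
  intro z. unfold Bterm. destruct (Defs.Ceq_dec z (t n)) as [->|Hn].
  - f_equal. apply is_C_derive_unique. apply cdiff_is_derive.
    apply cdiff_cara. exists g. split; [|split; [reflexivity|apply entire_continuous, G1]].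
    intro y. rewrite (G3' y), (G3' (t n)). ring.
  - rewrite G3'. field. intro E. apply Hn. symmetry. apply Ceq_sub0, E.
Qed.

Lemma Bterm_at (n : nat) : exists l : C, l <> 0 /\ cdiff A (t n) l /\ Bterm A t n (t n) = - l.
Proof.
  destruct (Bterm_spec n) as [g [G1 [G2 [G3 G4]]]]. exists (g (t n)). split; [exact G2|]. split; [|apply G4].
  apply cdiff_cara. exists g. split; [|split; [reflexivity|apply entire_continuous, G1]].
  intro y. rewrite (G3 y), (G3 (t n)). ring.
Qed.

Lemma Bterm_off (n : nat) (z : C) : z <> t n -> Bterm A t n z = A z / (t n - z).
Proof. intro H. unfold Bterm. destruct (Defs.Ceq_dec z (t n)); [contradiction|reflexivity]. Qed.

(** Near z all but finitely many points are far away: the head is a finite sum of entire functions,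
    and the tail is A times a Cauchy transform without poles nearby. *)
Lemma Bgam_entire (gamma : C) : entire (Bgam t A mu gamma).
Proof.
  apply entire_cdiff. intro z. set (rho := (Cmod z + 1)%R). pose proof (Cmod_ge_0 z) as Hz0.
  destruct (far_tail rho ltac:(unfold rho; lra)) as [M [Sum [Diff Far]]].
  destruct (Diff z ltac:(unfold rho; lra)) as [l Hl].
  assert (Fin : exists m, cdiff (fun y => csum (fun n => RtoC (mu n) * Bterm A t n y) M) z m).
  { clear - HT. induction M as [|M [m IH]]; [exists 0; apply (cdiff_const 0)|].
    destruct (Bterm_spec M) as [g [G1 [_ [_ G3]]]]. rewrite entire_cdiff in G1. destruct (G1 z) as [lg Hlg].
    eexists. apply (cdiff_plus (fun y => csum (fun n => RtoC (mu n) * Bterm A t n y) M)); [exact IH|].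
    apply cdiff_ext with (fun y => RtoC (mu M) * - g y); [intro; rewrite G3; reflexivity|].
    apply cdiff_scal, cdiff_opp, Hlg. }
  destruct Fin as [m Hm].
  pose proof A_entire as EA. rewrite entire_cdiff in EA. destruct (EA z) as [la Hla].
  eexists.
  apply (cdiff_ext_loc (fun y => gamma * A y + (csum (fun n => RtoC (mu n) * Bterm A t n y) M
     + A y * ctransform (tail M t) (tail M mu) y)) _ z _ 1); [lra| |].
  - intros y Hy. assert (Hyr : Cmod y < rho) by (pose proof (Cmod_sub_ge y z); unfold rho; lra).
    unfold Bgam. f_equal. symmetry. apply is_CSeries_unique, is_CSeries_split.
    eapply is_CSeries_ext; [|apply is_CSeries_scal, (Sum y Hyr)].
    intro k. unfold tail. specialize (Far y k Hyr). unfold tail in Far. rewrite Bterm_off by exact Far.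
    field. intro E. apply Far. symmetry. apply Ceq_sub0, E.
  - apply cdiff_plus; [apply cdiff_scal, Hla|]. apply cdiff_plus; [exact Hm|].
    apply cdiff_mult; [exact Hla|exact Hl].
Qed.

(** Valid at the points too: the finitely many near terms are just numbers, whatever division by
    zero returns. *)
Lemma ctransform_ex (z : C) : is_CSeries (fun n => RtoC (mu n) / (t n - z)) (ctransform t mu z).
Proof.
  pose proof (Cmod_ge_0 z). destruct (far_tail (Cmod z + 1) ltac:(lra)) as [M [Sum _]].
  pose proof (is_CSeries_split M _ _ (Sum z ltac:(lra))) as E.
  unfold ctransform. rewrite (is_CSeries_unique _ _ E). exact E.
Qed.

Lemma Bgam_off (gamma z : C) : A z <> 0 -> Bgam t A mu gamma z = A z * (gamma + ctransform t mu z).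
Proof.
  intro Hz. unfold Bgam.
  replace (A z * (gamma + ctransform t mu z)) with (gamma * A z + A z * ctransform t mu z) by ring.
  f_equal. apply is_CSeries_unique.
  apply is_CSeries_ext with (fun n => A z * (RtoC (mu n) / (t n - z))).
  - intro n. assert (Hn : z <> t n) by (intro E; apply Hz, A_zero; exists n; exact E).
    rewrite Bterm_off by exact Hn. field. intro E. apply Hn. symmetry. apply Ceq_sub0, E.
  - apply is_CSeries_scal, ctransform_ex.
Qed.

(** Every other term carries the factor A(t n) = 0. This value, - mu n A'(t n), is what later
    recovers [mu]. *)
Lemma Bgam_at (gamma : C) (n : nat) : Bgam t A mu gamma (t n) = RtoC (mu n) * Bterm A t n (t n).
Proof.
  assert (A0 : A (t n) = 0) by (apply A_zero; exists n; reflexivity).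
  unfold Bgam. rewrite A0.
  replace (RtoC (mu n) * Bterm A t n (t n)) with (gamma * 0 + RtoC (mu n) * Bterm A t n (t n)) by ring.
  f_equal. apply is_CSeries_unique.
  assert (Off : forall k, k <> n -> RtoC (mu k) * Bterm A t k (t n) = 0).
  { intros k Hk. rewrite Bterm_off.
    - rewrite A0. unfold Cdiv. ring.
    - intro E. apply Hk. symmetry. apply HT. exact E. }
  assert (Cs : forall m, (m <= n)%nat -> csum (fun k => RtoC (mu k) * Bterm A t k (t n)) m = 0).
  { induction m as [|m IH]; intro Hm; [reflexivity|]. simpl. rewrite IH, Off by lia. ring. }
  replace (RtoC (mu n) * Bterm A t n (t n))
    with (csum (fun k => RtoC (mu k) * Bterm A t k (t n)) (S n) + 0 * ctransform t mu (t n)).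
  - apply is_CSeries_split.
    apply is_CSeries_ext with (fun _ => 0).
    + intro k. unfold tail. rewrite Off by lia. reflexivity.
    + assert (E0 : is_CSeries (fun _ => 0) 0).
      { pose proof (is_CSeries_scal 0 _ _ (ctransform_ex (t n))) as E. rewrite (Cmult_0_l (ctransform _ _ _)) in E.
        apply (is_CSeries_ext _ (fun _ => 0)) in E; [exact E|]. intro; ring. }
      rewrite Cmult_0_l. exact E0.
  - simpl. rewrite Cs by lia. ring.
Qed.

(** Positive mass and a simple zero make every B_gamma nonzero at the points: a base point for
    Jensen's inequality, and a witness that B_gamma is not identically 0. *)
Lemma Bgam_at_neq0 (gamma : C) (n : nat) : Bgam t A mu gamma (t n) <> 0.
Proof.
  rewrite Bgam_at. destruct (Bterm_spec n) as [g [_ [G2 [_ G3]]]]. rewrite G3.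
  apply Cmult_neq_0.
  - intro E. apply RtoC_inj in E. assert (0 < mu n) by apply HT. lra.
  - intro E. apply G2. replace (g (t n)) with (- - g (t n)) by ring. rewrite E. ring.
Qed.

End Cauchy_transform.

(** * Means of 1/|a - z| and the choice of radii *)

(** On a circle the right side is a Poisson kernel; as the real part of a function analytic in the
    disc, it has its mean given by the value at the centre. *)
Lemma Re_Cayley (p q : C) : p <> q -> Re ((p + q) / (p - q)) = ((Cmod p ^ 2 - Cmod q ^ 2) / Cmod (p - q)%C ^ 2)%R.
Proof.
  intro H. assert (Hn : p - q <> 0) by (intro E; apply H, Ceq_sub0, E).
  assert (Hd : ((Re p - Re q) ^ 2 + (Im p - Im q) ^ 2 <> 0)%R).
  { intro E. pose proof (pow2_ge_0 (Re p - Re q)). pose proof (pow2_ge_0 (Im p - Im q)).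
    apply H. apply Ceq_ReIm; apply Rminus_diag_uniq, Rsqr_0_uniq; rewrite Rsqr_pow2; lra. }
  rewrite !Cmod2_alt. destruct p as [a b], q as [c d]. unfold Re, Im in *. simpl in *.
  field. repeat split; intro E; apply Hd; rewrite <- E; ring.
Qed.

Lemma cdiff_affine (a b z : C) : cdiff (fun y => a + b * y) z b.
Proof.
  apply cdiff_cara. exists (fun _ => b). split; [intro; ring|]. split; [reflexivity|apply continuous_Cconst].
Qed.

Lemma continuous_inv_dist (a : C) (r x : R) : 0 < r -> Cmod a <> r ->
  continuous (fun y => / Cmod (a - circ r y)%C)%R x.
Proof.
  intros Hr Ha. apply (continuous_comp (fun y => Cmod (a - circ r y)%C) Rinv).
  - ccont.
  - apply continuous_Rinv. intro E. apply Cmod_eq_0, Ceq_sub0 in E. apply Ha. rewrite E. apply Cmod_circ. lra.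
Qed.

Lemma continuous_inv_dist2 (a : C) (r x : R) : 0 < r -> Cmod a <> r ->
  continuous (fun y => / Cmod (a - circ r y)%C ^ 2)%R x.
Proof.
  intros Hr Ha. apply (continuous_ext (fun y => / Cmod (a - circ r y)%C * / Cmod (a - circ r y)%C)%R).
  - intro y. rewrite <- pow_inv. simpl. ring.
  - apply continuous_Rmult; apply continuous_inv_dist; assumption.
Qed.

Lemma Poisson_mean_aux (p q : C) (r : R) : 0 < r -> Cmod q * r < Cmod p ->
  RInt (fun x => Re ((p + q * circ r x) / (p - q * circ r x))) 0 (2 * PI) = (2 * PI)%R.
Proof.
  intros Hr Hpq. pose proof (Cmod_ge_0 q) as Hq.
  set (G := fun z => (p + q * z) * / (p + (- q) * z)).
  transitivity (RInt (fun x => Re (G (circ r x))) 0 (2 * PI)).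
  { apply RInt_ext. intros x _. unfold G, Cdiv. do 3 f_equal. ring. }
  rewrite (RInt_Re_MVP G r Hr); unfold G.
  - replace (p + q * 0) with p by ring. replace (p + - q * 0) with p by ring.
    rewrite Cinv_r; [simpl; ring|]. apply Cmod_gt_0. nra.
  - intros z Hz. eexists. apply cdiff_mult; [apply cdiff_affine|].
    apply cdiff_inv; [apply cdiff_affine|].
    intro E. assert (E2 : p = q * z) by (apply Ceq_sub0; rewrite <- E; ring).
    apply (f_equal Cmod) in E2. rewrite Cmod_mult in E2. pose proof (Cmod_ge_0 z). nra.
Qed.

Lemma Poisson_mean (a : C) (r : R) : 0 < r -> Cmod a <> r ->
  RInt (fun x => / Cmod (a - circ r x)%C ^ 2)%R 0 (2 * PI) = (2 * PI / Rabs (Cmod a ^ 2 - r ^ 2))%R.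
Proof.
  intros Hr Har. pose proof (Cmod_ge_0 a) as Ha.
  assert (Hpos : forall x, 0 < Cmod (a - circ r x)).
  { intro x. apply Cmod_pos. intro E. apply Har. apply Ceq_sub0 in E. rewrite E. apply Cmod_circ. lra. }
  set (k := Rabs (Cmod a ^ 2 - r ^ 2)).
  assert (Hk : 0 < k) by (apply Rabs_pos_lt; intro E; apply Har; nra).
  assert (Main : RInt (fun x => k * / Cmod (a - circ r x)%C ^ 2)%R 0 (2 * PI) = (2 * PI)%R).
  { destruct (Rlt_dec r (Cmod a)) as [L|L].
    - eapply eq_trans; [|apply (Poisson_mean_aux a 1 r Hr); rewrite Cmod_1; lra]. apply RInt_ext. intros x _. specialize (Hpos x).
      rewrite Cmult_1_l, Re_Cayley by (intro E; rewrite <- E in Hpos; replace (a - a) with (RtoC 0) in Hpos by ring; rewrite Cmod_0 in Hpos; lra).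
      rewrite Cmod_circ by lra. unfold k. rewrite Rabs_pos_eq by nra. reflexivity.
    - assert (Mp : Cmod (RtoC (r ^ 2)) = (r ^ 2)%R) by (rewrite Cmod_R, Rabs_pos_eq; [reflexivity|nra]).
      eapply eq_trans; [|apply (Poisson_mean_aux (RtoC (r ^ 2)) (Cconj a) r Hr); rewrite Mp, Cmod_conj; nra].
      apply RInt_ext. intros x _. specialize (Hpos x).
      set (z := circ r x) in *. assert (Mz : Cmod z = r) by (apply Cmod_circ; lra).
      (* For |a| < r the pole is reflected in the circle: |r^2 - conj(a) z| = r |a - z| on |z| = r.
         Keeping r^2 and conj(a) z undivided admits a = 0. *)
      assert (M3 : Cmod (RtoC (r ^ 2) - Cconj a * z) = (r * Cmod (a - z)%C)%R).
      { replace (RtoC (r ^ 2) - Cconj a * z) with (z * Cconj (z - a)).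
        - rewrite Cmod_mult, Mz, Cmod_conj, Cmod_sub_sym. reflexivity.
        - rewrite Cminus_conj, <- Mz, Cmod2_conj. ring. }
      assert (Hpq : RtoC (r ^ 2) <> Cconj a * z).
      { intro E. rewrite E in M3. replace (Cconj a * z - Cconj a * z) with (RtoC 0) in M3 by ring. rewrite Cmod_0 in M3. nra. }
      rewrite Re_Cayley by exact Hpq. rewrite M3, Mp, Cmod_mult, Cmod_conj, Mz. unfold k.
      rewrite Rabs_minus_sym, Rabs_pos_eq by nra. refine (_ : _ = _ :> R). field. lra. }
  rewrite RInt_circle_scal in Main.
  - apply Rmult_eq_reg_l with k; [|lra]. rewrite Main. field. lra.
  - intro x. apply continuous_inv_dist2; assumption.
Qed.

(** Cauchy-Schwarz in the form d <= s d^2 / 2 + 1 / (2 s), applied to d = 1/|a - z|, with s the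
    square root of | |a|^2 - r^2 |; the two terms then contribute equally. *)
Lemma mean_inv_dist (a : C) (r : R) : 0 < r -> Cmod a <> r ->
  RInt (fun x => / Cmod (a - circ r x)%C)%R 0 (2 * PI) <= 2 * PI / sqrt (Rabs (Cmod a ^ 2 - r ^ 2)).
Proof.
  intros Hr Har. pose proof (Cmod_ge_0 a) as Ha. pose proof two_PI_pos as Hpi.
  pose proof (Poisson_mean a r Hr Har) as P. set (k := Rabs (Cmod a ^ 2 - r ^ 2)) in *.
  assert (Hk : 0 < k).
  { apply Rabs_pos_lt. intro E. apply Har. nra. }
  set (s := sqrt k). assert (Hs : 0 < s) by (apply sqrt_lt_R0, Hk).
  assert (Hss : (s * s = k)%R) by (apply sqrt_sqrt; lra).
  assert (C1 : forall x, continuous (fun y => / Cmod (a - circ r y)%C)%R x) by (intro; apply continuous_inv_dist; assumption).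
  assert (C2 : forall x, continuous (fun y => / Cmod (a - circ r y)%C ^ 2)%R x) by (intro; apply continuous_inv_dist2; assumption).
  assert (L : (RInt (fun x => / Cmod (a - circ r x)%C)%R 0 (2 * PI) <=
     RInt (fun x => s / 2 * / Cmod (a - circ r x)%C ^ 2 + / (2 * s))%R 0 (2 * PI))%R).
  { apply RInt_circle_le; [exact C1|ccont|].
    - intro x. rewrite <- pow_inv. set (d := (/ Cmod (a - circ r x)%C)%R).
      assert (0 <= s / 2 * (d - / s) ^ 2) by (apply Rmult_le_pos; [lra|apply pow2_ge_0]).
      replace (s / 2 * (d - / s) ^ 2)%R with (s / 2 * d ^ 2 - d + / (2 * s))%R in H by (field; lra). lra. }
  eapply Rle_trans; [exact L|].
  rewrite RInt_circle_plus, RInt_circle_scal, RInt_circle_const, P by ccont.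
  rewrite <- Hss. right. field. lra.
Qed.

Local Open Scope R_scope.

(** * Finite sums, and a smoothed square root for choosing the radius *)

Lemma psum_le (f g : nat -> R) (n : nat) : (forall k, (k < n)%nat -> f k <= g k) -> psum f n <= psum g n.
Proof.
  induction n as [|n IH]; intro H; simpl; [lra|].
  apply Rplus_le_compat; [apply IH; auto|apply H; lia].
Qed.

Lemma psum_scal (c : R) (f : nat -> R) (n : nat) : psum (fun k => c * f k) n = (c * psum f n).
Proof. induction n as [|n IH]; simpl; [ring|rewrite IH; ring]. Qed.

Lemma psum_nonneg (f : nat -> R) (n : nat) : (forall k, (k < n)%nat -> 0 <= f k) -> 0 <= psum f n.
Proof.
  intro H. replace 0 with (psum (fun _ => 0) n).
  - apply psum_le, H.
  - clear. induction n; simpl; [reflexivity|rewrite IHn; ring].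
Qed.

Lemma psum_term_le (f : nat -> R) (n k : nat) : (forall j, (j < n)%nat -> 0 <= f j) -> (k < n)%nat -> f k <= psum f n.
Proof.
  induction n as [|n IH]; intros H Hk; [lia|]. simpl.
  destruct (Nat.eq_dec k n) as [->|Hn].
  - pose proof (psum_nonneg f n ltac:(auto)). lra.
  - pose proof (H n ltac:(lia)). specialize (IH ltac:(auto) ltac:(lia)). lra.
Qed.

(** A smoothed sqrt |x|, positive also at 0; [dl] removes the singularity of |r - tau|^(-1/2). *)
Definition root_den (dl x : R) : R := sqrt (sqrt (x ^ 2 + dl ^ 2)).

(* An explicit function comparable to [sign x * sqrt |x|] whose derivative dominates [(x^2 + dl^2)^(-1/4) / 2] *)
Definition root_prim (dl x : R) : R := (x / root_den dl x).

Lemma root_den_facts (dl x : R) : 0 < dl ->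
  (0 < root_den dl x /\ root_den dl x ^ 4 = x ^ 2 + dl ^ 2).
Proof.
  intro H. assert (P : 0 < x ^ 2 + dl ^ 2) by nra.
  assert (Q : 0 < sqrt (x ^ 2 + dl ^ 2)) by (apply sqrt_lt_R0, P).
  split; [apply sqrt_lt_R0, Q|]. unfold root_den.
  replace (sqrt (sqrt (x ^ 2 + dl ^ 2)) ^ 4) with
    ((sqrt (sqrt (x ^ 2 + dl ^ 2)) * sqrt (sqrt (x ^ 2 + dl ^ 2))) * (sqrt (sqrt (x ^ 2 + dl ^ 2)) * sqrt (sqrt (x ^ 2 + dl ^ 2)))) by ring.
  rewrite (sqrt_sqrt (sqrt _)) by lra. apply sqrt_sqrt. lra.
Qed.

(** With w = [root_den], w^4 = u^2 + dl^2 gives (u / w)' = 1/w - u^2 / (2 w^5), and u^2 <= w^4 keeps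
    at least half of 1/w. *)
Lemma root_prim_derive (dl tau x : R) : 0 < dl ->
  exists d, is_derive (fun y => root_prim dl (y - tau)) x d /\ / root_den dl (x - tau) <= 2 * d.
Proof.
  intro H. set (u := (x - tau)).
  destruct (root_den_facts dl u H) as [P E]. set (w := root_den dl u) in *.
  assert (P1 : 0 < u ^ 2 + dl ^ 2) by nra.
  assert (P2 : 0 < sqrt (u ^ 2 + dl ^ 2)) by (apply sqrt_lt_R0, P1).
  exists (/ w - u ^ 2 / (2 * w ^ 5)). split.
  - unfold root_prim, root_den. auto_derive; fold u.
    + replace (x + - tau) with u by reflexivity.
      assert (R1 : 0 < u * (u * 1) + dl * (dl * 1)) by (replace (u * (u * 1) + dl * (dl * 1)) with (u ^ 2 + dl ^ 2) by ring; exact P1).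
      assert (R2 : 0 < sqrt (u * (u * 1) + dl * (dl * 1))) by (apply sqrt_lt_R0, R1).
      repeat split; try assumption.
      pose proof (sqrt_lt_R0 _ R2). lra.
    + replace (x + - tau) with u by reflexivity.
      replace (u * (u * 1) + dl * (dl * 1)) with (u ^ 2 + dl ^ 2) by ring.
      assert (S1 : sqrt (u ^ 2 + dl ^ 2) = w ^ 2).
      { pose proof (sqrt_sqrt (sqrt (u ^ 2 + dl ^ 2)) ltac:(lra)) as Q. unfold w, root_den.
        rewrite <- Q at 1. ring. }
      rewrite !S1. rewrite sqrt_pow2 by lra. field. lra.
  - assert (B : u ^ 2 <= w ^ 4) by nra.
    assert (B2 : u ^ 2 / (2 * w ^ 5) <= / (2 * w)).
    { replace (/ (2 * w)) with (w ^ 4 / (2 * w ^ 5)) by (field; lra).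
      apply Rmult_le_compat_r; [|exact B]. apply Rlt_le, Rinv_0_lt_compat.
      apply Rmult_lt_0_compat; [lra|apply pow_lt, P]. }
    replace (/ w) with (2 * (/ w - / (2 * w))) at 1 by (field; lra). lra.
Qed.

Lemma root_prim_bound (dl x : R) : 0 < dl -> Rabs (root_prim dl x) <= sqrt (Rabs x).
Proof.
  intro H. destruct (root_den_facts dl x H) as [P E].
  unfold root_prim. unfold Rdiv. rewrite Rabs_mult, Rabs_inv, (Rabs_pos_eq (root_den dl x)) by lra.
  assert (L : sqrt (Rabs x) <= root_den dl x).
  { unfold root_den. apply sqrt_le_1_alt. rewrite <- sqrt_Rsqr_abs. apply sqrt_le_1_alt.
    unfold Rsqr. nra. }
  apply Rmult_le_reg_r with (root_den dl x); [exact P|].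
  rewrite Rmult_assoc, Rinv_l by lra. rewrite Rmult_1_r.
  rewrite <- (sqrt_sqrt (Rabs x)) at 1 by apply Rabs_pos.
  apply Rmult_le_compat_l; [apply sqrt_pos|exact L].
Qed.

(** Undoes the smoothing: if w = [root_den dl x] is not small compared with dl^(1/2), then dl^2 <=
    w^4 / 4, so x^2 is most of w^4 and sqrt |x| >= w / 2. *)
Lemma root_den_lower (dl x b : R) : 0 < dl -> 0 < b -> 2 * dl <= b ^ 2 -> b <= root_den dl x ->
  x <> 0 /\ / sqrt (Rabs x) <= 2 * / root_den dl x.
Proof.
  intros H Hb Hd Hw. destruct (root_den_facts dl x H) as [P E]. set (w := root_den dl x) in *.
  assert (B2 : b ^ 2 <= w ^ 2) by (apply pow_incr; lra).
  assert (B4 : 4 * dl ^ 2 <= w ^ 4) by (replace (w ^ 4) with (w ^ 2 * w ^ 2) by ring; nra).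
  assert (X : 3 / 4 * w ^ 4 <= x ^ 2) by nra.
  assert (W4 : 0 < w ^ 4) by (apply pow_lt, P).
  assert (Hx : x <> 0) by (intro E0; rewrite E0 in X; nra).
  split; [exact Hx|].
  assert (Px : 0 < Rabs x) by (apply Rabs_pos_lt, Hx).
  assert (Sx : 0 < sqrt (Rabs x)) by (apply sqrt_lt_R0, Px).
  assert (L : w <= 2 * sqrt (Rabs x)).
  { apply Rnot_lt_le. intro Hlt.
    assert (S2 : sqrt (Rabs x) * sqrt (Rabs x) = Rabs x) by (apply sqrt_sqrt; lra).
    assert (A1 : 4 * Rabs x < w ^ 2) by nra.
    assert (A2 : 16 * Rabs x ^ 2 < w ^ 4) by (replace (w ^ 4) with (w ^ 2 * w ^ 2) by ring; nra).
    rewrite pow2_abs in A2. nra. }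
  replace (2 * / w) with (/ (w / 2)) by (field; lra). apply Rinv_le_contravar; lra.
Qed.

(** Dominates the increase over [rho, 2 rho] of the n-th weighted primitive, independently of
    [dl]. *)
Definition root_weight (w tau : nat -> R) (rho : R) (n : nat) : R :=
  (w n * (sqrt (Rabs (2 * rho - tau n)) + sqrt (Rabs (rho - tau n)))).

Lemma exists_small (w : nat -> R) (D : R) (M : nat) : 0 < D -> exists dl, 0 < dl /\
  forall n, (n < M)%nat -> 0 < w n -> 2 * dl <= (w n / D) ^ 2.
Proof.
  intro HD. induction M as [|M [dl [H1 H2]]].
  - exists 1. split; [lra|]. intros; lia.
  - destruct (Rlt_dec 0 (w M)) as [P|N].
    + assert (Q : 0 < (w M / D) ^ 2) by (apply pow_lt, Rdiv_lt_0_compat; assumption).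
      exists (Rmin dl ((w M / D) ^ 2 / 2)). split; [apply Rmin_glb_lt; lra|].
      intros n Hn Hw. destruct (Nat.eq_dec n M) as [->|Hne].
      * pose proof (Rmin_r dl ((w M / D) ^ 2 / 2)). lra.
      * pose proof (Rmin_l dl ((w M / D) ^ 2 / 2)). specialize (H2 n ltac:(lia) Hw). lra.
    + exists dl. split; [exact H1|]. intros n Hn Hw. destruct (Nat.eq_dec n M) as [->|Hne]; [lra|].
      apply H2; [lia|exact Hw].
Qed.

Lemma psum_root_prim_derive (w tau : nat -> R) (dl x : R) (M : nat) : 0 < dl -> (forall n, 0 <= w n) ->
  exists d, is_derive (fun y => psum (fun n => w n * root_prim dl (y - tau n)) M) x d /\
    psum (fun n => w n * / root_den dl (x - tau n)) M <= 2 * d.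
Proof.
  intros H Hw. induction M as [|M [d [D1 D2]]].
  - exists 0. split; [apply (is_derive_const (K := R_AbsRing) (V := R_NormedModule) 0)|simpl; lra].
  - destruct (root_prim_derive dl (tau M) x H) as [e [E1 E2]].
    exists (d + w M * e). split.
    + simpl. apply (is_derive_plus (K := R_AbsRing) (V := R_NormedModule) (fun y => psum (fun n => w n * root_prim dl (y - tau n)) M)); [exact D1|].
      apply (is_derive_scal (fun y => root_prim dl (y - tau M))); exact E1.
    + simpl psum. pose proof (Rmult_le_compat_l (w M) _ _ (Hw M) E2). lra.
Qed.

Lemma psum_root_prim_diff (w tau : nat -> R) (dl rho : R) (M : nat) : 0 < dl -> (forall n, 0 <= w n) ->
  psum (fun n => w n * root_prim dl (2 * rho - tau n)) M - psum (fun n => w n * root_prim dl (rho - tau n)) M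
   <= psum (root_weight w tau rho) M.
Proof.
  intros H Hw. induction M as [|M IH]; simpl; [lra|].
  pose proof (root_prim_bound dl (2 * rho - tau M) H) as B1. pose proof (root_prim_bound dl (rho - tau M) H) as B2.
  apply Rabs_le_between in B1. apply Rabs_le_between in B2.
  unfold root_weight at 2. specialize (Hw M). nra.
Qed.

(* The radius is produced by the mean value theorem, so that no integral over radii of unbounded functions is needed. *)
Lemma radius_choice (w tau : bool -> nat -> R) (M : nat) (rho B : R) : 0 < rho ->
  (forall i n, 0 <= w i n) ->
  psum (root_weight (w true) (tau true) rho) M + psum (root_weight (w false) (tau false) rho) M <= B ->
  exists r, rho < r < 2 * rho /\ forall i,
    (forall n, (n < M)%nat -> 0 < w i n -> r <> tau i n) /\
    psum (fun n => w i n * / sqrt (Rabs (r - tau i n))) M <= 4 * B / rho.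
Proof.
  intros Hr Hw HWB.
  assert (RW : forall i, 0 <= psum (root_weight (w i) (tau i) rho) M).
  { intro i. apply psum_nonneg. intros n _. apply Rmult_le_pos; [apply Hw|].
    pose proof (sqrt_pos (Rabs (2 * rho - tau i n))). pose proof (sqrt_pos (Rabs (rho - tau i n))). lra. }
  assert (HB : 0 <= B) by (pose proof (RW true); pose proof (RW false); lra).
  (* Strictly above the bound 2 B / rho that each smoothed sum will satisfy at the chosen radius. *)
  set (D := (2 * B / rho + 1)).
  assert (HD : 0 < D) by (pose proof (Rdiv_le_0_compat (2 * B) rho ltac:(lra) Hr); unfold D; lra).
  destruct (exists_small (w true) D M HD) as [d1 [Pd1 Sd1]]. destruct (exists_small (w false) D M HD) as [d2 [Pd2 Sd2]].
  set (dl := Rmin d1 d2). assert (Hdl : 0 < dl) by (apply Rmin_glb_lt; assumption).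
  assert (Sd : forall i n, (n < M)%nat -> 0 < w i n -> 2 * dl <= (w i n / D) ^ 2).
  { intros i n Hn Hwn. pose proof (Rmin_l d1 d2). pose proof (Rmin_r d1 d2). unfold dl.
    destruct i; [specialize (Sd1 n Hn Hwn)|specialize (Sd2 n Hn Hwn)]; lra. }
  set (H := fun i y => psum (fun n => w i n * root_prim dl (y - tau i n)) M).
  set (S := fun i y => psum (fun n => w i n * / root_den dl (y - tau i n)) M).
  (* Both families enter one function, so a single intermediate point serves both: rho G'(r) <= B,
     and G' dominates half of the two smoothed sums. *)
  set (G := fun y => (H true y + H false y)).
  assert (DH : forall x, exists d, is_derive G x d /\ S true x + S false x <= 2 * d).
  { intro x. destruct (psum_root_prim_derive (w true) (tau true) dl x M Hdl (Hw true)) as [a [A1 A2]].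
    destruct (psum_root_prim_derive (w false) (tau false) dl x M Hdl (Hw false)) as [b [B1 B2]].
    exists (a + b). split; [apply (is_derive_plus (K := R_AbsRing) (V := R_NormedModule) (H true)); assumption|].
    unfold S. lra. }
  destruct (MVT_cor2 G (Derive G) rho (2 * rho)) as [r [Er Hrr]]; [lra| |].
  { intros x _. destruct (DH x) as [d [Hd _]]. apply is_derive_Reals, Derive_correct. exists d. exact Hd. }
  assert (NN : forall i n, 0 <= w i n * / root_den dl (r - tau i n)).
  { intros i n. apply Rle_mult_inv_pos; [apply Hw|apply root_den_facts, Hdl]. }
  assert (SB : forall i, S i r <= 2 * B / rho).
  { assert (SB2 : S true r + S false r <= 2 * B / rho).
    { destruct (DH r) as [d [Hd1 Hd2]]. rewrite <- (is_derive_unique _ _ _ Hd1) in Hd2.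
      assert (Q : forall i, H i (2 * rho) - H i rho <= psum (root_weight (w i) (tau i) rho) M)
        by (intro i; apply psum_root_prim_diff; auto).
      pose proof (Q true). pose proof (Q false).
      apply Rle_div_r; [exact Hr|]. replace (2 * rho - rho) with rho in Er by ring. unfold G at 1 2 in Er.
      apply Rmult_le_compat_r with (r := rho) in Hd2; lra. }
    pose proof (psum_nonneg _ M (fun n _ => NN true n)). pose proof (psum_nonneg _ M (fun n _ => NN false n)).
    intros []; unfold S in *; lra. }
  assert (U : forall i n, (n < M)%nat -> 0 < w i n ->
    r <> tau i n /\ / sqrt (Rabs (r - tau i n)) <= 2 * / root_den dl (r - tau i n)).
  { intros i n Hn Hwn. destruct (root_den_facts dl (r - tau i n) Hdl) as [P _].
    pose proof (psum_term_le _ M n (fun j _ => NN i j) Hn) as T. specialize (SB i). unfold S in SB.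
    (* A single term of the sum is below D, so r cannot be close to a point of positive weight; this
       lets the smoothing be removed, at the cost of a factor 2. *)
    assert (L : w i n / D <= root_den dl (r - tau i n)).
    { apply Rle_div_l; [lra|]. rewrite Rmult_comm. apply Rle_div_l; [exact P|].
      unfold Rdiv, D in *. cbv beta in T. lra. }
    destruct (root_den_lower dl (r - tau i n) (w i n / D) Hdl) as [X Y];
      [apply Rdiv_lt_0_compat; lra|apply Sd; assumption|exact L|].
    split; [intro E; apply X; lra|exact Y]. }
  exists r. split; [lra|]. intro i. split; [intros n Hn Hwn; apply U; assumption|].
  apply Rle_trans with (2 * S i r).
  - unfold S. rewrite <- psum_scal. apply psum_le. intros n Hn. destruct (Hw i n) as [P|E].
    + destruct (U i n Hn P) as [_ Q]. nra.
    + rewrite <- E. lra.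
  - specialize (SB i). replace (4 * B / rho) with (2 * (2 * B / rho)) by (field; lra). lra.
Qed.

(** * Circles on which the Cauchy transforms are small in mean *)

Local Open Scope R_scope.

Lemma psum_plus_tail (m : nat -> R) (M : nat) : ex_series m -> psum m M + Series (tail M m) = Series m.
Proof.
  intro H. induction M as [|M IH]; simpl psum; [apply Rplus_0_l|].
  rewrite <- IH, (Series_incr_1 (tail M m)) by (apply (ex_series_incr_n m M), H).
  unfold tail at 2. rewrite Nat.add_0_r, Rplus_assoc. do 2 f_equal.
  apply Series_ext. intro k. unfold tail. f_equal. lia.
Qed.

Lemma series_tail_small (m : nat -> R) (eps : R) : ex_series m -> 0 < eps ->
  exists M0, forall M, (M0 <= M)%nat -> Rabs (Series (tail M m)) <= eps.
Proof.
  intros H He. pose proof (Series_correct m H) as L.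
  apply (is_lim_seq_spec (sum_n m) (Series m)) in L. destruct (L (mkposreal eps He)) as [N HN].
  exists (S N). intros [|M] HM; [lia|].
  specialize (HN M ltac:(lia)). simpl in HN.
  assert (E : sum_n m M = psum m (S M)).
  { clear. induction M as [|M IH]; [rewrite sum_O; simpl; ring|]. rewrite sum_Sn, IH. reflexivity. }
  rewrite E in HN. pose proof (psum_plus_tail m (S M) H) as T.
  replace (Series (tail (S M) m)) with (- (psum m (S M) - Series m)) by lra.
  rewrite Rabs_Ropp. lra.
Qed.

(** * Weights for points near to and far from the annulus of radii rho to 2 rho *)

Section Family.

Variables (mu tau : nat -> R).
Hypothesis Hmu : forall n, 0 < mu n.
Hypothesis Htau : forall n, 0 <= tau n.
Hypothesis Hsum : ex_series (fun n => mu n / (tau n + 1)).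

(** For r > rho, |tau^2 - r^2| >= (tau + rho) |r - tau|; the first factor goes into the weight and
    the second is left to [radius_choice]. Points with tau >= 4 rho are never close to r < 2 rho and
    get weight 0. *)
Definition near_weight (rho : R) (n : nat) : R :=
  if Rlt_dec (tau n) (4 * rho) then (mu n * / sqrt (tau n + rho)) else 0.

(** Up to a factor 4 this is 1 / max(rho, tau n), the natural size of the contribution of a
    point. *)
Definition inv_max (rho : R) (n : nat) : R :=
  if Rlt_dec (tau n) (4 * rho) then (/ rho) else (/ tau n).

Lemma near_weight_nonneg (rho : R) (n : nat) : 0 < rho -> 0 <= near_weight rho n.
Proof.
  intro Hr. unfold near_weight. destruct Rlt_dec; [|lra].
  pose proof (Hmu n). pose proof (Htau n).
  assert (0 < sqrt (tau n + rho)) by (apply sqrt_lt_R0; lra).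
  apply Rmult_le_pos; [lra|]. apply Rlt_le, Rinv_0_lt_compat. assumption.
Qed.

Lemma near_weight_pos (rho : R) (n : nat) : 0 < rho -> tau n < 4 * rho -> 0 < near_weight rho n.
Proof.
  intros Hr Ht. unfold near_weight. destruct Rlt_dec; [|contradiction].
  pose proof (Htau n). apply Rmult_lt_0_compat; [apply Hmu|]. apply Rinv_0_lt_compat, sqrt_lt_R0. lra.
Qed.

(** A fixed head of the sum is killed by the factor 1/rho, the rest by
    [inv_max rho n <= 5 / (tau n + 1)] and convergence. The bound is uniform in [M], which is to be
    chosen after [rho]. *)
Lemma inv_max_small (eps : R) : 0 < eps -> exists rho1, 1 <= rho1 /\
  forall rho M, rho1 <= rho -> psum (fun n => mu n * inv_max rho n) M <= eps.
Proof.
  intro He.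
  destruct (series_tail_small _ (eps / 10) Hsum) as [n0 Hn0]; [lra|]. specialize (Hn0 n0 (le_n n0)).
  set (m := fun n => (mu n / (tau n + 1))) in *.
  assert (Pm : forall n, 0 <= m n).
  { intro n. unfold m. pose proof (Hmu n). pose proof (Htau n). apply Rmult_le_pos; [lra|]. apply Rlt_le, Rinv_0_lt_compat. lra. }
  assert (Tl : forall k, psum m (n0 + k) - psum m n0 <= eps / 10).
  { intro k. pose proof (psum_plus_tail m (n0 + k) Hsum) as E1. pose proof (psum_plus_tail m n0 Hsum) as E2.
    assert (0 <= Series (tail (n0 + k) m)).
    { rewrite <- (Rmult_0_l (Series (tail (n0 + k) m))), <- Series_scal_l.
      apply Series_le; [intro j; specialize (Pm (n0 + k + j)%nat); unfold tail; lra|].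
      apply (ex_series_incr_n m (n0 + k)). exact Hsum. }
    apply Rabs_le_between in Hn0. lra. }
  set (P := psum mu n0).
  assert (HP : 0 <= P) by (apply psum_nonneg; intros k _; specialize (Hmu k); lra).
  exists (Rmax 1 (2 * P / eps)). split; [apply Rmax_l|].
  intros rho M Hrho.
  pose proof (Rmax_l 1 (2 * P / eps)). pose proof (Rmax_r 1 (2 * P / eps)).
  assert (Hr : 1 <= rho) by lra.
  assert (HPr : P * / rho <= eps / 2).
  { apply Rmult_le_reg_r with rho; [lra|]. rewrite Rmult_assoc, Rinv_l by lra.
    assert (Q : 2 * P / eps <= rho) by lra.
    apply Rle_div_l in Q; lra. }
  assert (B1 : forall n, 0 <= inv_max rho n <= / rho).
  { intro n. unfold inv_max. assert (0 < / rho) by (apply Rinv_0_lt_compat; lra).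
    destruct Rlt_dec; [lra|]. split.
    - apply Rlt_le, Rinv_0_lt_compat. lra.
    - apply Rinv_le_contravar; lra. }
  assert (B2 : forall n, inv_max rho n <= 5 * / (tau n + 1)).
  { intro n. pose proof (Htau n). unfold inv_max. destruct Rlt_dec.
    - replace (5 * / (tau n + 1)) with (/ ((tau n + 1) / 5)) by (field; lra).
      apply Rinv_le_contravar; lra.
    - replace (5 * / (tau n + 1)) with (/ ((tau n + 1) / 5)) by (field; lra).
      apply Rinv_le_contravar; lra. }
  set (a := fun n => (mu n * inv_max rho n)).
  assert (Pa : forall n, 0 <= a n) by (intro n; apply Rmult_le_pos; [specialize (Hmu n); lra|apply B1]).
  assert (A0 : psum a n0 <= P * / rho).
  { unfold P. rewrite Rmult_comm, <- psum_scal. apply psum_le. intros k _. unfold a.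
    rewrite Rmult_comm. apply Rmult_le_compat_r; [specialize (Hmu k); lra|apply B1]. }
  assert (Ak : forall k, psum a (n0 + k) <= P * / rho + 5 * (psum m (n0 + k) - psum m n0)).
  { induction k as [|k IH]; [rewrite Nat.add_0_r; lra|].
    rewrite Nat.add_succ_r. simpl psum.
    assert (a (n0 + k)%nat <= 5 * m (n0 + k)%nat); [|lra]. generalize (n0 + k)%nat. intro n.
    unfold a, m. specialize (Hmu n). specialize (B2 n).
    replace (5 * (mu n / (tau n + 1))) with (mu n * (5 * / (tau n + 1))) by (unfold Rdiv; ring).
    apply Rmult_le_compat_l; lra. }
  assert (Mono : forall k, psum a M <= psum a (k + M)).
  { induction k as [|k IH]; [simpl; lra|]. simpl. specialize (Pa (k + M)%nat). lra. }
  eapply Rle_trans; [apply (Mono n0)|]. eapply Rle_trans; [apply Ak|].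
  specialize (Tl M). lra.
Qed.

(** For tau < 4 rho the two roots are at most 2 and 1 times sqrt(tau + rho), which cancels against
    the weight and leaves the factor 3. *)
Lemma root_weight_near (rho : R) (n : nat) : 0 < rho ->
  root_weight (near_weight rho) tau rho n <= 3 * rho * (mu n * inv_max rho n).
Proof.
  intro Hr. unfold root_weight, near_weight, inv_max. pose proof (Hmu n). pose proof (Htau n).
  destruct Rlt_dec as [L|L].
  - assert (Q : 0 < sqrt (tau n + rho)) by (apply sqrt_lt_R0; lra).
    assert (S1 : sqrt (Rabs (2 * rho - tau n)) <= 2 * sqrt (tau n + rho)).
    { replace (2 * sqrt (tau n + rho)) with (sqrt (2 * 2 * (tau n + rho))).
      - apply sqrt_le_1_alt. apply Rabs_le. lra.
      - rewrite sqrt_mult, sqrt_square by lra. reflexivity. }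
    assert (S2 : sqrt (Rabs (rho - tau n)) <= sqrt (tau n + rho)) by (apply sqrt_le_1_alt, Rabs_le; lra).
    replace (3 * rho * (mu n * / rho)) with (mu n * / sqrt (tau n + rho) * (3 * sqrt (tau n + rho))) by (field; lra).
    apply Rmult_le_compat_l; [|lra].
    apply Rmult_le_pos; [lra|]. apply Rlt_le, Rinv_0_lt_compat, Q.
  - rewrite Rmult_0_l. apply Rmult_le_pos; [lra|]. apply Rmult_le_pos; [lra|].
    apply Rlt_le, Rinv_0_lt_compat. lra.
Qed.

(** Near points use tau^2 - r^2 = (tau + r)(tau - r). For far ones r < tau / 2, so the root of
    |tau^2 - r^2| is at least tau / 2 and 2 / tau suffices. *)
Lemma mean_inv_dist_weight (a : C) (r rho : R) (n : nat) : Cmod a = tau n -> 0 < rho -> rho < r < 2 * rho ->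
  r <> tau n ->
  (mu n * RInt (fun x => / Cmod (a - circ r x)%C) 0 (2 * PI) <=
   2 * PI * (near_weight rho n * / sqrt (Rabs (r - tau n)) + 2 * (mu n * inv_max rho n))).
Proof.
  intros Ha Hr Hrr Hne. pose proof two_PI_pos as Hpi.
  assert (Hne' : Cmod a <> r) by congruence.
  pose proof (mean_inv_dist a r ltac:(lra) Hne') as B. rewrite Ha in B.
  pose proof (Hmu n) as Pm. pose proof (Htau n) as Pt.
  assert (Pk : 0 < Rabs (r - tau n)) by (apply Rabs_pos_lt; lra).
  assert (Eabs : Rabs (tau n ^ 2 - r ^ 2) = ((tau n + r) * Rabs (r - tau n))).
  { replace (tau n ^ 2 - r ^ 2) with ((tau n + r) * (tau n - r)) by ring.
    rewrite Rabs_mult, (Rabs_pos_eq (tau n + r)) by lra. rewrite (Rabs_minus_sym (tau n)). reflexivity. }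
  apply Rmult_le_compat_l with (r := mu n) in B; [|lra]. eapply Rle_trans; [exact B|].
  unfold near_weight, inv_max. destruct Rlt_dec as [L|L].
  - rewrite Eabs.
    assert (S1 : 0 < sqrt (tau n + rho)) by (apply sqrt_lt_R0; lra).
    assert (S2 : 0 < sqrt (Rabs (r - tau n))) by (apply sqrt_lt_R0; lra).
    assert (S3 : sqrt (tau n + rho) * sqrt (Rabs (r - tau n)) <= sqrt ((tau n + r) * Rabs (r - tau n))).
    { rewrite <- sqrt_mult by lra. apply sqrt_le_1_alt. apply Rmult_le_compat_r; lra. }
    assert (S4 : 0 < sqrt (tau n + rho) * sqrt (Rabs (r - tau n))) by (apply Rmult_lt_0_compat; assumption).
    assert (S5 : / sqrt ((tau n + r) * Rabs (r - tau n)) <= / sqrt (tau n + rho) * / sqrt (Rabs (r - tau n))).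
    { rewrite <- Rinv_mult. apply Rinv_le_contravar; assumption. }
    assert (S6 : 0 <= mu n * / rho) by (apply Rmult_le_pos; [lra|apply Rlt_le, Rinv_0_lt_compat, Hr]).
    assert (S7 : mu n * / sqrt ((tau n + r) * Rabs (r - tau n)) <= mu n * (/ sqrt (tau n + rho) * / sqrt (Rabs (r - tau n))))
      by (apply Rmult_le_compat_l; lra).
    unfold Rdiv. nra.
  - assert (S1 : tau n / 2 <= sqrt (Rabs (tau n ^ 2 - r ^ 2))).
    { rewrite <- (sqrt_pow2 (tau n / 2)) by lra. apply sqrt_le_1_alt. rewrite Rabs_pos_eq; nra. }
    assert (S2 : / sqrt (Rabs (tau n ^ 2 - r ^ 2)) <= 2 * / tau n).
    { replace (2 * / tau n) with (/ (tau n / 2)) by (field; lra). apply Rinv_le_contravar; lra. }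
    assert (S7 : mu n * / sqrt (Rabs (tau n ^ 2 - r ^ 2)) <= mu n * (2 * / tau n))
      by (apply Rmult_le_compat_l; lra).
    rewrite Rmult_0_l. unfold Rdiv. nra.
Qed.

End Family.

Lemma psum_plus (f g : nat -> R) (n : nat) : psum (fun k => f k + g k) n = (psum f n + psum g n).
Proof. induction n as [|n IH]; simpl; [ring|rewrite IH; ring]. Qed.

Lemma RInt_circle_psum (c : nat -> R) (h : nat -> R -> R) (M : nat) : (forall n x, continuous (h n) x) ->
  (forall x, continuous (fun x => psum (fun n => c n * h n x) M) x) /\
  RInt (fun x => psum (fun n => c n * h n x) M) 0 (2 * PI) = psum (fun n => c n * RInt (h n) 0 (2 * PI)) M.
Proof.
  intro H. induction M as [|M [IH1 IH2]].
  - split; [intro; apply continuous_const|]. simpl. rewrite RInt_circle_const. ring.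
  - assert (CM : forall x, continuous (fun x => c M * h M x) x).
    { intro x. apply continuous_Rmult; [apply continuous_const|apply H]. }
    split; [intro x; apply continuous_Rplus; [apply IH1|apply CM]|].
    simpl psum. rewrite <- IH2, <- RInt_circle_scal by apply H. apply RInt_circle_plus; assumption.
Qed.

Local Open Scope C_scope.

(** * Means of the Cauchy transform over circles centred at c *)

Section Circle_means.

Variables (t : nat -> C) (A : C -> C) (mu : nat -> R) (c : C).
Hypothesis HT : CdB_data t A mu.
Hypothesis Hconv : convergence_class t mu.

Let tau (n : nat) : R := Cmod (t n - c).

Lemma tau_summable : ex_series (fun n => mu n / (tau n + 1))%R.
Proof.
  apply (ex_series_le (K := R_AbsRing) (V := R_CompleteNormedModule) _ (fun n => (1 + Cmod c) * (mu n / (Cmod (t n) + 1)))%R).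
  - intro n. change (Rabs (mu n / (tau n + 1)) <= (1 + Cmod c) * (mu n / (Cmod (t n) + 1))).
    assert (Hm : 0 < mu n) by apply HT. pose proof (Cmod_ge_0 (t n)) as H1. pose proof (Cmod_ge_0 (t n - c)) as H2.
    pose proof (Cmod_ge_0 c) as H3. unfold tau.
    assert (P1 : 0 < / (Cmod (t n - c) + 1)) by (apply Rinv_0_lt_compat; lra).
    rewrite Rabs_pos_eq by (apply Rmult_le_pos; lra).
    replace ((1 + Cmod c) * (mu n / (Cmod (t n) + 1)))%R with (mu n * (/ ((Cmod (t n) + 1) / (1 + Cmod c))))%R by (field; lra).
    apply Rmult_le_compat_l; [lra|]. apply Rinv_le_contravar; [apply Rdiv_lt_0_compat; lra|].
    apply Rle_div_l; [lra|].
    pose proof (Cmod_sub_ge (t n) c). nra.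
  - apply (ex_series_Rscal _ _ Hconv).
Qed.

Lemma tau_escape (rho : R) : exists M, forall n, (M <= n)%nat -> rho < tau n.
Proof.
  destruct (points_escape t A mu HT (rho + Cmod c)) as [M HM]. exists M.
  intros n Hn. specialize (HM n Hn). unfold tau. pose proof (Cmod_sub_ge (t n) c). lra.
Qed.

Lemma A_circle_neq0 (r x : R) : 0 < r -> (forall n, r <> tau n) -> A (c + circ r x) <> 0.
Proof.
  intros Hr H E. apply (A_zero t A mu HT) in E. destruct E as [n E]. apply (H n).
  unfold tau. rewrite <- E. replace (c + circ r x - c) with (circ r x) by ring. symmetry. apply Cmod_circ. lra.
Qed.

(** Off the points the transform is B_0 / A, a quotient of entire functions with nonzero
    denominator. *)
Lemma Ccont_ctransform_circ (r : R) : 0 < r -> (forall n, r <> tau n) ->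
  Ccont (fun x => ctransform t mu (c + circ r x)).
Proof.
  intros Hr H x.
  assert (E : forall y, Bgam t A mu 0 (c + circ r y) / A (c + circ r y) = ctransform t mu (c + circ r y)).
  { intro y. pose proof (A_circle_neq0 r y Hr H) as N.
    rewrite (Bgam_off t A mu HT Hconv 0 _ N). field. exact N. }
  apply (continuous_ext (T := R_UniformSpace) (U := C_UniformSpace) (fun x => Bgam t A mu 0 (c + circ r x) / A (c + circ r x))).
  - exact E.
  - apply continuous_Cdiv; [| |apply A_circle_neq0; assumption].
    + apply (Ccont_entire_circ (fun z => Bgam t A mu 0 (c + z))).
      apply entire_shift, (Bgam_entire t A mu HT Hconv).
    + apply (Ccont_entire_circ (fun z => A (c + z))). apply entire_shift, (A_entire t A mu HT).
Qed.

Lemma ctransform_mean (r T : R) (M : nat) : 1 <= r -> (forall n, r <> tau n) ->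
  (forall n, (M <= n)%nat -> 2 * r < tau n) ->
  (Rabs (Series (tail M (fun n => mu n / (tau n + 1)))) <= T)%R ->
  (RInt (fun x => Cmod (ctransform t mu (c + circ r x)%C)) 0 (2 * PI) <=
   psum (fun n => mu n * RInt (fun x => / Cmod (t n - c - circ r x)%C) 0 (2 * PI)) M + 2 * PI * (8 * T))%R.
Proof.
  intros Hr Hne Hfar HTl. pose proof two_PI_pos as Hpi.
  assert (Cf := Ccont_ctransform_circ r ltac:(lra) Hne). set (m := fun n => (mu n / (tau n + 1))%R) in *.
  assert (HS : ex_series (fun k => 4 * tail M m k)%R) by (apply ex_series_Rscal, (ex_series_incr_n m M), tau_summable).
  assert (Pt : forall x, (Cmod (ctransform t mu (c + circ r x)%C) <=
     psum (fun n => mu n * / Cmod (t n - c - circ r x)%C) M + 8 * T)%R).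
  { intro x. set (z := c + circ r x).
    (* Here |t n - z| >= tau n - r > tau n / 2 and tau n > 2, so the constant 4 is enough;
       [CSeries_bound] doubles it, hence 8 T. *)
    assert (Tb : forall n, (M <= n)%nat -> Cmod (RtoC (mu n) / (t n - z)) <= 4 * m n).
    { intros n Hn. specialize (Hfar n Hn). assert (Hm : 0 < mu n) by apply HT.
      assert (D : tau n / 2 < Cmod (t n - z)).
      { unfold z. replace (t n - (c + circ r x)) with (t n - c - circ r x) by ring.
        pose proof (Cmod_sub_ge (t n - c) (circ r x)) as G. rewrite Cmod_circ in G by lra. fold (tau n) in G. lra. }
      rewrite Cmod_div by (apply Cmod_gt_0; lra). rewrite Cmod_R, Rabs_pos_eq by lra.
      unfold m. replace (4 * (mu n / (tau n + 1)))%R with (mu n * / ((tau n + 1) / 4))%R by (field; lra).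
      apply Rmult_le_compat_l; [lra|]. apply Rinv_le_contravar; lra. }
    assert (Tb' : forall k, Cmod (tail M (fun n => RtoC (mu n) / (t n - z)) k) <= 4 * tail M m k)
      by (intro; apply Tb, Nat.le_add_r).
    pose proof (is_CSeries_split M _ _ (is_CSeries_dom _ _ Tb' HS)) as Sp.
    unfold ctransform. rewrite (is_CSeries_unique _ _ Sp).
    eapply Rle_trans; [apply Cmod_triangle|]. apply Rplus_le_compat.
    - apply Cmod_csum_le. intros n _.
      assert (Hm : 0 < mu n) by apply HT.
      assert (N : t n - z <> 0).
      { intro E. apply (Hne n). unfold tau. replace (t n - c) with (circ r x).
        - rewrite Cmod_circ; lra.
        - apply Ceq_sub0. replace (circ r x - (t n - c)) with (- (t n - z)) by (unfold z; ring). rewrite E. ring. }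
      rewrite Cmod_div by exact N. rewrite Cmod_R, Rabs_pos_eq by lra.
      right. unfold Rdiv. f_equal. f_equal. f_equal. unfold z. ring.
    - eapply Rle_trans; [apply (CSeries_bound _ _ Tb' HS)|]. rewrite Series_scal_l. change (fun n => tail M m n) with (tail M m).
      apply Rabs_le_between in HTl. lra. }
  assert (Ct : forall n x, continuous (fun x => / Cmod (t n - c - circ r x)%C)%R x).
  { intros n x. apply continuous_inv_dist; [lra|]. fold (tau n). intro E. apply (Hne n). congruence. }
  destruct (RInt_circle_psum mu (fun n x => / Cmod (t n - c - circ r x)%C)%R M Ct) as [C1 C2].
  rewrite <- C2, <- (RInt_circle_const (8 * T)), <- RInt_circle_plus; [|exact C1|intro; apply continuous_const].
  apply RInt_circle_le; [ccont| |exact Pt].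
  intro x. apply continuous_Rplus; [apply C1|apply continuous_const].
Qed.

End Circle_means.

Lemma good_circle (t : bool -> nat -> C) (A : bool -> C -> C) (mu : bool -> nat -> R) (c : C) (eps rho0 : R) :
  (forall i, CdB_data (t i) (A i) (mu i)) -> (forall i, convergence_class (t i) (mu i)) -> 0 < eps ->
  exists r, rho0 <= r /\ 1 <= r /\ forall i, (forall n, r <> Cmod (t i n - c)%C) /\
    RInt (fun x => Cmod (ctransform (t i) (mu i) (c + circ r x)%C)) 0 (2 * PI) <= eps.
Proof.
  intros HT Hc He. pose proof two_PI_pos as Hpi.
  set (tau := fun i n => Cmod (t i n - c)).
  assert (Hmu : forall i n, 0 < mu i n) by (intro i; apply HT).
  assert (Ht : forall i n, 0 <= tau i n) by (intros; apply Cmod_ge_0).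
  (* 34 = 24 + 2 + 8: from [radius_choice] with B = 6 rho e, from the [inv_max] terms of
     [mean_inv_dist_weight], and from the tail in [ctransform_mean]. *)
  set (e := (eps / (2 * PI * 34))%R). assert (Pe : 0 < e) by (apply Rdiv_lt_0_compat; lra).
  (* Each threshold condition is stable under increase, so the two families can share the larger
     one. *)
  assert (Both : forall P : bool -> R -> Prop, (forall i x y, x <= y -> P i x -> P i y) ->
    (forall i, exists x, P i x) -> exists x, forall i, P i x).
  { intros P Mon Ex. destruct (Ex true) as [x Hx], (Ex false) as [y Hy]. exists (Rmax x y).
    intros []; [apply (Mon _ x); [apply Rmax_l|exact Hx]|apply (Mon _ y); [apply Rmax_r|exact Hy]]. }
  destruct (Both (fun i x => forall rho M, 1 <= rho -> x <= rho ->
    (psum (fun n => mu i n * inv_max (tau i) rho n) M <= e)%R)) as [r1 B1].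
  { intros i x y Hxy H rho M H1 Hy. apply H; lra. }
  { intro i. destruct (inv_max_small (mu i) (tau i) (Hmu i) (Ht i) (tau_summable _ _ _ c (HT i) (Hc i)) e Pe) as [r1 [_ H]].
    exists r1. intros. apply H. assumption. }
  set (rho := Rmax 1 (Rmax r1 rho0)).
  assert (L0 : 1 <= rho) by apply Rmax_l.
  assert (L1 : r1 <= rho) by (eapply Rle_trans; [apply Rmax_l|apply Rmax_r]).
  assert (L2 : rho0 <= rho) by (eapply Rle_trans; [apply Rmax_r|apply Rmax_r]).
  (* The length of the head depends on [rho] and is fixed before r; it passes through [INR] so that
     [Both] applies again. *)
  destruct (Both (fun i x => forall M, x <= INR M -> (forall n, (M <= n)%nat -> 4 * rho < tau i n) /\
    (Rabs (Series (tail M (fun n => mu i n / (tau i n + 1)))) <= e)%R)) as [x HM].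
  { intros i x y Hxy H M Hy. apply H. lra. }
  { intro i. destruct (tau_escape _ _ _ c (HT i) (4 * rho)) as [M1 F1].
    destruct (series_tail_small _ e (tau_summable _ _ _ c (HT i) (Hc i)) Pe) as [M2 F2].
    exists (INR (M1 + M2)). intros M H. apply INR_le in H.
    split; [intros n Hn; apply F1; lia|apply F2; lia]. }
  destruct (INR_unbounded x) as [M HMx]. specialize (fun i => HM i M (Rlt_le _ _ HMx)). clear x HMx.
  destruct (radius_choice (fun i => near_weight (mu i) (tau i) rho) tau M rho (6 * rho * e)) as [r [Hr RB]].
  { lra. } { intros i n. apply near_weight_nonneg; auto; lra. }
  { assert (RW : forall i, psum (root_weight (near_weight (mu i) (tau i) rho) (tau i) rho) M <= 3 * rho * e).
    { intro i. eapply Rle_trans; [apply psum_le; intros n _; apply root_weight_near; auto; lra|].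
      rewrite psum_scal. apply Rmult_le_compat_l; [lra|]. apply B1; assumption. }
    pose proof (RW true). pose proof (RW false). lra. }
  exists r. split; [lra|]. split; [lra|]. intro i. destruct (HM i) as [Far Tail]. destruct (RB i) as [Ne Sum].
  assert (NE : forall n, r <> tau i n).
  { intros n E. destruct (Rlt_dec (tau i n) (4 * rho)) as [L|L]; [|lra].
    destruct (Compare_dec.le_lt_dec M n) as [Hn|Hn]; [specialize (Far n Hn); lra|].
    apply (Ne n Hn); [apply near_weight_pos; auto; lra|exact E]. }
  split; [exact NE|].
  eapply Rle_trans; [apply (ctransform_mean _ _ _ c (HT i) (Hc i) r e M); [lra|exact NE| |exact Tail]|].
  { intros n Hn. specialize (Far n Hn). unfold tau in Far. lra. }
  assert (Fin : (psum (fun n => mu i n * RInt (fun x => / Cmod (t i n - c - circ r x)%C) 0 (2 * PI)) M <= 2 * PI * (26 * e))%R).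
  { apply Rle_trans with (psum (fun n => 2 * PI * (near_weight (mu i) (tau i) rho n * / sqrt (Rabs (r - tau i n))
      + 2 * (mu i n * inv_max (tau i) rho n)))%R M).
    - apply psum_le. intros n _. apply mean_inv_dist_weight; auto; lra.
    - rewrite psum_scal, psum_plus, psum_scal. apply Rmult_le_compat_l; [lra|].
      specialize (B1 i rho M L0 L1). replace (4 * (6 * rho * e) / rho)%R with (24 * e)%R in Sum by (field; lra). lra. }
  replace eps with (2 * PI * (26 * e) + 2 * PI * (8 * e))%R by (unfold e; field; lra). lra.
Qed.

(** * The ratio of the two quotients *)

(** For r >= 1, 1 + |c| + r <= (2 + |c|) r absorbs the change of centre, and replacing K by |K| + 1
    makes its logarithm nonnegative. *)
Lemma finite_order_circle (A : C -> C) (c : C) : finite_order A ->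
  exists K N, 0 <= K /\ forall r x, 1 <= r -> Cmod (A (c + circ r x)%C) <= exp (K * r ^ N).
Proof.
  intros [K [N H]]. pose proof (Cmod_ge_0 c) as Hc.
  set (K' := (Rabs K + 1)%R). assert (HK : 1 <= K') by (pose proof (Rabs_pos K); unfold K'; lra).
  assert (HlnK : 0 <= ln K').
  { rewrite <- ln_1. apply ln_le; lra. }
  exists (ln K' + (2 + Cmod c) ^ N)%R, N. split.
  { assert (0 <= (2 + Cmod c) ^ N) by (apply pow_le; lra). lra. }
  intros r x Hr. eapply Rle_trans; [apply H|].
  assert (HrN : 1 <= r ^ N) by (apply pow_R1_Rle, Hr).
  apply Rle_trans with (K' * exp ((2 + Cmod c) ^ N * r ^ N))%R.
  - apply Rle_trans with (K' * exp ((1 + Cmod (c + circ r x)) ^ N))%R.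
    + apply Rmult_le_compat_r; [apply Rlt_le, exp_pos|]. unfold K'. pose proof (Rle_abs K). lra.
    + apply Rmult_le_compat_l; [lra|].
      assert (L : (1 + Cmod (c + circ r x)) ^ N <= (2 + Cmod c) ^ N * r ^ N).
      { rewrite <- Rpow_mult_distr. apply pow_incr. pose proof (Cmod_ge_0 (c + circ r x)).
        pose proof (Cmod_triangle c (circ r x)) as T. rewrite (Cmod_circ r x) in T by lra. nra. }
      apply exp_le_compat, L.
  - rewrite Rmult_plus_distr_r, exp_plus. rewrite <- (exp_ln K') at 1 by lra.
    apply Rmult_le_compat_r; [apply Rlt_le, exp_pos|].
    apply exp_le_compat. nra.
Qed.

Lemma ln_le_sub1 (x : R) : 0 < x -> ln x <= x - 1.
Proof.
  intro H. pose proof (exp_ineq1_le (ln x)) as E. rewrite exp_ln in E by exact H. lra.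
Qed.

Lemma abs_ln_Cmod_add (a f : C) : a <> 0 -> Cmod f <= Cmod a / 2 ->
  Rabs (ln (Cmod (a + f)%C) - ln (Cmod a)) <= 2 * (Cmod f / Cmod a).
Proof.
  intros Ha Hf. pose proof (Cmod_pos a Ha) as Pa. pose proof (Cmod_ge_0 f) as Pf.
  pose proof (Cmod_triangle a f) as T. pose proof (Cmod_add_ge a f) as T2.
  set (p := Cmod (a + f)) in *. set (q := Cmod a) in *. set (d := Cmod f) in *.
  assert (Pp : 0 < p) by lra.
  assert (U : ln p - ln q <= d / q).
  { rewrite <- ln_div by assumption. eapply Rle_trans; [apply ln_le_sub1, Rdiv_lt_0_compat; assumption|].
    replace (p / q - 1)%R with ((p - q) / q)%R by (field; lra).
    apply Rmult_le_compat_r; [apply Rlt_le, Rinv_0_lt_compat, Pa|lra]. }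
  assert (L : ln q - ln p <= 2 * (d / q)).
  { rewrite <- ln_div by assumption. eapply Rle_trans; [apply ln_le_sub1, Rdiv_lt_0_compat; assumption|].
    replace (q / p - 1)%R with ((q - p) / p)%R by (field; lra). apply Rle_div_l; [exact Pp|].
    replace (2 * (d / q) * p)%R with (d * (2 * p / q))%R by (field; lra).
    assert (1 <= 2 * p / q) by (apply Rle_div_r; lra). nra. }
  pose proof (Rdiv_le_0_compat d q Pf Pa). apply Rabs_le. lra.
Qed.

(** The identity bounds u from above by logarithms of the four factors, and |u| = 2 max(u, 0) - u
    does the rest. Only p and q, on the side of exp u, keep their logarithms; [eta] keeps these
    finite, and exp u * eta <= 1 makes the error it introduces harmless. *)
Lemma abs_le_of_ratio (u eta p q P Q : R) : 0 <= p -> 0 <= q -> 0 <= P -> 0 <= Q ->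
  0 < eta <= 1 -> exp u * eta <= 1 -> (exp u * (p * q) = P * Q)%R ->
  Rabs u <= 2 * (P + Q + p + q - ln (p + eta) - ln (q + eta)) - u.
Proof.
  intros Hp Hq HP HQ He He2 E.
  pose proof (ln_le_sub1 (p + eta) ltac:(lra)) as L1. pose proof (ln_le_sub1 (q + eta) ltac:(lra)) as L2.
  assert (P1 : 0 < (p + eta) * (q + eta)) by (apply Rmult_lt_0_compat; lra). pose proof (exp_pos u) as Pe.
  assert (X : exp u * ((p + eta) * (q + eta)) <= (1 + P) * (1 + Q) * ((1 + p) * (1 + q))).
  { replace (exp u * ((p + eta) * (q + eta)))%R with (P * Q + exp u * eta * (p + q + eta))%R by (rewrite <- E; ring).
    assert (exp u * eta * (p + q + eta) <= 1 * (p + q + 1)) by (apply Rmult_le_compat; nra).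
    assert (0 <= P * Q) by nra. assert (0 <= p * q) by nra.
    apply Rle_trans with ((1 + P * Q) * ((1 + p) * (1 + q)))%R; [nra|apply Rmult_le_compat_r; nra]. }
  apply ln_le in X; [|nra]. rewrite !ln_mult, ln_exp in X by (try apply Rmult_lt_0_compat; lra).
  pose proof (ln_le_sub1 (1 + P) ltac:(lra)). pose proof (ln_le_sub1 (1 + Q) ltac:(lra)).
  pose proof (ln_le_sub1 (1 + p) ltac:(lra)). pose proof (ln_le_sub1 (1 + q) ltac:(lra)).
  unfold Rabs. destruct (Rcase_abs u); lra.
Qed.

Lemma continuous_ln_shift (g : R -> C) (eta x : R) : 0 < eta -> Ccont g ->
  continuous (fun y => ln (Cmod (g y) + eta)) x.
Proof.
  intros He Cg. pose proof (Cmod_ge_0 (g x)).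
  apply (continuous_comp (fun y => Cmod (g y) + eta)%R ln); [ccont|].
  apply continuity_pt_filterlim, derivable_continuous_pt. exists (/ (Cmod (g x) + eta))%R.
  apply derivable_pt_lim_ln. lra.
Qed.

(** Jensen's inequality for B_gamma at c, with the continuous majorant ln(|gamma + f| + eta) + K r^N
    of ln |B_gamma|, where K r^N bounds ln |A|. The resulting constants depend on neither r nor
    [eta]. *)
Lemma mean_ln_lower (t : nat -> C) (A : C -> C) (mu : nat -> R) (c gamma : C) :
  CdB_data t A mu -> convergence_class t mu -> finite_order A -> Bgam t A mu gamma c <> 0 ->
  exists K N, 0 <= K /\ forall r eta, 1 <= r -> (forall n, r <> Cmod (t n - c)%C) -> 0 < eta ->
    - (K * r ^ N) <= RInt (fun x => ln (Cmod (gamma + ctransform t mu (c + circ r x))%C + eta)) 0 (2 * PI).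
Proof.
  intros HT Hc Hf H0. destruct (finite_order_circle A c Hf) as [K [N [HK HA]]]. pose proof two_PI_pos as Hpi.
  set (B := fun w => Bgam t A mu gamma (c + w)).
  assert (EB : entire B) by apply entire_shift, (Bgam_entire t A mu HT Hc).
  assert (B0 : B 0 <> 0) by (unfold B; rewrite Cplus_0_r; exact H0).
  set (k := (2 * PI * ln (Cmod (B 0)))%R). pose proof (Rabs_pos k) as Pk.
  assert (PK : 0 <= 2 * PI * K) by (apply Rmult_le_pos; lra).
  exists (Rabs k + 2 * PI * K)%R, N. split; [lra|].
  intros r eta Hr Hne He. set (q := fun x => gamma + ctransform t mu (c + circ r x)).
  assert (Cf := Ccont_ctransform_circ t A mu c HT Hc r ltac:(lra) Hne).
  assert (Cq : Ccont q) by (unfold q; ccont). assert (Cl := fun x => continuous_ln_shift q eta x He Cq).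
  assert (L : k <= RInt (fun x => ln (Cmod (q x) + eta) + K * r ^ N)%R 0 (2 * PI)).
  { apply (ln_submean B _ r EB B0); [lra|ccont| |].
    - intro x. unfold q. rewrite circ_2PI. reflexivity.
    - intro x. pose proof (Cmod_ge_0 (q x)) as Pq. rewrite exp_plus, exp_ln by lra.
      unfold B. rewrite (Bgam_off t A mu HT Hc) by (apply (A_circle_neq0 t A mu c HT); [lra|exact Hne]).
      rewrite Cmod_mult, Rmult_comm. apply Rmult_le_compat; try apply Cmod_ge_0; [unfold q; lra|apply HA, Hr]. }
  rewrite RInt_circle_plus, RInt_circle_const in L by ccont.
  change (- ((Rabs k + 2 * PI * K) * r ^ N) <= RInt (fun x => ln (Cmod (q x) + eta)) 0 (2 * PI)).
  assert (1 <= r ^ N) by apply pow_R1_Rle, Hr. pose proof (Rle_abs (- k)). rewrite Rabs_Ropp in *. nra.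
Qed.

(** * The ratio of the two zero-free quotients is identically 1 *)

Section Ratio.

Variables (t : nat -> C) (A : C -> C) (mu : nat -> R) (t' : nat -> C) (A' : C -> C) (mu' : nat -> R).
Hypothesis HT : CdB_data t A mu.
Hypothesis HT' : CdB_data t' A' mu'.
Hypothesis Hc : convergence_class t mu.
Hypothesis Hc' : convergence_class t' mu'.
Hypothesis Hf : finite_order A.
Hypothesis Hf' : finite_order A'.
Variables (alpha beta : C) (Sa Sb : C -> C).
Hypothesis Ha : alpha <> 0.
Hypothesis Hb : beta <> 0.
Hypothesis HSa : entire Sa.
Hypothesis HSb : entire Sb.
Hypothesis Sa_neq0 : forall z, Sa z <> 0.
Hypothesis Sb_neq0 : forall z, Sb z <> 0.
Hypothesis ESa : forall z, Bgam t' A' mu' alpha z = Sa z * Bgam t A mu alpha z.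
Hypothesis ESb : forall z, Bgam t' A' mu' beta z = Sb z * Bgam t A mu beta z.

(** At this centre every B_gamma of the first space is nonzero, and so is B~_beta, being a zero-free
    multiple of B_beta. *)
Let c : C := t O.
Let f (r x : R) : C := ctransform t mu (c + circ r x).
Let f' (r x : R) : C := ctransform t' mu' (c + circ r x).

Variable phi : C -> C.
Hypothesis Hphi : entire phi.
Hypothesis Ephi : forall w, Sa (c + w) * / Sb (c + w) = Cexp (phi w).

Definition off_points (r : R) : Prop :=
  (1 <= r) /\ (forall n, r <> Cmod (t n - c)%C) /\ (forall n, r <> Cmod (t' n - c)%C).

Lemma ratio_identity (r x : R) : off_points r ->
  Cexp (phi (circ r x)) * ((alpha + f r x) * (beta + f' r x)) = (alpha + f' r x) * (beta + f r x).
Proof.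
  intros [Hr [N N']]. rewrite <- Ephi. unfold f, f'. set (z := c + circ r x).
  assert (NA : A z <> 0) by (apply (A_circle_neq0 t A mu c HT); [lra|exact N]).
  assert (NA' : A' z <> 0) by (apply (A_circle_neq0 t' A' mu' c HT'); [lra|exact N']).
  pose proof (ESa z) as E1. pose proof (ESb z) as E2.
  rewrite (Bgam_off t A mu HT Hc), (Bgam_off t' A' mu' HT' Hc') in E1, E2 by assumption.
  set (F := ctransform t mu z) in *. set (F' := ctransform t' mu' z) in *.
  specialize (Sb_neq0 z).
  assert (X1 : alpha + F' = Sa z * (A z * (alpha + F)) / A' z) by (rewrite <- E1; field; exact NA').
  assert (X2 : beta + F' = Sb z * (A z * (beta + F)) / A' z) by (rewrite <- E2; field; exact NA').
  rewrite X1, X2. field. split; assumption.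
Qed.

Lemma Ccont_f (r : R) : off_points r -> Ccont (f r).
Proof. intros [Hr [N _]]. apply (Ccont_ctransform_circ t A mu c HT Hc); [lra|exact N]. Qed.

Lemma Ccont_f' (r : R) : off_points r -> Ccont (f' r).
Proof. intros [Hr [_ N]]. apply (Ccont_ctransform_circ t' A' mu' c HT' Hc'); [lra|exact N]. Qed.

Lemma mean_abs_Re_phi_growth : exists K N, 0 <= K /\ forall r, off_points r ->
  RInt (fun x => Cmod (f r x)) 0 (2 * PI) <= 1 -> RInt (fun x => Cmod (f' r x)) 0 (2 * PI) <= 1 ->
  RInt (fun x => Rabs (Re (phi (circ r x)))) 0 (2 * PI) <= K * r ^ N.
Proof.
  assert (B0 := Bgam_at_neq0 t A mu HT Hc). pose proof two_PI_pos as Hpi.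
  destruct (mean_ln_lower t A mu c alpha HT Hc Hf (B0 alpha O)) as [K1 [N1 [HK1 G1]]].
  destruct (mean_ln_lower t' A' mu' c beta HT' Hc' Hf') as [K2 [N2 [HK2 G2]]].
  { rewrite ESb. apply Cmult_neq_0; [apply Sb_neq0|apply B0]. }
  (* Collects the terms without growth: the moduli of alpha and beta, 4 + 4 from the means of |f|
     and |f~|, and the integral of - Re phi. *)
  set (k0 := (2 * PI * (4 * (Cmod alpha + Cmod beta)) + 8 - 2 * PI * Re (phi 0))%R).
  exists (Rabs k0 + 2 * K1 + 2 * K2)%R, (N1 + N2)%nat. pose proof (Rabs_pos k0).
  split; [lra|]. intros r Hr M1 M2. pose proof Hr as [Hr1 [N N']].
  set (u := fun x => Re (phi (circ r x))).
  assert (Cu : forall x, continuous u x) by (intro x; apply continuous_Re_circ, Hphi).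
  destruct (entire_bounded_circle phi r Hphi) as [Mp HMp].
  (* Depends on r through the maximum of |phi| on the circle, which is allowed because the lower
     bounds [G1] and [G2] are uniform in [eta]. *)
  set (eta := exp (- Rmax 0 Mp)).
  assert (Heta : 0 < eta <= 1).
  { split; [apply exp_pos|]. unfold eta. rewrite <- exp_0. pose proof (Rmax_l 0 Mp).
    apply exp_le_compat. lra. }
  assert (Hue : forall x, exp (u x) * eta <= 1).
  { intro x. unfold eta. rewrite <- exp_plus, <- exp_0. apply exp_le_compat.
    pose proof (Rmax_r 0 Mp). pose proof (re_le_Cmod (phi (circ r x))) as B. pose proof (Rle_abs (Re (phi (circ r x)))).
    specialize (HMp (circ r x) (Cmod_circ r x ltac:(lra))). unfold u. lra. }
  assert (Cf := Ccont_f r Hr). assert (Cf' := Ccont_f' r Hr).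
  set (a := fun x => alpha + f r x). set (b' := fun x => beta + f' r x).
  assert (Ca : Ccont a) by (unfold a; ccont). assert (Cb' : Ccont b') by (unfold b'; ccont).
  set (l1 := fun x => ln (Cmod (a x) + eta)). set (l2 := fun x => ln (Cmod (b' x) + eta)).
  assert (Cl1 : forall x, continuous l1 x) by (intro x; apply continuous_ln_shift; [lra|exact Ca]).
  assert (Cl2 : forall x, continuous l2 x) by (intro x; apply continuous_ln_shift; [lra|exact Cb']).
  assert (ML1 : - (K1 * r ^ N1) <= RInt l1 0 (2 * PI)) by (apply G1; [exact Hr1|exact N|lra]).
  assert (ML2 : - (K2 * r ^ N2) <= RInt l2 0 (2 * PI)) by (apply G2; [exact Hr1|exact N'|lra]).
  set (F := fun x => Cmod (f r x)). set (F' := fun x => Cmod (f' r x)).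
  assert (CF : forall x, continuous F x) by (intro x; apply continuous_Cmod, Cf).
  assert (CF' : forall x, continuous F' x) by (intro x; apply continuous_Cmod, Cf').
  assert (Pt : forall x, Rabs (u x) <= 4 * (Cmod alpha + Cmod beta) + (4 * F x + (4 * F' x + (-2 * l1 x + (-2 * l2 x + -1 * u x))))).
  { intro x.
    assert (E : (exp (u x) * (Cmod (a x) * Cmod (b' x)) = Cmod (alpha + f' r x)%C * Cmod (beta + f r x)%C)%R).
    { unfold u. rewrite <- Cmod_Cexp, <- !Cmod_mult. f_equal. apply ratio_identity, Hr. }
    pose proof (abs_le_of_ratio (u x) eta _ _ _ _ (Cmod_ge_0 _) (Cmod_ge_0 _) (Cmod_ge_0 _) (Cmod_ge_0 _) Heta (Hue x) E) as B.
    pose proof (Cmod_triangle alpha (f' r x)). pose proof (Cmod_triangle beta (f r x)).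
    pose proof (Cmod_triangle alpha (f r x)). pose proof (Cmod_triangle beta (f' r x)).
    unfold l1, l2, F, F'. fold (a x) (b' x) in *. lra. }
  assert (Int : (RInt (fun x => Rabs (u x)) 0 (2 * PI) <=
     RInt (fun x => 4 * (Cmod alpha + Cmod beta) + (4 * F x + (4 * F' x + (-2 * l1 x + (-2 * l2 x + -1 * u x))))) 0 (2 * PI))%R).
  { apply RInt_circle_le; [ccont|ccont|exact Pt]. }
  rewrite (RInt_circle_plus (fun _ => 4 * (Cmod alpha + Cmod beta))%R), (RInt_circle_plus (fun x => 4 * F x)%R),
    (RInt_circle_plus (fun x => 4 * F' x)%R), (RInt_circle_plus (fun x => -2 * l1 x)%R),
    (RInt_circle_plus (fun x => -2 * l2 x)%R), !RInt_circle_scal, RInt_circle_const in Int by ccont.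
  unfold u at 2 in Int. rewrite (entire_RInt_Re phi r Hphi) in Int by lra.
  change (RInt F 0 (2 * PI) <= 1) in M1. change (RInt F' 0 (2 * PI) <= 1) in M2.
  assert (R1 : r ^ N1 <= r ^ (N1 + N2)) by (apply Rle_pow; [exact Hr1|lia]).
  assert (R2 : r ^ N2 <= r ^ (N1 + N2)) by (apply Rle_pow; [exact Hr1|lia]).
  assert (R0 : 1 <= r ^ (N1 + N2)) by (apply pow_R1_Rle, Hr1).
  assert (X1 : K1 * r ^ N1 <= K1 * r ^ (N1 + N2)) by (apply Rmult_le_compat_l; assumption).
  assert (X2 : K2 * r ^ N2 <= K2 * r ^ (N1 + N2)) by (apply Rmult_le_compat_l; assumption).
  assert (X0 : k0 <= Rabs k0 * r ^ (N1 + N2)) by (pose proof (Rle_abs k0); nra).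
  change (RInt (fun x => Rabs (u x)) 0 (2 * PI) <= (Rabs k0 + 2 * K1 + 2 * K2) * r ^ (N1 + N2)).
  unfold k0 in X0 at 1. lra.
Qed.

Lemma good_radius (eps rho0 : R) : 0 < eps -> exists r, rho0 <= r /\ off_points r /\
  RInt (fun x => Cmod (f r x)) 0 (2 * PI) <= eps /\ RInt (fun x => Cmod (f' r x)) 0 (2 * PI) <= eps.
Proof.
  intro He. destruct (good_circle (fun i : bool => if i then t else t') (fun i : bool => if i then A else A')
    (fun i : bool => if i then mu else mu') c eps rho0) as [r [H1 [H2 H3]]]; [intros []; assumption..|exact He|].
  destruct (H3 true) as [N M], (H3 false) as [N' M'].
  exists r. unfold off_points. repeat split; assumption.
Qed.

(** A nonzero coefficient of index above N would make the mean of |Re phi| outgrow K r^N along the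
    available radii. *)
Lemma phi_coef_eventually_0 : exists N, forall n, (N < n)%nat -> coef phi n = 0.
Proof.
  destruct mean_abs_Re_phi_growth as [K [N [HK H]]]. exists N.
  intros [|n] Hn; [lia|]. apply Cmod_eq_0. apply Rle_antisym; [|apply Cmod_ge_0].
  apply Rnot_lt_le. intro P. set (m := Cmod (coef phi (S n))) in *.
  destruct (good_radius 1 ((K + 1) / m) ltac:(lra)) as [r [R1 [R2 [R3 R4]]]].
  specialize (H r R2 R3 R4). destruct R2 as [Hr _].
  pose proof (coef_le_mean_Re phi n r Hphi ltac:(lra)) as B. fold m in B.
  assert (Hrn : 0 < r ^ N) by (apply pow_lt; lra).
  assert (E : (r ^ S n = r ^ N * (r * r ^ (n - N)))%R).
  { replace (S n) with (N + S (n - N))%nat by lia. rewrite pow_add. reflexivity. }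
  assert (1 <= r ^ (n - N)) by (apply pow_R1_Rle, Hr).
  assert (m * r >= K + 1).
  { apply Rmult_le_compat_l with (r := m) in R1; [|lra]. replace (m * ((K + 1) / m))%R with (K + 1)%R in R1 by (field; lra). lra. }
  rewrite E in B.
  assert (r ^ N * (K + 1) <= r ^ N * (m * (r * r ^ (n - N)))).
  { apply Rmult_le_compat_l; [lra|]. nra. }
  nra.
Qed.

(** In the logarithm of the identity, alpha and beta each occur once on either side, so ln |alpha|
    and ln |beta| cancel; four differences remain, each linear in |f| or |f~|. *)
Lemma Re_phi_small (r x : R) : off_points r ->
  Cmod (f r x) <= Rmin (Cmod alpha) (Cmod beta) / 2 -> Cmod (f' r x) <= Rmin (Cmod alpha) (Cmod beta) / 2 ->
  Rabs (Re (phi (circ r x))) <= 2 * (/ Cmod alpha + / Cmod beta) * (Cmod (f r x) + Cmod (f' r x)).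
Proof.
  intros Hr H1 H2. pose proof (ratio_identity r x Hr) as E.
  pose proof (Rmin_l (Cmod alpha) (Cmod beta)). pose proof (Rmin_r (Cmod alpha) (Cmod beta)).
  pose proof (Cmod_pos alpha Ha) as Pa. pose proof (Cmod_pos beta Hb) as Pb.
  pose proof (abs_ln_Cmod_add alpha (f r x) Ha ltac:(lra)) as L1. pose proof (abs_ln_Cmod_add beta (f r x) Hb ltac:(lra)) as L2.
  pose proof (abs_ln_Cmod_add alpha (f' r x) Ha ltac:(lra)) as L3. pose proof (abs_ln_Cmod_add beta (f' r x) Hb ltac:(lra)) as L4.
  apply (f_equal Cmod) in E. rewrite !Cmod_mult, Cmod_Cexp in E.
  pose proof (Cmod_add_ge alpha (f r x)). pose proof (Cmod_add_ge alpha (f' r x)).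
  pose proof (Cmod_add_ge beta (f r x)). pose proof (Cmod_add_ge beta (f' r x)).
  apply (f_equal ln) in E. rewrite !ln_mult, ln_exp in E; try lra; try apply exp_pos; try (apply Rmult_lt_0_compat; lra).
  apply Rabs_le_between in L1. apply Rabs_le_between in L2. apply Rabs_le_between in L3. apply Rabs_le_between in L4.
  unfold Rdiv in *. apply Rabs_le. lra.
Qed.

Lemma phi_polynomial_bound (d : nat) : (forall n, (d < n)%nat -> coef phi n = 0) ->
  exists K, 1 <= K /\ forall r x, 1 <= r -> Cmod (phi (circ r x)) <= K * r ^ d.
Proof.
  intro Hd. set (K := (psum (fun n => Cmod (coef phi n)) (S d) + 1)%R). exists K.
  assert (PK : 0 <= psum (fun n => Cmod (coef phi n)) (S d)) by (apply psum_nonneg; intros; apply Cmod_ge_0).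
  split; [unfold K; lra|].
  intros r x Hr. set (w := circ r x). rewrite (entire_eq_PS phi w Hphi).
  assert (S : is_CSeries (fun n => coef phi n * w ^ n) (csum (fun n => coef phi n * w ^ n) (S d) + 0)).
  { apply is_CSeries_split. apply is_CSeries_ext with (fun k => 0 * (coef phi k * w ^ k)).
    - intro k. unfold tail; rewrite (Hd (S d + k)%nat) by lia. ring.
    - pose proof (is_CSeries_scal 0 _ _ (PS_ex (coef phi) w (superexp_decay_coef phi Hphi))) as E.
      rewrite (Cmult_0_l (PS _ _)) in E. exact E. }
  unfold PS. rewrite (is_CSeries_unique _ _ S), Cplus_0_r.
  assert (Hrd : 1 <= r ^ d) by (apply pow_R1_Rle, Hr).
  apply Rle_trans with (psum (fun n => r ^ d * Cmod (coef phi n)) (Datatypes.S d))%R.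
  - apply Cmod_csum_le. intros k Hk. rewrite Cmod_mult, Cmod_pow. unfold w. rewrite Cmod_circ by lra.
    rewrite Rmult_comm. apply Rmult_le_compat_r; [apply Cmod_ge_0|]. apply Rle_pow; [exact Hr|lia].
  - rewrite psum_scal. unfold K. nra.
Qed.

(** The coefficient bound and the mean of |Re phi| carry the same power of r; after cancelling it,
    the coefficient is at most a constant times the means of |f| and |f~|, which can be made
    arbitrarily small. *)
Lemma phi_coef_descend (d : nat) : (forall n, (S d < n)%nat -> coef phi n = 0) -> coef phi (S d) = 0.
Proof.
  intro Hd. destruct (phi_polynomial_bound (S d) Hd) as [K [HK HB]].
  pose proof (Cmod_pos alpha Ha) as Pa. pose proof (Cmod_pos beta Hb) as Pb.
  set (dl := (Rmin (Cmod alpha) (Cmod beta) / 2)%R).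
  assert (Hdl : 0 < dl) by (unfold dl; assert (0 < Rmin (Cmod alpha) (Cmod beta)) by (apply Rmin_glb_lt; assumption); lra).
  set (C2 := (2 * (/ Cmod alpha + / Cmod beta))%R).
  assert (HC2 : 0 < C2).
  { unfold C2. pose proof (Rinv_0_lt_compat _ Pa). pose proof (Rinv_0_lt_compat _ Pb). lra. }
  set (C3 := (C2 + / dl)%R). assert (Pid : 0 < / dl) by (apply Rinv_0_lt_compat, Hdl).
  apply Cmod_eq_0. apply Rle_antisym; [|apply Cmod_ge_0].
  apply le_epsilon. intros eps He. rewrite Rplus_0_l.
  assert (Pk : 0 < K * C3 * 2) by (unfold C3; apply Rmult_lt_0_compat; [apply Rmult_lt_0_compat; lra|lra]).
  destruct (good_radius (eps / (K * C3 * 2)) 1) as [r [_ [Hr [M1 M2]]]]; [apply Rdiv_lt_0_compat; lra|].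
  pose proof Hr as [Hr1 _].
  assert (Prd : 1 <= r ^ S d) by (apply pow_R1_Rle, Hr1).
  assert (Pt : forall x, Rabs (Re (phi (circ r x))) <= K * r ^ S d * C3 * (Cmod (f r x) + Cmod (f' r x))).
  { intro x. pose proof (Cmod_ge_0 (f r x)) as F0. pose proof (Cmod_ge_0 (f' r x)) as F0'.
    set (s := (Cmod (f r x) + Cmod (f' r x))%R) in *.
    assert (Hs : 0 <= s) by (unfold s; lra).
    assert (HK1 : 1 <= K * r ^ S d) by nra.
    (* For small s the logarithmic bound applies; otherwise s / dl >= 1, and the growth of phi is
       multiplied by it. [C3] adds the two constants. *)
    destruct (Rle_dec s dl) as [L|L].
    - eapply Rle_trans; [apply (Re_phi_small r x Hr); fold dl; unfold s in L; lra|]. fold C2 s.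
      apply Rle_trans with (C3 * s)%R; [unfold C3; nra|].
      assert (0 <= C3 * s) by (unfold C3; apply Rmult_le_pos; lra). nra.
    - eapply Rle_trans; [apply re_le_Cmod|]. eapply Rle_trans; [apply HB, Hr1|].
      assert (1 <= / dl * s).
      { apply Rmult_le_reg_l with dl; [exact Hdl|]. rewrite <- Rmult_assoc, Rinv_r; lra. }
      assert (1 <= C3 * s) by (unfold C3; nra). rewrite Rmult_assoc. nra. }
  assert (CF : forall x, continuous (fun x => Cmod (f r x)) x) by (intro x; apply continuous_Cmod, (Ccont_f r Hr)).
  assert (CF' : forall x, continuous (fun x => Cmod (f' r x)) x) by (intro x; apply continuous_Cmod, (Ccont_f' r Hr)).
  assert (I : (RInt (fun x => Rabs (Re (phi (circ r x)))) 0 (2 * PI) <=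
     RInt (fun x => K * r ^ S d * C3 * (Cmod (f r x) + Cmod (f' r x))) 0 (2 * PI))%R).
  { apply RInt_circle_le; [ccont|ccont|exact Pt]. }
  rewrite RInt_circle_scal, RInt_circle_plus in I by ccont.
  pose proof (coef_le_mean_Re phi d r Hphi ltac:(lra)) as B.
  assert (T : K * r ^ S d * C3 * (RInt (fun x => Cmod (f r x)) 0 (2 * PI) + RInt (fun x => Cmod (f' r x)) 0 (2 * PI))
     <= K * r ^ S d * C3 * (2 * (eps / (K * C3 * 2)))).
  { apply Rmult_le_compat_l; [|lra]. unfold C3. apply Rmult_le_pos; [apply Rmult_le_pos; lra|lra]. }
  replace (K * r ^ S d * C3 * (2 * (eps / (K * C3 * 2))))%R with (eps * r ^ S d)%R in T.
  - apply Rmult_le_reg_r with (r ^ S d)%R; [lra|]. lra.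
  - field. split; [unfold C3|]; lra.
Qed.

Lemma phi_constant (w : C) : phi w = phi 0.
Proof.
  destruct phi_coef_eventually_0 as [N HN].
  (* Downward induction: k counts the top degrees already removed. *)
  assert (H : forall k, (k <= N)%nat -> forall n, (N - k < n)%nat -> coef phi n = 0).
  { induction k as [|k IH]; intros Hk n Hn; [apply HN; lia|].
    destruct (Nat.eq_dec n (N - k)) as [->|Hne]; [|apply IH; lia].
    destruct (N - k)%nat as [|d] eqn:E; [lia|]. apply phi_coef_descend. intros m Hm. apply IH; lia. }
  assert (H0 : forall n, coef phi (S n) = 0) by (intro n; apply (H N); lia).
  rewrite (entire_eq_PS phi w Hphi), <- (coef_0 phi Hphi).
  destruct (PS_shift (coef phi) w (superexp_decay_coef phi Hphi)) as [HS ->].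
  replace (PS (fun n => coef phi (S n)) w) with (RtoC 0); [ring|].
  symmetry. apply is_CSeries_unique. apply is_CSeries_ext with (fun n => 0 * (coef phi (S n) * w ^ n)).
  - intro n. rewrite H0. ring.
  - pose proof (is_CSeries_scal 0 _ _ (PS_ex _ w HS)) as E. rewrite (Cmult_0_l (PS _ _)) in E. exact E.
Qed.

(** With the ratio a constant rho, the identity at a point where f and f~ are small reads alpha beta
    (rho - 1) = small. *)
Lemma ratio_is_1 (w : C) : Cexp (phi w) = 1.
Proof.
  rewrite phi_constant. set (rho := Cexp (phi 0)).
  pose proof (Cmod_pos alpha Ha) as Pa. pose proof (Cmod_pos beta Hb) as Pb. pose proof two_PI_pos as Hpi.
  apply Ceq_sub0. apply (Cmult_eq0_r (alpha * beta)); [|apply Cmult_neq_0; assumption].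
  apply Cmod_eq_0. apply Rle_antisym; [|apply Cmod_ge_0].
  apply le_epsilon. intros eps He. rewrite Rplus_0_l.
  set (Q := ((Cmod rho + 1) * (Cmod alpha + Cmod beta + 1))%R).
  assert (HQ : 1 <= Q) by (pose proof (Cmod_ge_0 rho); unfold Q; nra).
  set (e := Rmin 1 (eps / Q)). assert (Pe : 0 < e) by (apply Rmin_glb_lt; [lra|apply Rdiv_lt_0_compat; lra]).
  destruct (good_radius (e / 2) 1) as [r [_ [Hr [M1 M2]]]]; [lra|].
  assert (CF : forall x, continuous (fun x => Cmod (f r x)) x) by (intro x; apply continuous_Cmod, (Ccont_f r Hr)).
  assert (CF' : forall x, continuous (fun x => Cmod (f' r x)) x) by (intro x; apply continuous_Cmod, (Ccont_f' r Hr)).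
  (* Otherwise the integral of |f| + |f~| would be at least 2 pi e, while it is at most e. *)
  assert (Ex : exists x, Cmod (f r x) + Cmod (f' r x) <= e).
  { apply Classical_Prop.NNPP. intro Hn.
    assert (Hlt : forall x, e <= Cmod (f r x) + Cmod (f' r x)).
    { intro x. apply Rnot_lt_le. intro L. apply Hn. exists x. lra. }
    assert (I : RInt (fun _ => e) 0 (2 * PI) <= RInt (fun x => Cmod (f r x) + Cmod (f' r x))%R 0 (2 * PI)).
    { apply RInt_circle_le; [ccont|ccont|exact Hlt]. }
    rewrite RInt_circle_const, RInt_circle_plus in I by auto.
    pose proof PI2_1. nra. }
  destruct Ex as [x Hx].
  pose proof (ratio_identity r x Hr) as E. rewrite phi_constant in E. fold rho in E.
  set (F := f r x) in *. set (F' := f' r x) in *.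
  assert (Eq : alpha * beta * (rho - 1) = (alpha * F + beta * F' + F * F') - rho * (alpha * F' + beta * F + F * F')).
  { replace (alpha * beta * (rho - 1)) with (rho * ((alpha + F) * (beta + F')) - alpha * beta - rho * (alpha * F' + beta * F + F * F')) by ring.
    rewrite E. ring. }
  rewrite Eq. pose proof (Cmod_ge_0 F) as P1. pose proof (Cmod_ge_0 F') as P2. pose proof (Cmod_ge_0 rho) as P3.
  assert (He1 : e <= 1) by apply Rmin_l. assert (He2 : e <= eps / Q) by apply Rmin_r.
  assert (Bd : forall a b : C, Cmod (a * F + b * F' + F * F')%C <= Cmod a * Cmod F + Cmod b * Cmod F' + Cmod F * Cmod F').
  { intros a b. rewrite <- !Cmod_mult. pose proof (Cmod_triangle (a * F + b * F') (F * F')).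
    pose proof (Cmod_triangle (a * F) (b * F')). lra. }
  pose proof (Bd alpha beta) as B1. pose proof (Bd beta alpha) as B2.
  replace (alpha * F' + beta * F + F * F') with (beta * F + alpha * F' + F * F') by ring.
  set (s := (Cmod F + Cmod F')%R) in *.
  assert (FF : Cmod F * Cmod F' <= s) by (unfold s in *; nra).
  assert (G1 : Cmod (alpha * F + beta * F' + F * F')%C <= (Cmod alpha + Cmod beta + 1) * s) by (unfold s in *; nra).
  assert (G2 : Cmod (beta * F + alpha * F' + F * F')%C <= (Cmod alpha + Cmod beta + 1) * s) by (unfold s in *; nra).
  apply Rle_trans with (Q * s)%R.
  - pose proof (Cmod_triangle (alpha * F + beta * F' + F * F') (- (rho * (beta * F + alpha * F' + F * F')))) as T.
    rewrite Cmod_opp, (Cmod_mult rho) in T. unfold Cminus. eapply Rle_trans; [exact T|]. unfold Q.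
    apply Rmult_le_compat_l with (r := Cmod rho) in G2; [|exact P3]. lra.
  - apply Rle_trans with (Q * (eps / Q))%R; [apply Rmult_le_compat_l; lra|]. right. field. lra.
Qed.

End Ratio.

Theorem theorem1p6
  (t : nat -> C) (A : C -> C) (mu : nat -> R)
  (tt : nat -> C) (At : C -> C) (mut : nat -> R)
  (HT : CdB_data t A mu) (HTt : CdB_data tt At mut)
  (Hc : convergence_class t mu) (Hct : convergence_class tt mut)
  (Hf : CdB_finite_order A) (Hft : CdB_finite_order At)
  (alpha beta : C) (Ha : alpha <> 0) (Hb : beta <> 0) (Hab : alpha <> beta)
  (Hza : same_zeros (Bgam t A mu alpha) (Bgam tt At mut alpha))
  (Hzb : same_zeros (Bgam t A mu beta) (Bgam tt At mut beta)) :
  (forall z : C, (exists n, t n = z) <-> (exists m, tt m = z)) /\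
  (forall n m, t n = tt m -> mu n = mut m) /\
  (exists S : C -> C, entire S /\ (forall z, S z <> 0) /\
     forall z, At z = S z * A z).
Proof.
  destruct (zero_free_quotient _ _ (t O) (Bgam_entire t A mu HT Hc alpha) (Bgam_entire tt At mut HTt Hct alpha)
    (Bgam_at_neq0 t A mu HT Hc alpha 0) Hza) as [Sa [ESa [NSa QSa]]].
  destruct (zero_free_quotient _ _ (t O) (Bgam_entire t A mu HT Hc beta) (Bgam_entire tt At mut HTt Hct beta)
    (Bgam_at_neq0 t A mu HT Hc beta 0) Hzb) as [Sb [ESb [NSb QSb]]].
  destruct (entire_log (fun w => Sa (t O + w) * / Sb (t O + w))) as [phi [Ephi Hphi]].
  { apply (entire_shift (fun z => Sa z * / Sb z)). apply entire_mult; [exact ESa|apply entire_inv; assumption]. }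
  { intros w E. apply (NSa (t O + w)).
    replace (Sa (t O + w)) with (Sa (t O + w) * / Sb (t O + w) * Sb (t O + w)) by (field; apply NSb). rewrite E. ring. }
  assert (EqS : forall z, Sb z = Sa z).
  { intro z. pose proof (ratio_is_1 t A mu tt At mut HT HTt Hc Hct Hf Hft alpha beta Sa Sb Ha Hb NSb QSa QSb phi Ephi Hphi (z - t O)) as E.
    rewrite <- Hphi in E. replace (t O + (z - t O)) with z in E by ring.
    replace (Sa z) with (Sa z * / Sb z * Sb z) by (field; apply NSb). rewrite E. ring. }
  assert (EA : forall z, At z = Sa z * A z).
  { intro z. pose proof (QSa z) as E1. pose proof (QSb z) as E2. rewrite EqS in E2. unfold Bgam in E1, E2.
    apply Ceq_sub0. apply (Cmult_eq0_r (alpha - beta)).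
    (* The series in [Bgam] do not involve gamma, so they cancel as opaque values and no convergence
       is used. *)
    - set (X := CSeries _) in E1. set (Y := CSeries _) in E1. fold X Y in E2.
      replace ((alpha - beta) * (At z - Sa z * A z)) with
        ((alpha * At z + X - Sa z * (alpha * A z + Y)) - (beta * At z + X - Sa z * (beta * A z + Y))) by ring.
      rewrite E1, E2. ring.
    - intro E. apply Hab, Ceq_sub0, E. }
  split; [|split].
  - intro z. split.
    + intros [n <-]. assert (Z : At (t n) = 0).
      { rewrite EA. replace (A (t n)) with (RtoC 0); [ring|]. symmetry. apply (A_zero t A mu HT). exists n; reflexivity. }
      apply (A_zero tt At mut HTt) in Z. destruct Z as [m Em]. exists m. symmetry. exact Em.
    + intros [m <-]. assert (Z : At (tt m) = 0) by (apply (A_zero tt At mut HTt); exists m; reflexivity).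
      rewrite EA in Z. apply Cmult_eq0_r in Z; [|apply NSa].
      apply (A_zero t A mu HT) in Z. destruct Z as [n En]. exists n. symmetry. exact En.
  - intros n m E. pose proof (QSa (t n)) as Q. rewrite E in Q at 1.
    rewrite (Bgam_at tt At mut HTt Hct), (Bgam_at t A mu HT Hc) in Q.
    destruct (Bterm_at t A mu HT n) as [l [Nl [Dl El]]].
    destruct (Bterm_at tt At mut HTt m) as [l' [Nl' [Dl' El']]].
    rewrite El, El' in Q. rewrite <- E in Dl'.
    (* Product rule for A~ = S A at a zero of A: the term with S' drops. The same factor S(t n) A'(t
       n) then cancels from the two values of B. *)
    assert (L : l' = Sa (t n) * l).
    { pose proof ESa as ESa'. rewrite entire_cdiff in ESa'. destruct (ESa' (t n)) as [s Hs].
      pose proof (cdiff_mult _ _ _ _ _ Hs Dl) as D. cbv beta in D.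
      apply (cdiff_ext _ At) in D; [|intro; symmetry; apply EA].
      apply cdiff_is_derive, is_C_derive_unique in D. apply cdiff_is_derive, is_C_derive_unique in Dl'.
      rewrite <- Dl', D. replace (A (t n)) with (RtoC 0); [ring|].
      symmetry. apply (A_zero t A mu HT). exists n; reflexivity. }
    rewrite L in Q. apply RtoC_inj. symmetry. apply Ceq_sub0. apply (Cmult_eq0_r (Sa (t n) * l)).
    + replace (Sa (t n) * l * (RtoC (mut m) - RtoC (mu n))) with
        (Sa (t n) * (RtoC (mu n) * - l) - RtoC (mut m) * - (Sa (t n) * l)) by ring.
      rewrite Q. ring.
    + apply Cmult_neq_0; [apply NSa|exact Nl].
  - exists Sa. split; [exact ESa|]. split; [exact NSa|exact EA].
Qed.
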